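(* Let $B$ be a finite-dimensional Hopf algebra over a field $k$, and let $H$ be a braided Hopf algebra in the Yetter–Drinfeld category $({}^B_B\mathcal{YD},C)$ with $C_{H,H}=C_{H,H}^{-1}$ and with invertible antipode. Let $U$ be a braided Hopf subalgebra of the finite dual $H^\circ$, and assume that the $RL$-condition holds on $H$ and $U$ under the evaluation $\langle\,,\rangle_{ev}:U\otimes H\to k$. Let $(R,\psi)$ be a right $U$-comodule algebra in ${}^B_B\mathcal{YD}$, regarded as a left $H$-module algebra via $$\alpha=(R\otimes\langle\,,\rangle_{ev})(R\otimes C_{H,U})(C_{H,R}\otimes U)(H\otimes\psi),$$ and let $U$ act on $R\# H$ by acting trivially on $R$ and via $\rightharpoonup$ on $H$, i.e. via $(R\otimes\rightharpoonup)(C_{U,R}\otimes H)$. Then $$(R\# H)\# U\;\cong\; R\otimes (H\# U)\qquad\text{as }k\text{-algebras}.$$ Moreover, if $B$ is commutative and cocommutative, then this isomorphism is an isomorphism of algebras in ${}^B_B\mathcal{YD}$.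
   Context: ${}^B_B\mathcal{YD}$ is the category of left-left Yetter–Drinfeld modules over $B$ (left $B$-modules and left $B$-comodules $v\mapsto\sum v_{(-1)}\otimes v_{(0)}$ with $\sum(b\cdot v)_{(-1)}\otimes(b\cdot v)_{(0)}=\sum b_1v_{(-1)}S(b_3)\otimes b_2\cdot v_{(0)}$), with braiding $C_{V,W}(v\otimes w)=\sum v_{(-1)}\cdot w\otimes v_{(0)}$. A braided Hopf algebra in it is a Hopf algebra object; module algebras and comodule algebras are understood in ${}^B_B\mathcal{YD}$. For an object $W$ and a morphism $f$, $W\otimes f=\mathrm{id}_W\otimes f$, $f\otimes W=f\otimes\mathrm{id}_W$. Dual: for $V\in{}^B_B\mathcal{YD}$, $V^*=\mathrm{Hom}_k(V,k)$ is in ${}^B_B\mathcal{YD}$ with $(b\cdot f)(x)=f(S(b)\cdot x)$ and coaction determined by $\sum f_{(-1)}f_{(0)}(x)=\sum f(x_{(0)})S^{-1}(x_{(-1)})$; evaluation is then a morphism $V^*\otimes V\to k$. Finite dual: $H^\circ=\{f\in H^*\mid \ker f$ contains an ideal of $H$ of finite codimension which is a $B$-submodule and $B$-subcomodule of $H\}$, which is a braided Hopf algebra in ${}^B_B\mathcal{YD}$ with structure determined by $\langle\,,\rangle=\langle\,,\rangle_{ev}$ through $(\langle\,,\rangle\otimes\langle\,,\rangle)(H^\circ\otimes C\otimes H)(\Delta_{H^\circ}\otimes H\otimes H)=\langle\,,\rangle(H^\circ\otimes m_H)$, $\epsilon_{H^\circ}=\langle\,,\rangle(H^\circ\otimes\eta_H)$,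 $\langle\,,\rangle(m_{H^\circ}\otimes H)=(\langle\,,\rangle\otimes\langle\,,\rangle)(H^\circ\otimes C\otimes H)(H^\circ\otimes H^\circ\otimes\Delta_H)$, $\langle\,,\rangle(\eta_{H^\circ}\otimes H)=\epsilon_H$, $\langle\,,\rangle(S_{H^\circ}\otimes H)=\langle\,,\rangle(H^\circ\otimes S_H)$, where $C=C_{H^\circ,H}$. Smash product: for a left $K$-module algebra $(A,\alpha)$ over a braided Hopf algebra $K$, $A\# K$ is $A\otimes K$ with unit $\eta_A\otimes\eta_K$ and multiplication $(m_A\otimes m_K)(A\otimes\alpha\otimes K\otimes K)(A\otimes K\otimes C_{K,A}\otimes K)(A\otimes\Delta_K\otimes A\otimes K)$. $R\otimes(H\# U)$ is the braided tensor product algebra, with multiplication $(m_R\otimes m_{H\# U})(R\otimes C_{H\# U,R}\otimes (H\# U))$. Action: $H$ is a left $U$-module algebra via $\rightharpoonup\,=(H\otimes\langle\,,\rangle_{ev})(C_{U,H}\otimes H)(U\otimes\Delta_H)$; this defines $H\# U$, and $(R\# H)\# U$ is formed with the action of $U$ on $R\# H$ in the claim. $RL$-condition on $H$ and $U$ under $\langle\,,\rangle$: define $k$-linear maps $\lambda:H\otimes U\to\mathrm{End}_kH$ and $\rho:U\otimes H\to\mathrm{End}_kH$ by $\lambda(h\# f)(x)=(m\otimes\langle\,,\rangle)(H\otimes C\otimes H)(H\otimes U\otimes\Delta)(h\otimes f\otimes x)=\sum\langle f,x_{2(0)}\rangle\,h\,(S^{-1}(x_{2(-1)})\cdot x_1)$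 and $\rho(f\# h)(x)=\sum\langle f,h_{(-1)1}\cdot x_1\rangle\,(h_{(-1)2}\cdot x_2)\,h_{(0)}$, for $h,x\in H$, $f\in U$. The condition is $\rho(U\# 1)\subseteq\lambda(H\# U)$. *)

(* Defs.v *)
From HB Require Import structures.
From mathcomp Require Import all_boot all_order all_algebra all_field.
From mathcomp Require Import generic_quotient.
From mathcomp Require Import boolp classical_sets.

Set Implicit Arguments.
Unset Strict Implicit.
Unset Printing Implicit Defensive.

Import GRing.Theory.
Local Open Scope ring_scope.
Local Open Scope quotient_scope.

(* Tensor product over k of arbitrary (possibly infinite-dimensional) vector
   spaces: finite formal sums of pairs, two sums being identified when no
   bilinear map separates them. tsumE, tsum_is_linear and tens_span below give
   the universal property. *)
Section TensorProduct.
Variable k : fieldType.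

Definition bilin (V W Z : lmodType k) (f : V -> W -> Z) : Prop :=
  (forall w, linear (f^~ w)) /\ (forall v, linear (f v)).

Variables V W : lmodType k.

Definition fsum (Z : lmodType k) (f : V -> W -> Z) (s : seq (V * W)) : Z :=
  \sum_(p <- s) f p.1 p.2.

Definition tens_rel (s t : seq (V * W)) : bool :=
  `[< forall (Z : lmodType k) (f : V -> W -> Z),
        bilin f -> fsum f s = fsum f t >].

Lemma tens_rel_refl : reflexive tens_rel.
Proof. by move=> s; apply/asboolP. Qed.

Lemma tens_rel_sym : symmetric tens_rel.
Proof.
by move=> s t; apply/asboolP/asboolP => h Z f bf; rewrite (h Z f).
Qed.

Lemma tens_rel_trans : transitive tens_rel.
Proof.
move=> t s u /asboolP st /asboolP tu; apply/asboolP => Z f bf.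
by rewrite (st Z f) ?(tu Z f).
Qed.

Canonical tens_equiv :=
  EquivRel tens_rel tens_rel_refl tens_rel_sym tens_rel_trans.

Definition tens := {eq_quot tens_equiv}.
HB.instance Definition _ := Choice.on tens.
HB.instance Definition _ := EqQuotient.on tens.

Definition tpure (v : V) (w : W) : tens := \pi_tens [:: (v, w)].

(* For bilinear f, tsum f t = \sum f v w whenever t = \sum v (x) w. *)
Definition tsum (Z : lmodType k) (f : V -> W -> Z) (t : tens) : Z :=
  fsum f (repr t).

Lemma tsum_pi (Z : lmodType k) (f : V -> W -> Z) s :
  bilin f -> tsum f (\pi_tens s) = fsum f s.
Proof.
move=> bf; have /asboolP : tens_rel (repr (\pi_tens s)) s.
  by apply/eqmodP; rewrite reprK.
by apply.
Qed.

Lemma tens_eqP (x y : tens) :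
  (forall (Z : lmodType k) (f : V -> W -> Z), bilin f -> tsum f x = tsum f y) ->
  x = y.
Proof.
move=> h; rewrite -[x]reprK -[y]reprK; apply/eqmodP/asboolP => Z f bf.
exact: h.
Qed.

Definition tens_add (x y : tens) : tens := \pi_tens (repr x ++ repr y).
Definition tens_zero : tens := \pi_tens [::].
Definition tens_scale (a : k) (x : tens) : tens :=
  \pi_tens [seq (a *: p.1, p.2) | p <- repr x].
Definition tens_opp (x : tens) : tens := tens_scale (-1) x.

Lemma bilinZl (Z : lmodType k) (f : V -> W -> Z) a v w :
  bilin f -> f (a *: v) w = a *: f v w.
Proof.
case=> /(_ w) fl _; have f0 : f 0 w = 0.
  by have /eqP := fl 1 0 0; rewrite !scale1r addr0 -subr_eq subrr => /eqP <-.
by have := fl a v 0; rewrite !addr0 f0 addr0.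
Qed.

Section Sums.
Variables (Z : lmodType k) (f : V -> W -> Z).
Hypothesis bf : bilin f.

Lemma tsum_add x y : tsum f (tens_add x y) = tsum f x + tsum f y.
Proof. by rewrite tsum_pi // /fsum big_cat. Qed.

Lemma tsum_zero : tsum f tens_zero = 0.
Proof. by rewrite tsum_pi // /fsum big_nil. Qed.

Lemma tsum_scale a x : tsum f (tens_scale a x) = a *: tsum f x.
Proof.
rewrite tsum_pi // /fsum big_map scaler_sumr.
by apply: eq_bigr => p _; rewrite bilinZl.
Qed.

Lemma tsumE v w : tsum f (tpure v w) = f v w.
Proof. by rewrite tsum_pi // /fsum big_seq1. Qed.
End Sums.

Lemma tens_addA : associative tens_add.
Proof. by move=> x y z; apply: tens_eqP => Z f bf; rewrite !tsum_add ?addrA. Qed.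
Lemma tens_addC : commutative tens_add.
Proof. by move=> x y; apply: tens_eqP => Z f bf; rewrite !tsum_add // addrC. Qed.
Lemma tens_add0 : left_id tens_zero tens_add.
Proof.
by move=> x; apply: tens_eqP => Z f bf; rewrite tsum_add // tsum_zero ?add0r.
Qed.
Lemma tens_addN : left_inverse tens_zero tens_opp tens_add.
Proof.
move=> x; apply: tens_eqP => Z f bf.
by rewrite tsum_add // tsum_scale // tsum_zero // scaleN1r addNr.
Qed.

HB.instance Definition _ :=
  GRing.isZmodule.Build tens tens_addA tens_addC tens_add0 tens_addN.

Lemma tens_scaleA a b x : tens_scale a (tens_scale b x) = tens_scale (a * b) x.
Proof. by apply: tens_eqP => Z f bf; rewrite !tsum_scale ?scalerA. Qed.
Lemma tens_scale1 : left_id 1 tens_scale.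
Proof. by move=> x; apply: tens_eqP => Z f bf; rewrite tsum_scale ?scale1r. Qed.
Lemma tens_scaleDr : right_distributive tens_scale +%R.
Proof.
move=> a x y; apply: tens_eqP => Z f bf.
rewrite tsum_scale // [in LHS](tsum_add bf) [in RHS](tsum_add bf).
by rewrite !tsum_scale // scalerDr.
Qed.
Lemma tens_scaleDl x : {morph tens_scale^~ x : a b / a + b}.
Proof.
move=> a b; apply: tens_eqP => Z f bf.
by rewrite tsum_scale // [in RHS](tsum_add bf) !tsum_scale // scalerDl.
Qed.

HB.instance Definition _ :=
  GRing.Zmodule_isLmodule.Build k tens
    tens_scaleA tens_scale1 tens_scaleDr tens_scaleDl.

Lemma tsum_is_linear (Z : lmodType k) (f : V -> W -> Z) :
  bilin f -> linear (tsum f).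
Proof.
by move=> bf a x y; rewrite [LHS](tsum_add bf) [in LHS](tsum_scale bf).
Qed.

Lemma tpure_bilin : bilin tpure.
Proof.
split=> [w a v v'|v a w w']; apply: tens_eqP => Z f bf.
  rewrite [RHS](tsum_add bf) [in RHS](tsum_scale bf) !tsumE //.
  by case: bf => ->.
rewrite [RHS](tsum_add bf) [in RHS](tsum_scale bf) !tsumE //.
by case: bf => _ ->.
Qed.

Lemma tens_span (t : tens) : t = \sum_(p <- repr t) tpure p.1 p.2.
Proof.
apply: tens_eqP => Z f bf.
have L := tsum_is_linear bf.
pose F := HB.pack_for {linear tens -> Z} (tsum f)
  (GRing.isLinear.Build _ _ _ _ (tsum f) L).
rewrite -[tsum f (\sum_(_ <- _) _)]/(F _) linear_sum /=.
by apply: eq_bigr => p _; rewrite tsumE.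
Qed.

Lemma tpure_is_linear v : linear (tpure v).
Proof. by case: tpure_bilin. Qed.
HB.instance Definition _ v :=
  GRing.isLinear.Build k W tens *:%R (tpure v) (tpure_is_linear v).

End TensorProduct.

Notation "v '\ox' w" := (tpure v w) (at level 40, left associativity) : ring_scope.

(* Sweedler-style sums: \tsum_(x, y <- t) E is \sum E(x, y) for t = \sum x (x) y *)
Notation "\tsum_ ( x , y <- t ) E" := (tsum (fun x y => E) t)
  (at level 36, E at level 36, x name, y name, t at level 100) : ring_scope.

Section Sweedler.
Variables (k : fieldType) (V W Z X : lmodType k).

Lemma tsum_param_linear (F : X -> V -> W -> Z) (t : tens V W) :
  (forall v w, linear (fun x => F x v w)) -> linear (fun x => tsum (F x) t).
Proof.
move=> FL a x y; rewrite /tsum /fsum scaler_sumr -big_split.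
by apply: eq_bigr => p _; rewrite FL.
Qed.
End Sweedler.

Section LinearMaps.
Variable k : fieldType.
Implicit Types V W X Y : lmodType k.

Definition tmap V W X Y (f : V -> X) (g : W -> Y) (t : tens V W) : tens X Y :=
  \tsum_(v, w <- t) (f v \ox g w).

Lemma tmap_bilin V W X Y (f : {linear V -> X}) (g : {linear W -> Y}) :
  bilin (fun v w => f v \ox g w).
Proof.
have [bl br] := tpure_bilin X Y.
by split=> u a x y; rewrite linearP ?bl ?br.
Qed.

Lemma tmap_is_linear V W X Y (f : {linear V -> X}) (g : {linear W -> Y}) :
  linear (tmap f g).
Proof. exact: tsum_is_linear (tmap_bilin f g). Qed.
HB.instance Definition _ V W X Y (f : {linear V -> X}) (g : {linear W -> Y}) :=
  GRing.isLinear.Build k (tens V W) (tens X Y) *:%R (tmap f g)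
    (tmap_is_linear f g).

Definition tflip V W (t : tens V W) : tens W V := \tsum_(v, w <- t) (w \ox v).

Lemma tflip_is_linear V W : linear (@tflip V W).
Proof.
apply: tsum_is_linear; have [bl br] := tpure_bilin W V.
by split=> u a x y; rewrite ?bl ?br.
Qed.
HB.instance Definition _ V W :=
  GRing.isLinear.Build k (tens V W) (tens W V) *:%R (@tflip V W)
    (@tflip_is_linear V W).

Definition tassoc V W X (t : tens (tens V W) X) : tens V (tens W X) :=
  \tsum_(s, x <- t) \tsum_(v, w <- s) (v \ox (w \ox x)).

Lemma tassoc_is_linear V W X : linear (@tassoc V W X).
Proof.
have [bl br] := tpure_bilin V (tens W X); have [bl' br'] := tpure_bilin W X.
apply: tsum_is_linear; split=> [x|s]; last first.
  by apply: tsum_param_linear => v w a x y /=; rewrite br' br.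
by apply: tsum_is_linear; split=> u a y z /=; rewrite ?bl' ?bl ?br.
Qed.
HB.instance Definition _ V W X :=
  GRing.isLinear.Build k (tens (tens V W) X) (tens V (tens W X)) *:%R
    (@tassoc V W X) (@tassoc_is_linear V W X).

Definition tassocV V W X (t : tens V (tens W X)) : tens (tens V W) X :=
  \tsum_(v, s <- t) \tsum_(w, x <- s) ((v \ox w) \ox x).

Lemma tassocV_is_linear V W X : linear (@tassocV V W X).
Proof.
have [bl br] := tpure_bilin (tens V W) X; have [bl' br'] := tpure_bilin V W.
apply: tsum_is_linear; split=> [s|v].
  by apply: tsum_param_linear => w x a v v' /=; rewrite bl' bl.
by apply: tsum_is_linear; split=> u a y z /=; rewrite ?br' ?bl ?br.
Qed.
HB.instance Definition _ V W X :=
  GRing.isLinear.Build k (tens V (tens W X)) (tens (tens V W) X) *:%R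
    (@tassocV V W X) (@tassocV_is_linear V W X).

Definition tlunit V (t : tens k^o V) : V :=
  tsum (fun (a : k^o) (v : V) => (a : k) *: v) t.

Lemma tlunit_is_linear V : linear (@tlunit V).
Proof.
apply: tsum_is_linear; split=> [v a b c|b a v w] /=.
  by rewrite scalerDl scalerA.
by rewrite scalerDr !scalerA mulrC.
Qed.
HB.instance Definition _ V :=
  GRing.isLinear.Build k (tens k^o V) V *:%R (@tlunit V) (@tlunit_is_linear V).

Definition trunit V : tens V k^o -> V := @tlunit V \o @tflip V k^o.
HB.instance Definition _ V := GRing.Linear.on (@trunit V).

(* (X (x) V) (x) (W (x) Y) -> (X (x) V') (x) (W' (x) Y), acting by
   c : V (x) W -> V' (x) W' on the two middle factors *)
Definition tmid X V W Y V' W' (c : tens V W -> tens V' W') :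
    tens (tens X V) (tens W Y) -> tens (tens X V') (tens W' Y) :=
  @tassocV X V' (tens W' Y) \o
  tmap idfun (@tassoc V' W' Y \o tmap c idfun \o @tassocV V W Y) \o
  @tassoc X V (tens W Y).
HB.instance Definition _ X V W Y V' W' (c : {linear tens V W -> tens V' W'}) :=
  GRing.Linear.on (@tmid X V W Y V' W' c).

End LinearMaps.

Section AlgebraMult.
Variables (k : fieldType) (B : falgType k).

Definition tmul (t : tens B B) : B := \tsum_(a, b <- t) (a * b).

Lemma tmul_is_linear : linear tmul.
Proof.
apply: tsum_is_linear; split=> u a x y /=.
  by rewrite mulrDl scalerAl.
by rewrite mulrDr scalerAr.
Qed.
HB.instance Definition _ :=
  GRing.isLinear.Build k (tens B B) B *:%R tmul tmul_is_linear.
End AlgebraMult.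

Record hopfAlgebra (k : fieldType) := HopfAlgebra {
  hopf_car :> falgType k;
  comulB : {linear hopf_car -> tens hopf_car hopf_car};
  counitB : {linear hopf_car -> k^o};
  antipodeB : {linear hopf_car -> hopf_car};
  comulB_coassoc : forall b,
    tassoc (tmap comulB idfun (comulB b)) = tmap idfun comulB (comulB b);
  counitBl : forall b, tlunit (tmap counitB idfun (comulB b)) = b;
  counitBr : forall b, trunit (tmap idfun counitB (comulB b)) = b;
  comulB1 : comulB 1 = 1 \ox 1;
  comulBM : forall a b, comulB (a * b) =
    tmap (@tmul k hopf_car) (@tmul k hopf_car)
      (tmid (@tflip k hopf_car hopf_car) (comulB a \ox comulB b));
  counitB1 : counitB 1 = 1;
  counitBM : forall a b, counitB (a * b) = (counitB a : k) * counitB b;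
  antipodeBl : forall b,
    tmul (tmap antipodeB idfun (comulB b)) = (counitB b : k) *: 1;
  antipodeBr : forall b,
    tmul (tmap idfun antipodeB (comulB b)) = (counitB b : k) *: 1
}.

(* The antipode of a finite-dimensional Hopf algebra is bijective
   (Larson-Sweedler), so that this is its inverse. *)
Definition antipodeB_inv (k : fieldType) (B : hopfAlgebra k) (b : B) : B :=
  xget 0 [set c | antipodeB B c = b]%classic.

Definition commutativeB (k : fieldType) (B : hopfAlgebra k) : Prop :=
  forall a b : B, a * b = b * a.

Definition cocommutativeB (k : fieldType) (B : hopfAlgebra k) : Prop :=
  forall b : B, tflip (comulB B b) = comulB B b.

(* Operations are kept apart from their axioms (ydData and is_yd, algData and
   is_ydalg, hopfData and is_braided_hopf), so that tensor and smash products
   can be formed before the axioms are known to hold for them. *)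
Section YetterDrinfeld.
Variables (k : fieldType) (B : hopfAlgebra k).

Record ydData := YdData {
  yd_car :> lmodType k;
  yd_act : {linear tens B yd_car -> yd_car};
  yd_coact : {linear yd_car -> tens B yd_car}
}.

Definition is_yd (V : ydData) : Prop :=
  [/\ forall v : V, yd_act V (1 \ox v) = v,
      forall (a b : B) (v : V),
        yd_act V ((a * b) \ox v) = yd_act V (a \ox yd_act V (b \ox v)),
      forall v : V, tassoc (tmap (comulB B) idfun (yd_coact V v))
                    = tmap idfun (yd_coact V) (yd_coact V v),
      forall v : V, tlunit (tmap (counitB B) idfun (yd_coact V v)) = v
    & forall (b : B) (v : V), yd_coact V (yd_act V (b \ox v)) =
        \tsum_(b1, b' <- comulB B b) \tsum_(b2, b3 <- comulB B b')
          \tsum_(u, v0 <- yd_coact V v)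
            ((b1 * u * antipodeB B b3) \ox yd_act V (b2 \ox v0)) ].

Definition yd_morph (V W : ydData) (f : V -> W) : Prop :=
  (forall (b : B) (v : V), f (yd_act V (b \ox v)) = yd_act W (b \ox f v)) /\
  (forall v : V, yd_coact W (f v) = tmap idfun f (yd_coact V v)).

Definition yd_unit : ydData :=
  @YdData k^o (@tlunit k k^o \o tmap (counitB B) idfun) (@tpure k B k^o 1).

(* b (v (x) w) = b_1 v (x) b_2 w and
   v (x) w |-> v_(-1) w_(-1) (x) (v_(0) (x) w_(0)) *)
Definition yd_tens (V W : ydData) : ydData :=
  @YdData (tens V W)
    (tmap (yd_act V) (yd_act W) \o tmid (@tflip k B V) \o
       tmap (comulB B) idfun)
    (tmap (@tmul k B) idfun \o tmid (@tflip k V B) \o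
       tmap (yd_coact V) (yd_coact W)).

(* C(v (x) w) = v_(-1) w (x) v_(0) *)
Definition braid (V W : ydData) : tens V W -> tens W V :=
  tmap (yd_act W) idfun \o @tassocV k B W V \o tmap idfun (@tflip k V W) \o
  @tassoc k B V W \o tmap (yd_coact V) idfun.
HB.instance Definition _ V W := GRing.Linear.on (@braid V W).

Record algData := AlgData {
  alg_obj :> ydData;
  alg_mul : {linear tens alg_obj alg_obj -> alg_obj};
  alg_unit : {linear k^o -> alg_obj}
}.

Definition alg_one (A : algData) : A := alg_unit A (1 : k).

Definition is_kalg (A : algData) : Prop :=
  [/\ forall x y z : A, alg_mul A (alg_mul A (x \ox y) \ox z)
                        = alg_mul A (x \ox alg_mul A (y \ox z)),
      forall x : A, alg_mul A (alg_one A \ox x) = x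
    & forall x : A, alg_mul A (x \ox alg_one A) = x ].

Definition is_ydalg (A : algData) : Prop :=
  [/\ is_yd A, is_kalg A, @yd_morph (yd_tens A A) A (alg_mul A)
    & @yd_morph yd_unit A (alg_unit A) ].

Definition kalg_morph (X Y : algData) (f : X -> Y) : Prop :=
  (forall t : tens X X, f (alg_mul X t) = alg_mul Y (tmap f f t)) /\
  f (alg_one X) = alg_one Y.

Definition kalg_iso (X Y : algData) (f : X -> Y) : Prop :=
  [/\ is_kalg X, is_kalg Y, kalg_morph f & bijective f].

Definition ydalg_iso (X Y : algData) (f : X -> Y) : Prop :=
  [/\ is_ydalg X, is_ydalg Y, kalg_morph f, @yd_morph X Y f & bijective f].

Definition braided_tens (A A' : algData) : algData :=
  @AlgData (yd_tens A A')
    (tmap (alg_mul A) (alg_mul A') \o tmid (@braid A' A))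
    (tmap (alg_unit A) (alg_unit A') \o @tpure k k^o k^o (1 : k)).

Record hopfData := HopfData {
  hopf_alg :> algData;
  comul : {linear hopf_alg -> tens hopf_alg hopf_alg};
  counit : {linear hopf_alg -> k^o};
  antipode : {linear hopf_alg -> hopf_alg}
}.

Definition is_braided_hopf (H : hopfData) : Prop :=
  [/\ is_ydalg H,
      [/\ @yd_morph H (yd_tens H H) (comul H), @yd_morph H yd_unit (counit H)
        & @yd_morph H H (antipode H)],
      [/\ forall x : H, tassoc (tmap (comul H) idfun (comul H x))
                        = tmap idfun (comul H) (comul H x),
          forall x : H, tlunit (tmap (counit H) idfun (comul H x)) = x
        & forall x : H, trunit (tmap idfun (counit H) (comul H x)) = x],
      @kalg_morph H (braided_tens H H) (comul H) /\
      (forall x y : H, counit H (alg_mul H (x \ox y))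
                       = (counit H x : k) * counit H y) /\
      counit H (alg_one H) = 1
    & forall x : H,
        alg_mul H (tmap (antipode H) idfun (comul H x))
          = alg_unit H (counit H x) /\
        alg_mul H (tmap idfun (antipode H) (comul H x))
          = alg_unit H (counit H x) ].

Definition hopf_incl (U H : hopfData) (j : U -> H) : Prop :=
  [/\ injective j, @yd_morph U H j, @kalg_morph U H j,
      forall x : U, comul H (j x) = tmap j j (comul U x)
    & (forall x : U, counit H (j x) = counit U x) /\
      (forall x : U, antipode H (j x) = j (antipode U x)) ].

Definition module_algebra (K : hopfData) (A : algData) (act : tens K A -> A) :
    Prop :=
  [/\ @yd_morph (yd_tens K A) A act,
      forall a : A, act (alg_one K \ox a) = a,
      forall (x y : K) (a : A),
        act (alg_mul K (x \ox y) \ox a) = act (x \ox act (y \ox a)),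
      forall (x : K) (a a' : A), act (x \ox alg_mul A (a \ox a')) =
        alg_mul A (tmap act act (tmid (@braid K A) (comul K x \ox (a \ox a'))))
    & forall x : K, act (x \ox alg_one A) = alg_unit A (counit K x) ].

Definition comodule_algebra (U : hopfData) (R : algData)
    (psi : R -> tens R U) : Prop :=
  [/\ @yd_morph R (yd_tens R U) psi,
      forall r : R, tassoc (tmap psi idfun (psi r))
                    = tmap idfun (comul U) (psi r),
      forall r : R, trunit (tmap idfun (counit U) (psi r)) = r
    & @kalg_morph R (braided_tens R U) psi ].

(* (m_A (x) m_K)(A (x) act (x) K (x) K)(A (x) K (x) C_(K,A) (x) K)
   (A (x) Delta_K (x) A (x) K): all but the two products act on the middle
   factors K (x) A of A (x) K (x) A (x) K *)
Definition smash (A : algData) (K : hopfData) (act : {linear tens K A -> A}) :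
    algData :=
  @AlgData (yd_tens A K)
    (tmap (alg_mul A) (alg_mul K) \o
     tmid (tmap act idfun \o @tassocV k K A K \o tmap idfun (@braid K A) \o
           @tassoc k K K A \o tmap (comul K) idfun))
    (tmap (alg_unit A) (alg_unit K) \o @tpure k k^o k^o (1 : k)).

Definition finite_codim (V : lmodType k) (I : V -> Prop) : Prop :=
  exists s : seq V, forall x, exists c : nat -> k,
    I (x - \sum_(i < size s) c i *: s`_i).

Definition yd_ideal (H : algData) (I : H -> Prop) : Prop :=
  [/\ I 0 /\ (forall (a : k) (x y : H), I x -> I y -> I (a *: x + y)),
      forall x y : H, I y ->
        I (alg_mul H (x \ox y)) /\ I (alg_mul H (y \ox x)),
      forall (b : B) (x : H), I x -> I (yd_act H (b \ox x))
    & forall x : H, I x -> exists2 s : seq (B * H),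
        (forall p, p \in s -> I p.2) &
        yd_coact H x = \sum_(p <- s) p.1 \ox p.2 ].

Definition in_finite_dual (H : algData) (f : H -> k) : Prop :=
  exists I : H -> Prop,
    [/\ yd_ideal I, finite_codim I & forall x, I x -> f x = 0].

(* D stands for the finite dual of H: ev identifies the space D with the set of
   functionals in_finite_dual inside Hom_k(H, k); the remaining clauses are the
   equations which determine the action and coaction of B and the Hopf algebra
   structure on it. *)
Definition is_finite_dual (H D : hopfData) (ev : {linear tens D H -> k^o}) :
    Prop :=
  let ev2 : tens (tens D D) (tens H H) -> k :=
    @tlunit k k^o \o tmap ev ev \o tmid (@braid D H) in
  [/\ is_braided_hopf D,
      (forall f : D, (forall x : H, ev (f \ox x) = 0) -> f = 0) /\
      (forall phi : {linear H -> k^o}, in_finite_dual phi <->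
         exists f : D, forall x : H, ev (f \ox x) = phi x),
      (forall (b : B) (f : D) (x : H),
         ev (yd_act D (b \ox f) \ox x)
           = ev (f \ox yd_act H (antipodeB B b \ox x))) /\
      (forall (f : D) (x : H),
         \tsum_(b, g <- yd_coact D f) ((ev (g \ox x) : k) *: b)
           = \tsum_(b, y <- yd_coact H x)
               ((ev (f \ox y) : k) *: antipodeB_inv b)),
      [/\ forall (f : D) (x y : H),
            ev2 (comul D f \ox (x \ox y)) = ev (f \ox alg_mul H (x \ox y)),
          forall f : D, counit D f = ev (f \ox alg_one H),
          forall (f g : D) (x : H),
            ev (alg_mul D (f \ox g) \ox x) = ev2 ((f \ox g) \ox comul H x)
        & forall x : H, ev (alg_one D \ox x) = counit H x]
    & forall (f : D) (x : H),
        ev (antipode D f \ox x) = ev (f \ox antipode H x) ].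

Section Duality.
Variables (H U : hopfData) (ev : {linear tens U H -> k^o}).

(* (m (x) ev)(H (x) C (x) H)(H (x) U (x) Delta) *)
Definition RL_lambda (t : tens H U) (x : H) : H :=
  trunit (tmap (alg_mul H) ev (tmid (@braid U H) (t \ox comul H x))).

Definition RL_rho (t : tens U H) (x : H) : H :=
  \tsum_(f, h <- t) \tsum_(b, h0 <- yd_coact H h)
    \tsum_(b1, b2 <- comulB B b) \tsum_(x1, x2 <- comul H x)
      ((ev (f \ox yd_act H (b1 \ox x1)) : k)
         *: alg_mul H (yd_act H (b2 \ox x2) \ox h0)).

(* rho(U # 1) is contained in lambda(H # U) *)
Definition RL_condition : Prop :=
  forall f : U, exists t : tens H U, RL_rho (f \ox alg_one H) =1 RL_lambda t.

Definition harpoon : tens U H -> H :=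
  @trunit k H \o tmap idfun ev \o @tassoc k H U H \o
  tmap (@braid U H) idfun \o @tassocV k U H H \o tmap idfun (comul H).
HB.instance Definition _ := GRing.Linear.on harpoon.

Definition coact_action (R : algData) (psi : {linear R -> tens R U}) :
    tens H R -> R :=
  @trunit k R \o tmap idfun ev \o tmap idfun (@braid H U) \o
  @tassoc k R H U \o tmap (@braid H R) idfun \o @tassocV k H R U \o
  tmap idfun psi.
HB.instance Definition _ R psi := GRing.Linear.on (@coact_action R psi).

Definition extended_action (R : ydData) :
    tens U (tens R H) -> tens R H :=
  tmap idfun harpoon \o @tassoc k R U H \o tmap (@braid U R) idfun \o
  @tassocV k U R H.
HB.instance Definition _ R := GRing.Linear.on (@extended_action R).
End Duality.

End YetterDrinfeld.

(* Main.v *)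
(** The natural action [lambda] of [H # U] on [H], [lambda (h # f) x = h (f -> x)], is faithful:
    [S^-1] is a skew antipode because [C^2 = 1], so that [\sum (f -> p) S^-1(q) = <f, y>] where
    [\sum p (x) q = C (Delta y)].  The RL-condition therefore gives a unique map
    [g : U -> H # U] with [lambda (g u) x = \sum <u, x_1> x_2], and uniqueness makes it a morphism
    of Yetter-Drinfeld modules.  The isomorphism from [R (x) (H # U)] to [(R # H) # U] is
    [r (x) w |-> \sum r_0 (x) g(r_1) w].  It is multiplicative because
    [theta (s (x) x) = \sum s_0 (x) <s_1, x_1> x_2] intertwines the natural actions of the two
    algebras on [R (x) H] and on [R # H], the second of which is faithful.  Its inverse is
    [r (x) w |-> \sum r_0 (x) g(sigma r_1) w], where [<sigma u, x> = <u, S^-1 x>]; the element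
    [sigma u] of [U] exists by the RL-condition: it is [\sum <u', h> f] if
    [\sum u' (x) u'' = C^-1 (S u_1 (x) u_2)] and [g u'' = \sum h # f]. *)

From HB Require Import structures.
Require Import Defs.
From mathcomp Require Import all_boot all_order all_algebra all_field.
From mathcomp Require Import boolp classical_sets.

Set Implicit Arguments.
Unset Strict Implicit.
Unset Printing Implicit Defensive.

Import GRing.Theory.
Local Open Scope ring_scope.

(** The condition C^2 = 1 concerns H alone, whereas the crossings of the proof also involve U and R.
    Because H separates the elements of U, it spreads to C_(H,U) C_(U,H) = 1 ([braid_UHK]), on which
    the action of H on R and the properties of theta rest. No such relation is available for
    crossings with R, so their orientation has to be respected throughout. Associators would bury
    the braided computations. Each computation is therefore a word of generators on a right-nested
    tensor product, rewritten by a script that is checked by evaluation; the arbitrary last factor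
    lets an identity be applied inside a longer one. Inverting a braiding takes S^-1 on B, and so
    does the coaction on the dual; the bijectivity of the antipode of B is derived from finite
    dimension. Faithfulness is proved with coefficients, for tensors in Z (x) (H # U): Z = B makes
    the lift g compatible with coactions, and Z = R makes the action on R # H faithful. *)

Section TensorCalculus.
Variable k : fieldType.
Implicit Types V W X Y Z : lmodType k.

Lemma lin_id V : linear (fun v : V => v).
Proof. by []. Qed.

Lemma lin_comp V W X (g : {linear W -> X}) (f : V -> W) :
  linear f -> linear (fun v => g (f v)).
Proof. by move=> lf a x y /=; rewrite lf linearP. Qed.

Lemma lin_tpurel V W X (f : V -> W) (x : X) :
  linear f -> linear (fun v => f v \ox x).
Proof.
by move=> lf a u v /=; rewrite lf; case: (tpure_bilin W X) => ->.
Qed.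

Lemma lin_scalel V W (f : V -> k^o) (w : W) :
  linear f -> linear (fun v => (f v : k) *: w).
Proof. by move=> lf a u v /=; rewrite lf scalerDl scalerA. Qed.

Lemma lin_scaler V W (c : k) (f : V -> W) :
  linear f -> linear (fun v => c *: f v).
Proof.
by move=> lf a u v /=; rewrite lf scalerDr !scalerA mulrC.
Qed.

Lemma lin_mull (A : falgType k) V (f : V -> A) (b : A) :
  linear f -> linear (fun v => f v * b).
Proof. by move=> lf a u v /=; rewrite lf mulrDl scalerAl. Qed.

Lemma lin_mulr (A : falgType k) V (f : V -> A) (b : A) :
  linear f -> linear (fun v => b * f v).
Proof. by move=> lf a u v /=; rewrite lf mulrDr scalerAr. Qed.

Lemma lin_tsum V W X Z (F : V -> W -> Z) (f : X -> tens V W) :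
  bilin F -> linear f -> linear (fun x => tsum F (f x)).
Proof. by move=> bF lf a u v /=; rewrite lf tsum_is_linear. Qed.

Lemma tens_ext V W Z (F G : tens V W -> Z) : linear F -> linear G ->
  (forall v w, F (v \ox w) = G (v \ox w)) -> forall t, F t = G t.
Proof.
move=> lF lG h t; rewrite (tens_span t).
pose F' := HB.pack_for {linear tens V W -> Z} F (GRing.isLinear.Build _ _ _ _ F lF).
pose G' := HB.pack_for {linear tens V W -> Z} G (GRing.isLinear.Build _ _ _ _ G lG).
rewrite -[F _]/(F' _) -[G _]/(G' _) !linear_sum; apply: eq_bigr => p _; exact: h.
Qed.

Lemma lin_tsum_tsum V W V' W' Z (F : V' -> W' -> tens V W)
    (G : V -> W -> Z) t : bilin G ->
  tsum G (tsum F t) = tsum (fun v w => tsum G (F v w)) t.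
Proof.
move=> bG; rewrite /tsum -!/(tsum _ _) /fsum.
pose G' := HB.pack_for {linear tens V W -> Z} (tsum G)
  (GRing.isLinear.Build _ _ _ _ (tsum G) (tsum_is_linear bG)).
by rewrite -[LHS]/(G' _) linear_sum.
Qed.

Lemma linear_tsum V W Z X (g : {linear Z -> X}) (F : V -> W -> Z) t :
  g (tsum F t) = tsum (fun v w => g (F v w)) t.
Proof. by rewrite /tsum /fsum linear_sum. Qed.

Lemma tmapE V W X Y (f : {linear V -> X}) (g : {linear W -> Y}) v w :
  tmap f g (v \ox w) = f v \ox g w.
Proof. by rewrite /tmap tsumE //; apply: tmap_bilin. Qed.

Lemma tflipE V W (v : V) (w : W) : tflip (v \ox w) = w \ox v.
Proof.
rewrite /tflip tsumE //; have [bl br] := tpure_bilin W V.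
by split=> u a x y; rewrite ?bl ?br.
Qed.

End TensorCalculus.

(** Linearity in one variable of a Sweedler expression is read off its syntax. In a [tsum] the
    variable sits either in the summand ([tsum_param_linear]) or in the tensor summed over
    ([lin_tsum]), which asks in turn for a bilinear summand. *)
Ltac lin1 :=
  lazymatch goal with
  | |- linear (fun x => x) => exact: lin_id
  | |- linear (fun x => @tpure _ _ _ _ _) =>
      first [refine (@lin_tpurel _ _ _ _ _ _ _) | refine (@lin_comp _ _ _ _ _ _ _)]
  | |- linear (fun x => @tsum _ _ _ _ _ _) =>
      first [ refine (@tsum_param_linear _ _ _ _ _ _ _ _); intros ? ?
            | refine (@lin_tsum _ _ _ _ _ _ _ _ _); [split; intros ?|] ]
  | |- linear (fun x => @GRing.scale _ _ _ _) =>
      first [refine (@lin_scaler _ _ _ _ _ _) | refine (@lin_scalel _ _ _ _ _ _)]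
  | |- linear (fun x => @GRing.mul _ _ _) =>
      first [refine (@lin_mull _ _ _ _ _ _) | refine (@lin_mulr _ _ _ _ _ _)]
  | |- linear (@GRing.mul _ _) => exact: (lin_mulr _ (@lin_id _ _))
  | |- linear (@tsum _ _ _ _ _) => refine (@tsum_is_linear _ _ _ _ _ _); split; intros ?
  | h : bilin ?F |- linear (?F _) => exact (proj2 h _)
  | h : bilin ?F |- linear (fun x => ?F x _) => exact (proj1 h _)
  | |- linear _ =>
    first [solve [trivial] | refine (@lin_comp _ _ _ _ _ _ _) | exact: linearP]
  end.
Ltac lin := cbv beta; repeat (lin1; cbv beta).

Ltac blin := split=> ?; lin.
(* Reduces an identity about all tensors to pure ones, after [lin] has found both sides linear.
   Proofs below first generalise a coproduct, a coaction or a crossing to an arbitrary tensor and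
   then apply it. *)
Tactic Notation "tpure" ident(v) ident(w) :=
  match goal with |- forall t : _, @eq _ (@?F t) (@?G t) =>
    refine (@tens_ext _ _ _ _ F G _ _ _); [by lin|by lin|intros v w] end.
Section TensorFormulas.
Variable k : fieldType.
Implicit Types V W X Y Z : lmodType k.
Lemma tassocE V W X (v : V) (w : W) (x : X) : tassoc (v \ox w \ox x) = v \ox (w \ox x).
Proof. rewrite /tassoc !tsumE //; blin. Qed.
Lemma tassocVE V W X (v : V) (w : W) (x : X) : tassocV (v \ox (w \ox x)) = v \ox w \ox x.
Proof. rewrite /tassocV !tsumE //; blin. Qed.
Lemma tlunitE V (a : k^o) (v : V) : tlunit (a \ox v) = (a : k) *: v.
Proof. rewrite /tlunit tsumE //; blin. Qed.
Lemma trunitE V (a : k^o) (v : V) : trunit (v \ox a) = (a : k) *: v.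
Proof. by rewrite /trunit /= tflipE tlunitE. Qed.
Lemma tmulE (B : falgType k) (a b : B) : tmul (a \ox b) = a * b.
Proof. rewrite /tmul tsumE //; blin. Qed.
Lemma tmidE X V W Y V' W' (c : {linear tens V W -> tens V' W'}) (x : X) (v : V) (w : W) (y : Y) :
  tmid c (x \ox v \ox (w \ox y)) = tassocV (x \ox tassoc (c (v \ox w) \ox y)).
Proof. by rewrite /tmid /= tassocE tmapE /= tassocVE tmapE. Qed.
Lemma tpureZl V W a (v : V) (w : W) : (a *: v) \ox w = a *: (v \ox w).
Proof. exact: (bilinZl _ _ _ (tpure_bilin V W)). Qed.
Lemma tpureZr V W a (v : V) (w : W) : v \ox (a *: w) = a *: (v \ox w).
Proof. exact: linearZ. Qed.
Lemma tassocK V W X : cancel (@tassoc k V W X) (@tassocV k V W X).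
Proof.
move=> t; move: t; tpure s x; move: s; tpure v w.
by rewrite tassocE tassocVE.
Qed.
Lemma tassocVK V W X : cancel (@tassocV k V W X) (@tassoc k V W X).
Proof.
move=> t; move: t; tpure v s; move: s; tpure w x.
by rewrite tassocVE tassocE.
Qed.
End TensorFormulas.

Section TmapPlain.
Variable k : fieldType.
Implicit Types V W X Y Z : lmodType k.

(** The semantics of diagrams consists of bare functions with separate proofs of linearity;
    packaging them gives the [tmap] lemmas for bare functions. *)
Definition mklin V W (f : V -> W) (lf : linear f) : {linear V -> W} :=
  HB.pack_for {linear V -> W} f (GRing.isLinear.Build _ _ _ _ f lf).

Lemma tmap_lin V W X Y (f : V -> X) (g : W -> Y) :
  linear f -> linear g -> linear (tmap f g).
Proof. move=> lf lg; exact: (tmap_is_linear (mklin lf) (mklin lg)). Qed.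

Lemma tmapE' V W X Y (f : V -> X) (g : W -> Y) v w :
  linear f -> linear g -> tmap f g (v \ox w) = f v \ox g w.
Proof. move=> lf lg; exact: (tmapE (mklin lf) (mklin lg)). Qed.

Lemma eq_tmap V W X Y (f f' : V -> X) (g g' : W -> Y) :
  f =1 f' -> g =1 g' -> tmap f g =1 tmap f' g'.
Proof.
by move=> ef eg t; rewrite /tmap /tsum /fsum; apply: eq_bigr => p _; rewrite ef eg.
Qed.

Lemma tmap_comp V W X Y V' W' (f : X -> V') (g : Y -> W') (f' : V -> X) (g' : W -> Y) t :
  linear f -> linear g -> linear f' -> linear g' ->
  tmap f g (tmap f' g' t) = tmap (f \o f') (g \o g') t.
Proof.
move=> lf lg lf' lg'; move: t.
have lF : linear (f \o f') by move=> a x y /=; rewrite lf' lf.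
have lG : linear (g \o g') by move=> a x y /=; rewrite lg' lg.
apply: (@tens_ext k V W (tens V' W')) => [a x y||v w]; last by rewrite !tmapE'.
  by rewrite (tmap_lin lf' lg') (tmap_lin lf lg).
exact: tmap_lin.
Qed.

Lemma tmap_id V W (t : tens V W) : tmap idfun idfun t = t.
Proof. by move: t; tpure v w; rewrite tmapE. Qed.
End TmapPlain.

(** * String diagrams *)

(* A diagram is the word of its generators in time order: (n, g) applies the generator number g
   to the strands n, n + 1, ... of a right-nested tensor product [T l].  [base] is an arbitrary
   last factor, which makes the identities stable under tensoring on the right. *)
Section Diagrams.
Variables (k : fieldType) (base : lmodType k) (ob : nat -> lmodType k).

Fixpoint T (l : seq nat) : lmodType k :=
  if l is o :: l' then tens (ob o) (T l') else base.

(** Left whiskering: f acts behind the strands a. *)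
Fixpoint wl (a : seq nat) l l' (f : T l -> T l') : T (a ++ l) -> T (a ++ l') :=
  if a is o :: a' then tmap idfun (wl (a := a') f) else f.

(** A generator acts whatever strands follow; [sem_nat], naturality in these strands, is the source
    of the interchange law [weq_swap]. *)
Record gen := Gen {
  dom : seq nat;
  cod : seq nat;
  sem : forall l, T (dom ++ l) -> T (cod ++ l);
  sem_lin : forall l, linear (@sem l);
  sem_nat : forall l l' (f : T l -> T l'), linear f ->
    forall t, sem (wl (a := dom) f t) = wl (a := cod) f (sem t)
}.

Variable sig : nat -> gen.

(** The equality proof reduces to [erefl] on numerals, so that transports along it vanish under
    [lazy] in [word_eq]. *)
Fixpoint nateq (m n : nat) : option (m = n) :=
  match m, n with
  | 0, 0 => Some erefl
  | m'.+1, n'.+1 => if nateq m' n' is Some e then Some (match e in _ = p return m'.+1 = p.+1 with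
    erefl => erefl end) else None
  | _, _ => None
  end.

Lemma nateqxx n : nateq n n = Some erefl.
Proof. by elim: n => //= n ->. Qed.

Definition eq_cons (o o' : nat) (l l' : seq nat) (e : o = o') (e' : l = l') :
    o :: l = o' :: l' :=
  match e, e' with erefl, erefl => erefl end.

Fixpoint strip (a l : seq nat) : option {r | l = a ++ r} :=
  match a, l with
  | [::], _ => Some (exist _ l erefl)
  | o :: a', o' :: l' =>
      if nateq o' o is Some e then
        if strip a' l' is Some (exist r e') then Some (exist _ r (eq_cons e e'))
        else None
      else None
  | _, _ => None
  end.

Lemma strip_cat a r : strip a (a ++ r) = Some (exist _ r erefl).
Proof. by elim: a => //= o a IH; rewrite nateqxx IH. Qed.

(** Words do not carry their intermediate shapes, so the target shape is computed along with the
    map. *)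
Definition hom l := {l' : seq nat & T l -> T l'}.

Definition hid l : hom l := existT _ l (fun t => t).
Definition hcons o l (h : hom l) : hom (o :: l) :=
  existT (fun l' => T (o :: l) -> T l') (o :: projT1 h) (tmap idfun (projT2 h)).

Fixpoint step n g l : hom l :=
  match n with
  | 0 => if strip (dom (sig g)) l is Some (exist r e) then
           existT _ (cod (sig g) ++ r)
             (fun t => sem (eq_rect l (fun l => T l : Type) t _ e))
         (* A generator that does not fit acts as the identity, which keeps [step] total; the
            checker calls [fits] wherever a fit matters. *)
         else hid l
  | n'.+1 => match l with
             | [::] => hid [::]
             | o :: l' => hcons o (step n' g l')
             end
  end.

Definition St := {l : seq nat & T l}.
Definition st l (t : T l) : St := existT (fun l => T l : Type) l t.
Definition happ l (h : hom l) (t : T l) : St := st (projT2 h t).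

Definition run1 (s : St) (a : nat * nat) : St :=
  happ (step a.1 a.2 (projT1 s)) (projT2 s).
Definition run (w : seq (nat * nat)) (s : St) : St := foldl run1 s w.
Definition wshape (w : seq (nat * nat)) l : seq nat :=
  foldl (fun l a => projT1 (step a.1 a.2 l)) l w.

Definition weq l (w1 w2 : seq (nat * nat)) : Prop :=
  forall t : T l, run w1 (st t) = run w2 (st t).

Lemma run_wshape w (s : St) : projT1 (run w s) = wshape w (projT1 s).
Proof. by elim: w s => //= a w IH s; rewrite IH. Qed.

Lemma weq_cat l p w1 w2 s :
  weq (wshape p l) w1 w2 -> weq l (p ++ w1 ++ s) (p ++ w2 ++ s).
Proof.
move=> h t; rewrite /run !foldl_cat -!/(run _ _); congr (run s _).
have := run_wshape p (st t); case: (run p (st t)) => l' t' /= e.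
by rewrite -e in h; apply: h.
Qed.

Definition sh n (w : seq (nat * nat)) := [seq (n + a.1, a.2)%N | a <- w].

Lemma step_lin n g l : linear (projT2 (step n g l)).
Proof.
elim: n l => [|n IH] l /=.
  by case: (strip _ _) => [[r e]|] //=; subst l; apply: sem_lin.
by case: l => [|o l] //=; apply: tmap_lin.
Qed.

(** Prepares [weq_sh1]: since a shifted word is the identity tensored with one linear map, an
    equality of words can be used under a further strand. *)
Lemma run_cons w l : exists h : hom l,
  [/\ linear (projT2 h), forall t, run w (st t) = happ h t &
      forall o t, run (sh 1 w) (st (t : T (o :: l))) = happ (hcons o h) t].
Proof.
elim: w l => [|[n g] w IH] l.
  by exists (hid l); split=> // o t; rewrite /happ /= tmap_id.
have [h [lh h1 h2]] := IH (projT1 (step n g l)).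
exists (existT _ (projT1 h) (projT2 h \o projT2 (step n g l))); split=> /=.
- by move=> a x y /=; rewrite step_lin lh.
- by move=> t; rewrite /run1 /happ /= h1.
move=> o t; rewrite /run1 add1n /= /happ /=.
transitivity (run (sh 1 w) (st (projT2 (hcons o (step n g l)) t : T (o :: _)))); first by [].
rewrite h2 /happ /=; congr st; rewrite tmap_comp //; exact: step_lin.
Qed.

(** Shapes are lists of natural numbers, for which identity proofs are unique, so the dependent pair
    is injective in its second component. *)
Lemma st_inj l : injective (@st l).
Proof.
move=> x y e; have := projT2_eq e.
by rewrite (eq_irrelevance (projT1_eq e) erefl).
Qed.

Lemma weq_sh1 o l w1 w2 : weq l w1 w2 -> weq (o :: l) (sh 1 w1) (sh 1 w2).
Proof.
move=> h t; have [[l1 f1] [lf1 e1 ->]] := run_cons w1 l.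
have [[l2 f2] [lf2 e2 ->]] := run_cons w2 l.
have {h} h u : st (f1 u) = st (f2 u) by have := h u; rewrite e1 e2.
(* The final shape does not depend on the tensor, so the states reached from 0 suffice to compare
   the shapes. *)
have e : l1 = l2 by have := congr1 (@projT1 _ _) (h 0).
subst l2; rewrite /happ /=; congr st; apply: eq_tmap => // u.
exact: st_inj.
Qed.

Lemma weq_sh n l pre w1 w2 : size pre = n -> weq l w1 w2 ->
  weq (pre ++ l) (sh n w1) (sh n w2).
Proof.
move=> <- {n} h; elim: pre => [|o pre IH] /=.
  by rewrite /sh !(eq_map (g := idfun)) ?map_id //; case.
move/(@weq_sh1 o): IH; rewrite /sh -!map_comp.
by rewrite !(eq_map (g := fun a => ((size pre).+1 + a.1, a.2)%N)).
Qed.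

Lemma run1_dom g r (t : T (dom (sig g) ++ r)) :
  run1 (st t) (0, g)%N = st (sem t).
Proof.
by rewrite /run1 /happ /= strip_cat.
Qed.

Lemma run1_wl a m h r (t : T (a ++ r)) :
  run1 (st t) (size a + m, h)%N =
  st (wl (a := a) (projT2 (step m h r)) t).
Proof.
elim: a t => [|o a IH] t //=.
rewrite /run1 /happ /=.
have {}IH u : st (projT2 (step (size a + m) h (a ++ r)) u) =
              st (wl (projT2 (step m h r)) u) := IH u.
case: (step _ h (a ++ r)) IH => l1 f1 /= IH.
have e : l1 = a ++ projT1 (step m h r) by have := congr1 (@projT1 _ _) (IH 0).
subst l1; congr st; apply: eq_tmap => // u; exact: st_inj.
Qed.

(** The generator h lies behind all strands of g, hence is a map of the strands in which g is
    natural. *)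
Lemma weq_swap pre g r m h :
  weq (pre ++ dom (sig g) ++ r)
    [:: (size pre, g); (size pre + size (cod (sig g)) + m, h)%N]
    [:: (size pre + size (dom (sig g)) + m, h)%N; (size pre, g)].
Proof.
have h0 : weq (dom (sig g) ++ r) [:: (0%N, g); (size (cod (sig g)) + m, h)%N]
    [:: (size (dom (sig g)) + m, h)%N; (0%N, g)].
  move=> t; rewrite /= run1_dom !run1_wl run1_dom; congr st.
  by rewrite sem_nat //; apply: step_lin.
have := weq_sh (erefl (size pre)) h0.
by rewrite /sh /= !addn0 !addnA.
Qed.

Lemma weq_trans l w1 w2 w3 : weq l w1 w2 -> weq l w2 w3 -> weq l w1 w3.
Proof. by move=> h1 h2 t; rewrite h1. Qed.

(** Only the strands behind the rule are quantified over; those in front are supplied by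
    [weq_sh]. *)
Record rule := Rule {
  rdom : seq nat;
  rl : seq (nat * nat);
  rr : seq (nat * nat);
  rok : forall post, weq (rdom ++ post) rl rr
}.

Definition rflip (r : rule) : rule :=
  Rule (fun post t => esym (@rok r post t)).

(* The script checker only looks at arities, given by the table ar, so that it
   never evaluates the semantics of the generators. *)
Section Checker.
Variable ar : nat -> seq nat * seq nat.
Hypothesis arP : forall g, (dom (sig g), cod (sig g)) = ar g.

Let domE g : dom (sig g) = (ar g).1. Proof. by rewrite -arP. Qed.
Let codE g : cod (sig g) = (ar g).2. Proof. by rewrite -arP. Qed.

Fixpoint astep n g l : seq nat :=
  match n with
  | 0 => if strip (ar g).1 l is Some (exist r e) then (ar g).2 ++ r else l
  | n'.+1 => if l is o :: l' then o :: astep n' g l' else [::]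
  end.

Lemma astepE n g l : projT1 (step n g l) = astep n g l.
Proof.
elim: n l => [|n IH] [|o l] //=; rewrite ?IH //.
  by rewrite -domE -codE; case: (strip _ _) => [[r e]|].
by rewrite -domE -codE; case: (strip _ _) => [[r e]|].
Qed.

Definition ashape (w : seq (nat * nat)) l : seq nat :=
  foldl (fun l a => astep a.1 a.2 l) l w.

Lemma ashapeE w l : ashape w l = wshape w l.
Proof. by elim: w l => //= a w IH l; rewrite IH astepE. Qed.

Definition fits n a l := (n <= size l)%N && (strip a (drop n l) : bool).

Lemma fitsP n a l : fits n a l ->
  exists pre r, size pre = n /\ l = pre ++ a ++ r.
Proof.
case/andP=> le_n; case: (strip _ _) => [[r e]|] // _.
exists (take n l), r; split; first by rewrite size_takel.
by rewrite -e cat_take_drop.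
Qed.

(** Positions count the strands present at that time. When two generators are exchanged, the one on
    the right therefore moves by the difference between the inputs and the outputs of the one on the
    left. *)
Definition swap_at l i (w : seq (nat * nat)) : option (seq (nat * nat)) :=
  let p := take i w in let l' := ashape p l in
  if drop i w is a :: b :: s then
    let: (n, g) := a in let: (m, h) := b in
    let ig := size (ar g).1 in let og := size (ar g).2 in
    let ih := size (ar h).1 in let oh := size (ar h).2 in
    if (n + og <= m)%N && fits n (ar g).1 l' then
      Some (p ++ [:: (n + ig + (m - (n + og)), h)%N; (n, g)] ++ s)
    else if (m + ih <= n)%N && fits m (ar h).1 l' then
      Some (p ++ [:: (m, h); (m + oh + (n - (m + ih)), g)%N] ++ s)
    else None
  else None.

Lemma swap_atP l i w w' : swap_at l i w = Some w' -> weq l w w'.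
Proof.
rewrite /swap_at; have := cat_take_drop i w.
case: (drop i w) => [|[n g] [|[m h] s]] // ew.
rewrite ashapeE -!domE -!codE.
case: ifP => [/andP[le_m /fitsP[pre [r [sz e]]]] [<-]|_].
  rewrite -{1}ew; apply: (@weq_cat l _ [:: _; _] [:: _; _] s).
  rewrite e -{1}(subnKC le_m) -sz; exact: weq_swap.
case: ifP => [/andP[le_n /fitsP[pre [r [sz e]]]] [<-]|_] //.
rewrite -{1}ew; apply: (@weq_cat l _ [:: _; _] [:: _; _] s); rewrite e => t.
by rewrite -{1}(subnKC le_n) -sz weq_swap.
Qed.

Definition rule_at l i n (r : rule) (w : seq (nat * nat)) :
    option (seq (nat * nat)) :=
  let p := take i w in
  if (take (size (rl r)) (drop i w) == sh n (rl r)) && fits n (rdom r) (ashape p l)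
  then Some (p ++ sh n (rr r) ++ drop (size (rl r)) (drop i w)) else None.

Lemma rule_atP l i n r w w' : rule_at l i n r w = Some w' -> weq l w w'.
Proof.
rewrite /rule_at ashapeE; case: ifP => // /andP[/eqP e /fitsP[pre [q [sz el]]]] [<-].
have := cat_take_drop (size (rl r)) (drop i w); rewrite {}e => e.
have := cat_take_drop i w; rewrite -{1}e => ew; rewrite -{1}ew.
by apply: (@weq_cat l); rewrite el; apply: weq_sh sz _; apply: rok.
Qed.

Fixpoint swaps l (ss : seq nat) w : option (seq (nat * nat)) :=
  if ss is i :: ss' then obind (swaps l ss') (swap_at l i w) else Some w.

Lemma swapsP l ss w w' : swaps l ss w = Some w' -> weq l w w'.
Proof.
elim: ss w => [|i ss IH] w /=; first by case=> <-.
case e: (swap_at l i w) => [w1|] //= /IH; apply: weq_trans.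
exact: swap_atP e.
Qed.

(* Each step of a script consists of transpositions of successive independent generators, given by
   their times, followed by the rule r applied at time i with leftmost strand n. *)
Fixpoint exec l (s : seq (seq nat * nat * nat * rule)) w :
    option (seq (nat * nat)) :=
  if s is (ss, i, n, r) :: s' then
    obind (exec l s') (obind (rule_at l i n r) (swaps l ss w))
  else Some w.

Lemma execP l s ss w w' :
  obind (swaps l ss) (exec l s w) = Some w' -> weq l w w'.
Proof.
elim: s w => [|[[[ss1 i] n] r] s IH] w; first by move/swapsP.
rewrite /=; case e1: (swaps l ss1 w) => [w1|] //=.
case e2: (rule_at l i n r w1) => [w2|] //= /IH; apply: weq_trans.
exact: weq_trans (swapsP e1) (rule_atP e2).
Qed.

End Checker.
End Diagrams.

(** The last premise is a boolean about numerals and arities which evaluates to true. The default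
    generator has the default arity, which settles indices outside the table. *)
Lemma weq_eq (k : fieldType) (base : lmodType k) (ob : nat -> lmodType k)
    (g0 : gen base ob) (G : seq (gen base ob)) ars l w w' s ss :
  (dom g0, cod g0) = ([::], [::]) -> map (fun g => (dom g, cod g)) G = ars ->
  (obind (swaps (nth ([::], [::]) ars) l ss)
     (exec (sig := nth g0 G) (nth ([::], [::]) ars) l s w) == Some w') = true ->
  weq (nth g0 G) l w w'.
Proof.
move=> e0 eG /eqP; apply: execP => g; rewrite -eG.
have [lt|ge] := ltnP g (size G); first by rewrite (nth_map g0).
by rewrite !nth_default ?size_map.
Qed.

(* opmn f applies f, which has m inputs and n outputs, to the first factors of a right-nested
   tensor product. *)
Section Ops.
Variable k : fieldType.
Implicit Types V W X Y Z : lmodType k.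

Definition op21 V W Z (f : {linear tens V W -> Z}) X : tens V (tens W X) -> tens Z X :=
  tmap f idfun \o @tassocV k V W X.
HB.instance Definition _ V W Z f X := GRing.Linear.on (@op21 V W Z f X).

Definition op22 V W V' W' (f : {linear tens V W -> tens V' W'}) X :
    tens V (tens W X) -> tens V' (tens W' X) :=
  @tassoc k V' W' X \o tmap f idfun \o @tassocV k V W X.
HB.instance Definition _ V W V' W' f X := GRing.Linear.on (@op22 V W V' W' f X).

Definition op12 V V' W' (f : {linear V -> tens V' W'}) X :
    tens V X -> tens V' (tens W' X) :=
  @tassoc k V' W' X \o tmap f idfun.
HB.instance Definition _ V V' W' f X := GRing.Linear.on (@op12 V V' W' f X).

Definition op11 V Z (f : {linear V -> Z}) X : tens V X -> tens Z X := tmap f idfun.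
HB.instance Definition _ V Z f X := GRing.Linear.on (@op11 V Z f X).

Definition op20 V W (f : {linear tens V W -> k^o}) X : tens V (tens W X) -> X :=
  @tlunit k X \o tmap f idfun \o @tassocV k V W X.
HB.instance Definition _ V W f X := GRing.Linear.on (@op20 V W f X).

Definition op10 V (f : {linear V -> k^o}) X : tens V X -> X :=
  @tlunit k X \o tmap f idfun.
HB.instance Definition _ V f X := GRing.Linear.on (@op10 V f X).

Definition op01 V (v : V) X : X -> tens V X := tpure v.
HB.instance Definition _ V v X := GRing.Linear.on (@op01 V v X).

Lemma op21E V W Z (f : {linear tens V W -> Z}) X v w (x : X) :
  op21 f (v \ox (w \ox x)) = f (v \ox w) \ox x.
Proof. by rewrite /op21 /= tassocVE tmapE. Qed.
Lemma op22E V W V' W' (f : {linear tens V W -> tens V' W'}) X v w (x : X) :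
  op22 f (v \ox (w \ox x)) = tassoc (f (v \ox w) \ox x).
Proof. by rewrite /op22 /= tassocVE tmapE. Qed.
Lemma op12E V V' W' (f : {linear V -> tens V' W'}) X v (x : X) :
  op12 f (v \ox x) = tassoc (f v \ox x).
Proof. by rewrite /op12 /= tmapE. Qed.
Lemma op11E V Z (f : {linear V -> Z}) X v (x : X) : op11 f (v \ox x) = f v \ox x.
Proof. by rewrite /op11 tmapE. Qed.
Lemma op20E V W (f : {linear tens V W -> k^o}) X v w (x : X) :
  op20 f (v \ox (w \ox x)) = (f (v \ox w) : k) *: x.
Proof. by rewrite /op20 /= tassocVE tmapE tlunitE. Qed.
Lemma op10E V (f : {linear V -> k^o}) X v (x : X) :
  op10 f (v \ox x) = (f v : k) *: x.
Proof. by rewrite /op10 /= tmapE tlunitE. Qed.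
Lemma op01E V (v : V) X (x : X) : op01 v x = v \ox x.
Proof. by []. Qed.
End Ops.
Arguments op21 {k V W Z} f {X} t.
Arguments op22 {k V W V' W'} f {X} t.
Arguments op12 {k V V' W'} f {X} t.
Arguments op11 {k V Z} f {X} t.
Arguments op20 {k V W} f {X} t.
Arguments op10 {k V} f {X} t.
Arguments op01 {k V} v {X} x.

Definition tE := (op21E, op22E, op12E, op11E, op20E, op10E, op01E, tassocE, tassocVE, tmapE,
  tlunitE, trunitE, tflipE, tmulE).

Ltac te := repeat progress (rewrite ?tE /=).

Section Naturality.
Variable k : fieldType.
Implicit Types V W X Y Z : lmodType k.
Variables (X X' : lmodType k) (g : {linear X -> X'}).

(** This lemma and the next six provide the field [sem_nat] of the generators below. *)
Lemma op21_nat V W Z (f : {linear tens V W -> Z}) t :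
  op21 f (tmap idfun (tmap idfun g) t) = tmap idfun g (op21 f t).
Proof. by move: t; tpure v t; move: t; tpure w x; te. Qed.
Lemma op22_nat V W V' W' (f : {linear tens V W -> tens V' W'}) t :
  op22 f (tmap idfun (tmap idfun g) t) = tmap idfun (tmap idfun g) (op22 f t).
Proof.
move: t; tpure v t; move: t; tpure w x; te.
by move: (f _); tpure v' w'; te.
Qed.
Lemma op12_nat V V' W' (f : {linear V -> tens V' W'}) t :
  op12 f (tmap idfun g t) = tmap idfun (tmap idfun g) (op12 f t).
Proof.
move: t; tpure v x; te.
by move: (f _); tpure v' w'; te.
Qed.
Lemma op11_nat V Z (f : {linear V -> Z}) t :
  op11 f (tmap idfun g t) = tmap idfun g (op11 f t).
Proof. by move: t; tpure v x; te. Qed.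
Lemma op20_nat V W (f : {linear tens V W -> k^o}) t :
  op20 f (tmap idfun (tmap idfun g) t) = g (op20 f t).
Proof. by move: t; tpure v t; move: t; tpure w x; te; rewrite linearZ. Qed.
Lemma op10_nat V (f : {linear V -> k^o}) t :
  op10 f (tmap idfun g t) = g (op10 f t).
Proof. by move: t; tpure v x; te; rewrite linearZ. Qed.
Lemma op01_nat V (v : V) t : op01 v (g t) = tmap idfun g (op01 v t).
Proof. by te. Qed.
End Naturality.

Section Gens.
Variables (k : fieldType) (base : lmodType k) (ob : nat -> lmodType k).
Notation T := (T base ob).
Notation gen := (gen base ob).

Definition gen21 a b c (f : {linear tens (ob a) (ob b) -> ob c}) : gen :=
  @Gen k base ob [:: a; b] [:: c] (fun l => @op21 k _ _ _ f (T l)) (fun l => linearP _)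
    (fun l l' g lg => op21_nat (mklin lg) f).
Definition gen22 a b c d (f : {linear tens (ob a) (ob b) -> tens (ob c) (ob d)}) : gen :=
  @Gen k base ob [:: a; b] [:: c; d] (fun l => @op22 k _ _ _ _ f (T l)) (fun l => linearP _)
    (fun l l' g lg => op22_nat (mklin lg) f).
Definition gen12 a c d (f : {linear ob a -> tens (ob c) (ob d)}) : gen :=
  @Gen k base ob [:: a] [:: c; d] (fun l => @op12 k _ _ _ f (T l)) (fun l => linearP _)
    (fun l l' g lg => op12_nat (mklin lg) f).
Definition gen11 a c (f : {linear ob a -> ob c}) : gen :=
  @Gen k base ob [:: a] [:: c] (fun l => @op11 k _ _ f (T l)) (fun l => linearP _)
    (fun l l' g lg => op11_nat (mklin lg) f).
Definition gen20 a b (f : {linear tens (ob a) (ob b) -> k^o}) : gen :=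
  @Gen k base ob [:: a; b] [::] (fun l => @op20 k _ _ f (T l)) (fun l => linearP _)
    (fun l l' g lg => op20_nat (mklin lg) f).
Definition gen10 a (f : {linear ob a -> k^o}) : gen :=
  @Gen k base ob [:: a] [::] (fun l => @op10 k _ f (T l)) (fun l => linearP _)
    (fun l l' g lg => op10_nat (mklin lg) f).
Definition gen01 c (v : ob c) : gen :=
  @Gen k base ob [::] [:: c] (fun l => @op01 k _ v (T l)) (fun l => linearP _)
    (fun l l' g lg => op01_nat (mklin lg) v).
Definition gen00 : gen :=
  @Gen k base ob [::] [::] (fun l => idfun) (fun l => linearP _)
    (fun l l' g lg t => erefl _).

End Gens.

Section MoreSums.
Variable k : fieldType.
Implicit Types V W X Y Z : lmodType k.
Lemma eq_tsum V W Z (f g : V -> W -> Z) t :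
  (forall v w, f v w = g v w) -> tsum f t = tsum g t.
Proof. by move=> e; apply: eq_bigr => p _; apply: e. Qed.

Lemma exch_tsum V W X Y Z (F : V -> W -> X -> Y -> Z) t s :
  tsum (fun v w => tsum (fun x y => F v w x y) s) t =
  tsum (fun x y => tsum (fun v w => F v w x y) t) s.
Proof. by rewrite /tsum /fsum exchange_big. Qed.

Lemma tsum_tmap V W X Y Z (F : V -> W -> Z) (f : {linear X -> V}) (g : {linear Y -> W}) t :
  bilin F -> tsum F (tmap f g t) = tsum (fun x y => F (f x) (g y)) t.
Proof.
move=> bF; rewrite [tmap f g t]/tmap (lin_tsum_tsum _ _ bF).
by apply: eq_tsum => x y; rewrite tsumE.
Qed.

Lemma scaler_tsum V W Z (c : k) (F : V -> W -> Z) t :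
  c *: tsum F t = tsum (fun v w => c *: F v w) t.
Proof. by rewrite /tsum /fsum scaler_sumr. Qed.

Lemma tsum_id V W (t : tens V W) : tsum (fun v w => v \ox w) t = t.
Proof. by rewrite [RHS]tens_span. Qed.
End MoreSums.

(** * Yetter-Drinfeld modules and their braiding *)

Section HopfB.
Variables (k : fieldType) (B : hopfAlgebra k).
Implicit Types (V Z : lmodType k).

(** Obtained by evaluating both sides of [comulB_coassoc] at the trilinear G. The lemmas up to
    [antipodeB_r] give the axioms of B this form, in which they rewrite inside Sweedler sums. *)
Lemma comulB_assoc Z (G : B -> B -> B -> Z) (b : B) :
  (forall y z, linear (fun x => G x y z)) -> (forall x z, linear (fun y => G x y z)) ->
  (forall x y, linear (G x y)) ->
  \tsum_(p, q <- comulB B b) \tsum_(x, y <- comulB B p) G x y q =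
  \tsum_(x, r <- comulB B b) \tsum_(y, q <- comulB B r) G x y q.
Proof.
move=> l1 l2 l3.
have bG x : bilin (G x) by split=> ?; [apply: l2|apply: l3].
have bG' z : bilin (fun x y => G x y z) by split=> ?; [apply: l1|apply: l2].
have bK : bilin (fun x (r : tens B B) => tsum (G x) r).
  split=> ?; [by apply: tsum_param_linear|exact: tsum_is_linear].
have e1 (t : tens (tens B B) B) : tsum (fun x r => tsum (G x) r) (tassoc t) =
    tsum (fun s z => tsum (fun x y => G x y z) s) t.
  move: t; tpure s z.
  rewrite tsumE; last by split=> ?; [apply: tsum_is_linear|apply: tsum_param_linear].
  move: s; tpure x y.
  by rewrite tassocE !tsumE.
have := congr1 (tsum (fun x r => tsum (G x) r)) (comulB_coassoc b).
rewrite e1 tsum_tmap; last by split=> ?; [apply: tsum_is_linear|apply: tsum_param_linear].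
by move=> ->; rewrite tsum_tmap.
Qed.

Lemma counitB_l Z (F : B -> Z) (b : B) : linear F ->
  \tsum_(x, y <- comulB B b) ((counitB B x : k) *: F y) = F b.
Proof.
move=> lF; rewrite -{2}(counitBl b).
rewrite -[F]/(mklin lF : _ -> _); move: (mklin lF) => {lF} G.
by move: (comulB B b); tpure x y; rewrite tsumE; [te; rewrite linearZ|blin].
Qed.

Lemma counitB_r Z (F : B -> Z) (b : B) : linear F ->
  \tsum_(x, y <- comulB B b) ((counitB B y : k) *: F x) = F b.
Proof.
move=> lF; rewrite -{2}(counitBr b).
rewrite -[F]/(mklin lF : _ -> _); move: (mklin lF) => {lF} G.
by move: (comulB B b); tpure x y; rewrite tsumE; [te; rewrite linearZ|blin].
Qed.

Lemma antipodeB_l Z (F : B -> Z) (b : B) : linear F ->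
  \tsum_(x, y <- comulB B b) F (antipodeB B x * y) = (counitB B b : k) *: F 1.
Proof.
move=> lF; rewrite -[F]/(mklin lF : _ -> _); move: (mklin lF) => {lF} G.
rewrite -linear_tsum -linearZ -antipodeBl; congr (G _).
by move: (comulB B b); tpure x y; rewrite tsumE; [te|blin].
Qed.

Lemma antipodeB_r Z (F : B -> Z) (b : B) : linear F ->
  \tsum_(x, y <- comulB B b) F (x * antipodeB B y) = (counitB B b : k) *: F 1.
Proof.
move=> lF; rewrite -[F]/(mklin lF : _ -> _); move: (mklin lF) => {lF} G.
rewrite -linear_tsum -linearZ -antipodeBr; congr (G _).
by move: (comulB B b); tpure x y; rewrite tsumE; [te|blin].
Qed.
End HopfB.

Section YD.
Variables (k : fieldType) (B : hopfAlgebra k).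
Implicit Types (V W X : ydData B).
Notation act := (yd_act _).
Notation coact := (yd_coact _).

Lemma act_tens V W b (v : V) (w : W) :
  yd_act (yd_tens V W) (b \ox (v \ox w)) =
  \tsum_(x, y <- comulB B b) (act (x \ox v) \ox act (y \ox w)).
Proof.
rewrite /=; te; move: (comulB B b); tpure x y.
by rewrite tmidE tsumE; [te|blin].
Qed.

Lemma coact_tens V W (v : V) (w : W) :
  yd_coact (yd_tens V W) (v \ox w) =
  \tsum_(b, v0 <- coact v) \tsum_(c, w0 <- coact w) (b * c \ox (v0 \ox w0)).
Proof.
rewrite /=; te; move: (yd_coact V v); tpure b v0; move: (yd_coact W w); tpure c w0.
by rewrite tmidE !tsumE; [te|blin..].
Qed.

Lemma braidE V W (v : V) (w : W) :
  @braid k B V W (v \ox w) = \tsum_(b, v0 <- coact v) (act (b \ox w) \ox v0).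
Proof.
rewrite /braid /=; te; move: (yd_coact V v); tpure b v0.
by rewrite tsumE; [te|blin].
Qed.

(** The compatibility condition with the antipode moved to the other side: (b_1 v)_(-1) b_2 (x) (b_1
    v)_(0) = b_1 v_(-1) (x) b_2 v_(0). *)
Definition yd_compat V := forall b (v : V),
  \tsum_(x, y <- comulB B b) \tsum_(c, v0 <- coact (act (x \ox v))) (c * y \ox v0)
  = \tsum_(x, y <- comulB B b) \tsum_(c, v0 <- coact v) (x * c \ox act (y \ox v0)).

Definition is_yd' V : Prop :=
  [/\ forall v : V, yd_act V (1 \ox v) = v,
      forall (a b : B) (v : V),
        yd_act V ((a * b) \ox v) = yd_act V (a \ox yd_act V (b \ox v)),
      forall v : V, tassoc (tmap (comulB B) idfun (yd_coact V v))
                    = tmap idfun (yd_coact V) (yd_coact V v),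
      forall v : V, tlunit (tmap (counitB B) idfun (yd_coact V v)) = v
    & yd_compat V].

(** In one direction a further factor of the coproduct of b is multiplied on the right and cancelled
    by S(b_3) b_4; in the other, b_2 S(b_3) is inserted. *)
Lemma is_ydP V : is_yd V <-> is_yd' V.
Proof.
split=> -[a1 aM c c1 h]; split=> // b v.
  transitivity (\tsum_(x, y <- comulB B b) \tsum_(b1, b' <- comulB B x)
    \tsum_(b2, b3 <- comulB B b') \tsum_(u, v0 <- coact v)
      ((b1 * u * (antipodeB B b3 * y)) \ox act (b2 \ox v0))).
    apply: eq_tsum => x y; rewrite h.
    do 3![rewrite lin_tsum_tsum; [apply: eq_tsum => ? ?|blin]].
    by rewrite tsumE ?mulrA //; blin.
  rewrite (comulB_assoc (G := fun b1 b' y => \tsum_(b2, b3 <- comulB B b')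
    \tsum_(u, v0 <- coact v)
      ((b1 * u * (antipodeB B b3 * y)) \ox act (b2 \ox v0)))); try by move=> *; lin.
  apply: eq_tsum => b1 r.
  rewrite (comulB_assoc (G := fun b2 b3 y =>
    \tsum_(u, v0 <- coact v)
      ((b1 * u * (antipodeB B b3 * y)) \ox act (b2 \ox v0)))); try by move=> *; lin.
  rewrite -[RHS](counitB_r (F := fun r => \tsum_(c0, v0 <- coact v) (b1 * c0 \ox act (r \ox
    v0)))); last by lin.
  apply: eq_tsum => b2 r'; rewrite exch_tsum scaler_tsum.
  apply: eq_tsum => u v0.
  rewrite (antipodeB_l (F := fun m => b1 * u * m \ox act (b2 \ox v0))) ?mulr1 //.
  by lin.

transitivity (\tsum_(p, b3 <- comulB B b) \tsum_(b1, b2 <- comulB B p)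
   \tsum_(u, v0 <- coact v)
      ((b1 * u * antipodeB B b3) \ox act (b2 \ox v0))); last first.
  by apply: (comulB_assoc (G := fun b1 b2 b3 => \tsum_(u, v0 <- coact v)
      ((b1 * u * antipodeB B b3) \ox act (b2 \ox v0)))); move=> *; lin.
transitivity (\tsum_(p, b3 <- comulB B b) \tsum_(x, y <- comulB B p)
   \tsum_(c, v0 <- coact (act (x \ox v))) (c * (y * antipodeB B b3) \ox v0)).
  rewrite (comulB_assoc (G := fun x y b3 => \tsum_(c, v0 <- coact (act (x \ox v)))
    (c * (y * antipodeB B b3) \ox v0))); try by move=> *; lin.
  rewrite -[LHS](counitB_r (F := fun x => coact (act (x \ox v)))); last by lin.
  apply: eq_tsum => x r; rewrite exch_tsum -[X in _ *: X]tsum_id scaler_tsum.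
  apply: eq_tsum => c' v0.
  by rewrite (antipodeB_r (F := fun m => c' * m \ox v0)) ?mulr1 //; lin.
apply: eq_tsum => p b3.
have := congr1 (tsum (fun c v0 => c * antipodeB B b3 \ox v0)) (h p v).
do 2![rewrite lin_tsum_tsum; last by blin]; move=> e.
transitivity (\tsum_(x, y <- comulB B p)
   tsum (fun c v0 => c * antipodeB B b3 \ox v0)
    (\tsum_(c0, v0 <- coact (act (x \ox v))) (c0 * y \ox v0))).
  apply: eq_tsum => x y; rewrite lin_tsum_tsum; last by blin.
  by apply: eq_tsum => c' v0; rewrite tsumE ?mulrA //; blin.
rewrite e; apply: eq_tsum => x y; rewrite lin_tsum_tsum; last by blin.
by apply: eq_tsum => c' v0; rewrite tsumE //; blin.
Qed.
End YD.

Section YDCat.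
Variables (k : fieldType) (B : hopfAlgebra k).
Implicit Types (V W X : ydData B) (Z : lmodType k).
Notation act := (yd_act _).
Notation coact := (yd_coact _).

Lemma coact_assoc V Z (G : B -> B -> V -> Z) (v : V) : is_yd V ->
  (forall y z, linear (fun x => G x y z)) -> (forall x z, linear (fun y => G x y z)) ->
  (forall x y, linear (G x y)) ->
  \tsum_(b, v0 <- coact v) \tsum_(x, y <- comulB B b) G x y v0 =
  \tsum_(x, v0 <- coact v) \tsum_(y, v00 <- coact v0) G x y v00.
Proof.
case=> _ _ c _ _ l1 l2 l3.
have bG x : bilin (G x) by split=> ?; [apply: l2|apply: l3].
have bG' z : bilin (fun x y => G x y z) by split=> ?; [apply: l1|apply: l2].
have bK : bilin (fun x (r : tens B V) => tsum (G x) r).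
  split=> ?; [by apply: tsum_param_linear|exact: tsum_is_linear].
have e1 (t : tens (tens B B) V) : tsum (fun x r => tsum (G x) r) (tassoc t) =
    tsum (fun s z => tsum (fun x y => G x y z) s) t.
  move: t; tpure s z.
  rewrite tsumE; last by split=> ?; [apply: tsum_is_linear|apply: tsum_param_linear].
  by move: s; tpure x y; rewrite tassocE !tsumE.
have := congr1 (tsum (fun x r => tsum (G x) r)) (c v).
rewrite e1 tsum_tmap; last by split=> ?; [apply: tsum_is_linear|apply: tsum_param_linear].
by move=> ->; rewrite tsum_tmap.
Qed.

(** For the compatibility, in the form without antipode, b is moved past the coaction of W first and
    past that of V next. *)
Lemma yd_tensP V W : is_yd V -> is_yd W -> is_yd (yd_tens V W).
Proof.
move=> yV yW; apply/is_ydP.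
have /is_ydP[a1 aM c c1 h] := yV; have /is_ydP[a1' aM' c' c1' h'] := yW.
split.
- by tpure v w; rewrite /=; te; rewrite comulB1 tmidE; te; rewrite a1 a1'.
- move=> a b; tpure v w; rewrite /=; te; rewrite comulBM.
  move: (comulB B b); tpure b1 b2; move: (comulB B a); tpure p1 p2.
  by rewrite !tmidE; te; rewrite !tmidE; te; rewrite aM aM'.
- tpure v w; rewrite coact_tens.
  transitivity (\tsum_(b, v0 <- coact v) \tsum_(x, y <- comulB B b)
    \tsum_(d, w0 <- coact w) \tsum_(x', y' <- comulB B d)
      (x * x' \ox (y * y' \ox (v0 \ox w0)))).
    under [RHS]eq_tsum do rewrite exch_tsum.
    move: (coact v); tpure b v0; move: (coact w); tpure d w0.
    rewrite !tsumE; [te; rewrite comulBM|blin..].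
    move: (comulB B b); tpure x y; move: (comulB B d); tpure x' y'.
    by rewrite tmidE !tsumE; [te|blin..].
  rewrite (coact_assoc (G := fun x y v0 => \tsum_(d, w0 <- coact w)
    \tsum_(x', y' <- comulB B d) (x * x' \ox (y * y' \ox (v0 \ox w0))))) //;
    try by move=> *; lin.
  have e x y v0 : \tsum_(d, w0 <- coact w) \tsum_(x', y' <- comulB B d)
      (x * x' \ox (y * y' \ox (v0 \ox w0))) =
      \tsum_(x', w0 <- coact w) \tsum_(y', w00 <- coact w0)
      (x * x' \ox (y * y' \ox (v0 \ox w00))).
    by apply: (coact_assoc (G := fun x' y' w0 => (x * x' \ox (y * y' \ox (v0 \ox w0))))) => // *;
      lin.
  under eq_tsum do under eq_tsum do rewrite e.
  under eq_tsum do rewrite exch_tsum.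
  move: (coact v); tpure x v0; move: (coact w); tpure x' w0.
  rewrite !tsumE; [te|blin..].
  move: (coact v0); tpure y v00; move: (coact w0); tpure y' w00.
  by rewrite !tsumE; [te; rewrite tmidE; te|blin..].
- tpure v w; rewrite coact_tens -[in RHS](c1 v) -[in RHS](c1' w).
  move: (coact v); tpure b v0; move: (coact w); tpure d w0.
  rewrite !tsumE; [te; rewrite counitBM|blin..].
  by rewrite tpureZl tpureZr scalerA.
move=> b; tpure v w.
transitivity (\tsum_(x, y <- comulB B b) \tsum_(x1, x2 <- comulB B x)
  \tsum_(c, v0 <- coact (act (x1 \ox v))) \tsum_(d, w0 <- coact (act (x2 \ox w)))
    (c * (d * y) \ox (v0 \ox w0))).
  apply: eq_tsum => x y; rewrite act_tens.
  move: (comulB B x); tpure x1 x2; rewrite !tsumE; [|blin..].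
  rewrite coact_tens.
  move: (coact _); tpure p v0; move: (coact _); tpure d w0.
  by rewrite !tsumE ?mulrA; [|blin..].
rewrite (comulB_assoc (G := fun x1 x2 y => \tsum_(c, v0 <- coact (act (x1 \ox v)))
  \tsum_(d, w0 <- coact (act (x2 \ox w))) (c * (d * y) \ox (v0 \ox w0))));
  try by move=> *; lin.
transitivity (\tsum_(x1, r <- comulB B b) \tsum_(c, v0 <- coact (act (x1 \ox v)))
  \tsum_(x2, y <- comulB B r) \tsum_(d, w0 <- coact w)
    (c * x2 * d \ox (v0 \ox act (y \ox w0)))).
  apply: eq_tsum => x1 r; rewrite exch_tsum; apply: eq_tsum => c0 v0.
  have := congr1 (tsum (fun d w0 => c0 * d \ox (v0 \ox w0))) (h' r w).
  do 2![rewrite lin_tsum_tsum; last by blin].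
  under eq_tsum => x y do [rewrite lin_tsum_tsum; last by blin].
  under [in RHS]eq_tsum => x y do [rewrite lin_tsum_tsum; last by blin].
  under eq_tsum => x y do under eq_tsum => p q do [rewrite tsumE; last by blin].
  move=> ->.
  apply: eq_tsum => x y; apply: eq_tsum => p q.
  by rewrite tsumE ?mulrA //; blin.
transitivity (\tsum_(x, y <- comulB B b) \tsum_(x1, x2 <- comulB B x)
  \tsum_(c, v0 <- coact v) \tsum_(d, w0 <- coact w)
    (x1 * c * d \ox (act (x2 \ox v0) \ox act (y \ox w0)))).
  transitivity (\tsum_(x, y <- comulB B b) \tsum_(x1, x2 <- comulB B x)
    \tsum_(c, v0 <- coact (act (x1 \ox v))) \tsum_(d, w0 <- coact w)
      (c * x2 * d \ox (v0 \ox act (y \ox w0)))).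
    rewrite (comulB_assoc (G := fun x1 x2 y =>
      \tsum_(c, v0 <- coact (act (x1 \ox v))) \tsum_(d, w0 <- coact w)
      (c * x2 * d \ox (v0 \ox act (y \ox w0))))); try by move=> *; lin.
    by apply: eq_tsum => x1 r; rewrite exch_tsum.
  apply: eq_tsum => x y.
  have := congr1 (tsum (fun c v0 => \tsum_(d, w0 <- coact w)
     (c * d \ox (v0 \ox act (y \ox w0))))) (h x v).
  do 2![rewrite lin_tsum_tsum; last by blin].
  under eq_tsum => x' y' do [rewrite lin_tsum_tsum; last by blin].
  under [in RHS]eq_tsum => x' y' do [rewrite lin_tsum_tsum; last by blin].
  under eq_tsum => x' y' do under eq_tsum => p q do [rewrite tsumE; last by blin].
  move=> ->.
  apply: eq_tsum => x' y'; apply: eq_tsum => p q.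
  by rewrite tsumE //; blin.
rewrite (comulB_assoc (G := fun x1 x2 y => \tsum_(c, v0 <- coact v)
  \tsum_(d, w0 <- coact w)
    (x1 * c * d \ox (act (x2 \ox v0) \ox act (y \ox w0))))); try by move=> *; lin.
apply: eq_tsum => x r; rewrite coact_tens.
rewrite exch_tsum.
under [LHS]eq_tsum do rewrite exch_tsum.
move: (coact v); tpure c0 v0; move: (coact w); tpure d w0.
rewrite !tsumE; [|blin..].
by rewrite act_tens linear_tsum; apply: eq_tsum => *; rewrite mulrA.
Qed.

(** Of the two hexagons, this one is associativity of the action on X, and [braid_hexr] is
    coassociativity of the coaction on V. *)
Lemma braid_hexl V W X (v : V) (w : W) (x : X) : is_yd X ->
  @braid k B (yd_tens V W) X (v \ox w \ox x) =
  tassoc (tmap (@braid k B V X) idfun (tassocV (v \ox @braid k B W X (w \ox x)))).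
Proof.
case=> _ aM _ _ _; rewrite !braidE coact_tens.
move: (coact w); tpure c w0; rewrite !tsumE; [te; rewrite braidE|blin..].
move: (coact v); tpure b v0; rewrite !tsumE; [te|blin..].
by rewrite aM.
Qed.

Lemma braid_hexr V W X (v : V) (w : W) (x : X) : is_yd V ->
  @braid k B V (yd_tens W X) (v \ox (w \ox x)) =
  tassocV (tmap idfun (@braid k B V X) (tassoc (@braid k B V W (v \ox w) \ox x))).
Proof.
move=> yV; rewrite !braidE.
under eq_tsum do rewrite act_tens.
transitivity (\tsum_(b, v0 <- coact v) \tsum_(y, z <- comulB B b)
   (act (y \ox w) \ox act (z \ox x) \ox v0)).
  move: (coact v); tpure b v0; rewrite !tsumE; [|blin..].
  by move: (comulB B b); tpure y z; rewrite !tsumE; [|blin..].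
rewrite (coact_assoc (G := fun y z v0 => act (y \ox w) \ox act (z \ox x) \ox v0)) //;
  try by move=> *; lin.
move: (coact v); tpure b v0; rewrite !tsumE; [te; rewrite braidE|blin..].
by move: (coact v0); tpure c v00; rewrite !tsumE; [te|blin..].
Qed.
End YDCat.

Section YDMorph.
Variables (k : fieldType) (B : hopfAlgebra k).
Implicit Types (V W X Y Z : ydData B).
Notation act := (yd_act _).
Notation coact := (yd_coact _).
Notation C V W := (@braid k B V W).

Lemma eq_ydm V W (f g : V -> W) : f =1 g -> yd_morph f -> yd_morph g.
Proof.
move=> e [h1 h2]; split=> [b v|v]; rewrite -!e ?h1 // h2.
by apply: eq_tmap.
Qed.

Lemma ydm_id V : @yd_morph k B V V idfun.
Proof. by split=> // v; rewrite tmap_id. Qed.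

Lemma ydm_comp V W X (g : {linear W -> X}) (f : {linear V -> W}) :
  yd_morph g -> yd_morph f -> @yd_morph k B V X (g \o f).
Proof.
move=> [g1 g2] [f1 f2]; split=> [b v|v]; first by rewrite /= f1 g1.
rewrite g2 f2 -[X in _ = tmap _ X _]/(g \o f).
by move: (coact v); tpure b v0; te.
Qed.

Lemma ydm_tmap V W X Y (f : {linear V -> X}) (g : {linear W -> Y}) :
  yd_morph f -> yd_morph g ->
  @yd_morph k B (yd_tens V W) (yd_tens X Y) (tmap f g).
Proof.
move=> [f1 f2] [g1 g2]; split=> [b|]; last first.
  tpure v w; rewrite tmapE !coact_tens f2 g2.
  move: (coact v); tpure c v0; move: (coact w); tpure d w0.
  by rewrite !tmapE !tsumE; [te|blin..].
tpure v w; rewrite tmapE !act_tens.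
by move: (comulB B b); tpure x y; rewrite !tsumE; [te; rewrite f1 g1|blin..].
Qed.

(** The action part is [yd_compat] for V, with the factor in B acting on w; the coaction part is
    [yd_compat] for W. As a morphism, the braiding is itself subject to naturality, whence the
    Yang-Baxter equation. *)
Lemma braid_ydm V W : is_yd V -> is_yd W ->
  @yd_morph k B (yd_tens V W) (yd_tens W V) (C V W).
Proof.
move=> yV yW; have /is_ydP[_ aM _ _ h] := yV; have /is_ydP[_ aM' _ _ h'] := yW.
split=> [b|]; tpure v w.
  rewrite act_tens.
  transitivity (\tsum_(x, y <- comulB B b) \tsum_(c, v0 <- coact (act (x \ox v)))
      (act (c * y \ox w) \ox v0)).
    move: (comulB B b); tpure x y; rewrite !tsumE; [|blin..].
    by rewrite braidE; apply: eq_tsum => c v0; rewrite aM'.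
  have := congr1 (tsum (fun c v0 => act (c \ox w) \ox v0)) (h b v).
  do 2![rewrite lin_tsum_tsum; last by blin].
  under eq_tsum => x y do [rewrite lin_tsum_tsum; last by blin].
  under [in RHS]eq_tsum => x y do [rewrite lin_tsum_tsum; last by blin].
  under eq_tsum => x y do under eq_tsum => p q do [rewrite tsumE; last by blin].
  move=> ->; rewrite braidE.
  under eq_tsum => x y do under eq_tsum => p q do [rewrite tsumE; last by blin].
  rewrite exch_tsum; move: (coact v); tpure c v0; rewrite !tsumE; [|blin..].
  by rewrite act_tens; apply: eq_tsum => x y; rewrite aM'.
rewrite braidE coact_tens.
transitivity (\tsum_(b, v0 <- coact v) \tsum_(d, v00 <- coact v0)
   \tsum_(c, w0 <- coact (act (b \ox w))) (c * d \ox (w0 \ox v00))).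
  move: (coact v); tpure b v0; rewrite !tsumE; [|blin..].
  by rewrite coact_tens exch_tsum.
rewrite -(coact_assoc (G := fun b d v00 =>
   \tsum_(c, w0 <- coact (act (b \ox w))) (c * d \ox (w0 \ox v00)))) //;
  try by move=> *; lin.
transitivity (\tsum_(b, v0 <- coact v) \tsum_(x, y <- comulB B b)
   \tsum_(c, w0 <- coact w) (x * c \ox (act (y \ox w0) \ox v0))).
  apply: eq_tsum => b v0.
  have := congr1 (tsum (fun c w0 => c \ox (w0 \ox v0))) (h' b w).
  do 2![rewrite lin_tsum_tsum; last by blin].
  under eq_tsum => x y do [rewrite lin_tsum_tsum; last by blin].
  under [in RHS]eq_tsum => x y do [rewrite lin_tsum_tsum; last by blin].
  under eq_tsum => x y do under eq_tsum => p q do [rewrite tsumE; last by blin].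
  move=> ->; apply: eq_tsum => x y; apply: eq_tsum => p q.
  by rewrite tsumE //; blin.
transitivity (\tsum_(x, v0 <- coact v) \tsum_(y, v00 <- coact v0)
   \tsum_(c, w0 <- coact w) (x * c \ox (act (y \ox w0) \ox v00))).
  by apply: (coact_assoc (G := fun x y v0 =>
     \tsum_(c, w0 <- coact w) (x * c \ox (act (y \ox w0) \ox v0)))) => //;
    move=> *; lin.
under eq_tsum do rewrite exch_tsum.
move: (coact v); tpure x v0; move: (coact w); tpure c w0.
rewrite !tsumE; [te; rewrite braidE|blin..].
by move: (coact v0); tpure d v00; rewrite !tsumE; [te|blin..].
Qed.

Lemma ydm_assoc V W X :
  @yd_morph k B (yd_tens (yd_tens V W) X) (yd_tens V (yd_tens W X)) (@tassoc k V W X).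
Proof.
split=> [b|]; tpure s x; move: s; tpure v w; rewrite tassocE.
  rewrite !act_tens.
  transitivity (\tsum_(b', b3 <- comulB B b) \tsum_(b1, b2 <- comulB B b')
     (act (b1 \ox v) \ox (act (b2 \ox w) \ox act (b3 \ox x)))).
    move: (comulB B b); tpure b' b3; rewrite !tsumE ?act_tens; [|blin..].
    by move: (comulB B b'); tpure b1 b2; rewrite !tsumE; [te|blin..].
  rewrite (comulB_assoc (G := fun b1 b2 b3 =>
     (act (b1 \ox v) \ox (act (b2 \ox w) \ox act (b3 \ox x))))); try by move=> *; lin.
  by apply: eq_tsum => y z; rewrite act_tens linear_tsum.
rewrite !coact_tens.
move: (coact v); tpure b v0; move: (coact w); tpure c w0; move: (coact x); tpure d x0.
by rewrite !tsumE; [te; rewrite mulrA|blin..].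
Qed.

Lemma ydm_can V W (f : {linear V -> W}) (g : W -> V) :
  cancel f g -> cancel g f -> yd_morph f -> @yd_morph k B W V g.
Proof.
move=> fK gK [f1 f2].
have lg : linear g by move=> a x y; apply: (can_inj fK); rewrite linearP !gK.
split=> [b w|w]; first by apply: (can_inj fK); rewrite gK f1 gK.
rewrite -{2}(gK w) f2 tmap_comp; do ?exact: linearP; last by [].
by rewrite (eq_tmap (f' := idfun) (g' := idfun)) ?tmap_id // => x /=; rewrite fK.
Qed.

Lemma ydm_assocV V W X :
  @yd_morph k B (yd_tens V (yd_tens W X)) (yd_tens (yd_tens V W) X) (@tassocV k V W X).
Proof.
apply: (@ydm_can (yd_tens (yd_tens V W) X) (yd_tens V (yd_tens W X)) (@tassoc k V W X)).
- exact: tassocK.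
- exact: tassocVK.
exact: ydm_assoc.
Qed.

Lemma ydm_lunit V : is_yd V -> @yd_morph k B (yd_tens (yd_unit B) V) V (@tlunit k V).
Proof.
case=> a1 aM _ _ _; split=> [b|]; tpure a v.
  rewrite act_tens tlunitE.
  transitivity ((a : k) *: \tsum_(x, y <- comulB B b) ((counitB B x : k) *: act (y \ox v))).
    rewrite scaler_tsum; move: (comulB B b); tpure x y; rewrite !tsumE; [te|blin..].
    by rewrite /= /tlunit /= ; te; rewrite scalerA mulrC.
  rewrite (counitB_l (F := fun y => act (y \ox v))); last by lin.
  by rewrite !linearZ.
rewrite coact_tens tlunitE linearZ /=.
move: (coact v); tpure b v0; rewrite !tsumE; [te; rewrite mul1r tpureZr|blin..].
done.
Qed.

Lemma ydm_runit V : is_yd V -> @yd_morph k B (yd_tens V (yd_unit B)) V (@trunit k V).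
Proof.
case=> a1 aM _ _ _; split=> [b|]; tpure v a.
  rewrite act_tens trunitE.
  transitivity ((a : k) *: \tsum_(x, y <- comulB B b) ((counitB B y : k) *: act (x \ox v))).
    rewrite scaler_tsum; move: (comulB B b); tpure x y; rewrite !tsumE; [te|blin..].
    by te; rewrite scalerA mulrC.
  rewrite (counitB_r (F := fun y => act (y \ox v))); last by lin.
  by rewrite !linearZ.
rewrite coact_tens trunitE linearZ /=.
by move: (coact v); tpure b v0; rewrite !tsumE; [te; rewrite mulr1 tpureZr|blin..].
Qed.

Lemma braid_nat V W V' W' (f : {linear V -> V'}) (g : {linear W -> W'}) v w :
  yd_morph f -> yd_morph g ->
  C V' W' (f v \ox g w) = tmap g f (C V W (v \ox w)).
Proof.
move=> [_ f2] [g1 _]; rewrite !braidE f2.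
move: (coact v); tpure b v0; rewrite !tsumE; [te; rewrite g1 tsumE //; blin|blin..].
Qed.

Definition yd_invariant V (v : V) : Prop :=
  (forall b : B, act (b \ox v) = (counitB B b : k) *: v) /\ coact v = 1 \ox v.

Lemma braid_invl V W (v : V) (w : W) : is_yd W -> yd_invariant v ->
  C V W (v \ox w) = w \ox v.
Proof. by case=> a1 _ _ _ _ [_ e]; rewrite braidE e tsumE ?a1 //; blin. Qed.

Lemma braid_invr V W (v : V) (w : W) : is_yd V -> yd_invariant w ->
  C V W (v \ox w) = w \ox v.
Proof.
case=> _ _ _ c1 _ [e _]; rewrite braidE -{2}(c1 v).
move: (coact v); tpure b v0; rewrite tsumE; [te|blin].
by rewrite e tpureZl tpureZr.
Qed.
End YDMorph.

Section BraidOps.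
Variables (k : fieldType) (B : hopfAlgebra k).
Implicit Types (V W X Y Z : ydData B) (Q : lmodType k).
Notation C V W := (@braid k B V W).

Section Nat.
Variables (V W V' W' Z : ydData B) (X : ydData B).
Hypothesis yX : is_yd X.

(** In this and the following lemmas the strand X slides across f. The final letter tells on which
    side of X the map f stands before the crossing; each rule is naturality of the braiding combined
    with a hexagon for every pair of strands. *)
Lemma braid_op21r (f : {linear tens V W -> Z}) :
  @yd_morph k B (yd_tens V W) Z f -> forall Q (t : tens X (tens V (tens W Q))),
  op22 (C X Z) (tmap idfun (op21 f) t) =
  op21 f (tmap idfun (op22 (C X W)) (op22 (C X V) t)).
Proof.
move=> mf Q t; move: t; tpure x t; move: t; tpure v t; move: t; tpure w q; te.
rewrite -[x in LHS]/(idfun x).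
rewrite (braid_nat x (v \ox w : yd_tens V W) (@ydm_id _ _ X) mf) braid_hexr //.
move: (C X V _); tpure v' x'; te.
by move: (C X W _); tpure w' x''; te.
Qed.

Lemma braid_op21l (f : {linear tens V W -> Z}) :
  @yd_morph k B (yd_tens V W) Z f -> forall Q (t : tens V (tens W (tens X Q))),
  op22 (C Z X) (op21 f t) =
  tmap idfun (op21 f) (op22 (C V X) (tmap idfun (op22 (C W X)) t)).
Proof.
move=> mf Q t; move: t; tpure v t; move: t; tpure w t; move: t; tpure x q; te.
rewrite -[x in LHS]/(idfun x).
rewrite (braid_nat (v \ox w : yd_tens V W) x mf (@ydm_id _ _ X)) braid_hexl //.
move: (C W X _); tpure x' w'; te.
by move: (C V X _); tpure v' x''; te.
Qed.

Lemma braid_op12r (f : {linear V -> tens W Z}) :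
  @yd_morph k B V (yd_tens W Z) f -> forall Q (t : tens X (tens V Q)),
  tmap idfun (op22 (C X Z)) (op22 (C X W) (tmap idfun (op12 f) t)) =
  op12 f (op22 (C X V) t).
Proof.
move=> mf Q t; move: t; tpure x t; move: t; tpure v q; te.
transitivity (tassoc (tassoc (C X (yd_tens W Z) (x \ox f v) \ox q))).
  move: (f v); tpure w z; rewrite braid_hexr //; te.
  move: (C X W _); tpure w' x'; te.
  by move: (C X Z _); tpure w'' x''; te.
rewrite -[x in LHS]/(idfun x) (braid_nat x v (@ydm_id _ _ X) mf).
move: (C X V _); tpure v' x'; te.
by move: (f _); tpure w z; te.
Qed.

Lemma braid_op12l (f : {linear V -> tens W Z}) :
  @yd_morph k B V (yd_tens W Z) f -> forall Q (t : tens V (tens X Q)),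
  op22 (C W X) (tmap idfun (op22 (C Z X)) (op12 f t)) =
  tmap idfun (op12 f) (op22 (C V X) t).
Proof.
move=> mf Q t; move: t; tpure v t; move: t; tpure x q; te.
transitivity (tmap idfun (@tassoc k W Z Q) (tassoc (C (yd_tens W Z) X (f v \ox x) \ox q))).
  move: (f v); tpure w z; rewrite braid_hexl //; te.
  move: (C Z X _); tpure w' x'; te.
  by move: (C W X _); tpure w'' x''; te.
rewrite -[x in LHS]/(idfun x) (braid_nat v x mf (@ydm_id _ _ X)).
move: (C V X _); tpure v' x'; te.
by move: (f _); tpure w z; te.
Qed.

(** A map f into the ground field is a morphism to the unit object, whose crossings are trivial;
    this is how X passes an evaluation or a counit below. *)
Lemma unit_inv (a : yd_unit B) : yd_invariant a.
Proof. by split=> [b|] /=; te => //; rewrite -[in RHS](mulr1 a) tpureZr. Qed.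

Lemma braid_op20r (f : {linear tens V W -> k^o}) :
  @yd_morph k B (yd_tens V W) (yd_unit B) f -> forall Q (t : tens X (tens V (tens W Q))),
  op20 f (tmap idfun (op22 (C X W)) (op22 (C X V) t)) = tmap idfun (op20 f) t.
Proof.
move=> mf Q t; move: t; tpure x t; move: t; tpure v t; move: t; tpure w q; te.
transitivity (tlunit (C X (yd_unit B) (x \ox f (v \ox w)) : tens k^o X) \ox q); last first.
  by rewrite (braid_invr x yX (unit_inv _)); te; rewrite tpureZl tpureZr.
rewrite -[x in RHS]/(idfun x).
rewrite (braid_nat x (v \ox w : yd_tens V W) (@ydm_id _ _ X) mf) braid_hexr //.
move: (C X V _); tpure v' x'; te.
by move: (C X W _); tpure w' x''; te; rewrite tpureZl.
Qed.

Lemma braid_op20l (f : {linear tens V W -> k^o}) :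
  @yd_morph k B (yd_tens V W) (yd_unit B) f -> forall Q (t : tens V (tens W (tens X Q))),
  tmap idfun (op20 f) (op22 (C V X) (tmap idfun (op22 (C W X)) t)) = op20 f t.
Proof.
move=> mf Q t; move: t; tpure v t; move: t; tpure w t; move: t; tpure x q; te.
transitivity (trunit (C (yd_unit B) X (f (v \ox w) \ox x) : tens X k^o) \ox q); last first.
  by rewrite (braid_invl x yX (unit_inv _)); te; rewrite tpureZl.
rewrite -[x in RHS]/(idfun x).
rewrite (braid_nat (v \ox w : yd_tens V W) x mf (@ydm_id _ _ X)) braid_hexl //.
move: (C W X _); tpure x' w'; te.
by move: (C V X _); tpure v' x''; te; rewrite tpureZl tpureZr.
Qed.

Lemma braid_op10r (f : {linear V -> k^o}) :
  @yd_morph k B V (yd_unit B) f -> forall Q (t : tens X (tens V Q)),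
  op10 f (op22 (C X V) t) = tmap idfun (op10 f) t.
Proof.
move=> mf Q t; move: t; tpure x t; move: t; tpure v q; te.
transitivity (tlunit (C X (yd_unit B) (x \ox f v) : tens k^o X) \ox q); last first.
  by rewrite (braid_invr x yX (unit_inv _)); te; rewrite tpureZl tpureZr.
rewrite -[x in RHS]/(idfun x) (braid_nat x v (@ydm_id _ _ X) mf).
by move: (C X V _); tpure v' x'; te; rewrite tpureZl.
Qed.

Lemma braid_op10l (f : {linear V -> k^o}) :
  @yd_morph k B V (yd_unit B) f -> forall Q (t : tens V (tens X Q)),
  tmap idfun (op10 f) (op22 (C V X) t) = op10 f t.
Proof.
move=> mf Q t; move: t; tpure v t; move: t; tpure x q; te.
transitivity (trunit (C (yd_unit B) X (f v \ox x) : tens X k^o) \ox q); last first.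
  by rewrite (braid_invl x yX (unit_inv _)); te; rewrite tpureZl.
rewrite -[x in RHS]/(idfun x) (braid_nat v x mf (@ydm_id _ _ X)).
by move: (C V X _); tpure x' v'; te; rewrite tpureZl tpureZr.
Qed.

Lemma braid_op11r (f : {linear V -> Z}) :
  yd_morph f -> forall Q (t : tens X (tens V Q)),
  op22 (C X Z) (tmap idfun (op11 f) t) = op11 f (op22 (C X V) t).
Proof.
move=> mf Q t; move: t; tpure x t; move: t; tpure v q; te.
rewrite -[x in LHS]/(idfun x) (braid_nat x v (@ydm_id _ _ X) mf).
by move: (C X V _); tpure v' x'; te.
Qed.

Lemma braid_op11l (f : {linear V -> Z}) :
  yd_morph f -> forall Q (t : tens V (tens X Q)),
  op22 (C Z X) (op11 f t) = tmap idfun (op11 f) (op22 (C V X) t).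
Proof.
move=> mf Q t; move: t; tpure v t; move: t; tpure x q; te.
rewrite -[x in LHS]/(idfun x) (braid_nat v x mf (@ydm_id _ _ X)).
by move: (C V X _); tpure x' v'; te.
Qed.

(** With a braiding for f this is the Yang-Baxter equation. *)
Lemma braid_op22r (f : {linear tens V W -> tens V' W'}) :
  @yd_morph k B (yd_tens V W) (yd_tens V' W') f -> forall Q (t : tens X (tens V (tens W Q))),
  tmap idfun (op22 (C X W')) (op22 (C X V') (tmap idfun (op22 f) t)) =
  op22 f (tmap idfun (op22 (C X W)) (op22 (C X V) t)).
Proof.
move=> mf Q t; move: t; tpure x t; move: t; tpure v t; move: t; tpure w q; te.
transitivity (tassoc (tassoc (C X (yd_tens V' W') (x \ox f (v \ox w)) \ox q))).
  move: (f _); tpure w1 z; rewrite braid_hexr //; te.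
  move: (C X V' _); tpure w' x'; te.
  by move: (C X W' _); tpure w'' x''; te.
rewrite -[x in LHS]/(idfun x).
rewrite (braid_nat x (v \ox w : yd_tens V W) (@ydm_id _ _ X) mf) braid_hexr //.
move: (C X V _); tpure v' x'; te.
move: (C X W _); tpure w' x''; te.
by move: (f _); tpure v1 w1; te.
Qed.

End Nat.
End BraidOps.

Section OpYdm.
Variables (k : fieldType) (B : hopfAlgebra k).
Implicit Types V W X : ydData B.

Lemma ydm_tmapr V W W' (f : {linear W -> W'}) : @yd_morph k B W W' f ->
  @yd_morph k B (yd_tens V W) (yd_tens V W') (tmap idfun f).
Proof. by move=> mf; apply: (@ydm_tmap _ _ V W V W' idfun f (ydm_id V) mf). Qed.

Lemma ydm_op22 V W V' W' X (f : {linear tens V W -> tens V' W'}) :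
  @yd_morph k B (yd_tens V W) (yd_tens V' W') f ->
  @yd_morph k B (yd_tens V (yd_tens W X)) (yd_tens V' (yd_tens W' X)) (op22 f (X:=X)).
Proof.
move=> mf; exact: (ydm_comp (ydm_assoc V' W' X)
  (ydm_comp (ydm_tmap mf (ydm_id X)) (ydm_assocV V W X))).
Qed.
End OpYdm.

(** * Hopf algebras: the antipode *)

Section TailForms.
Variable k : fieldType.
Implicit Types V W X Y Z Q : lmodType k.

(** Taking 1 in the ground field as last factor turns an identity between diagrams back into one
    between maps. *)
Lemma tpure1_inj V : injective (fun v : V => v \ox (1 : k^o)).
Proof. by move=> v w /(congr1 (@trunit k V)); rewrite !trunitE !scale1r. Qed.

Section Alg.
Variables (V : lmodType k) (m : {linear tens V V -> V}) (e : V).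
Lemma op21A :
  (forall x y z, m (m (x \ox y) \ox z) = m (x \ox m (y \ox z))) ->
  forall Q (t : tens V (tens V (tens V Q))),
  op21 m (op21 m t) = op21 m (tmap idfun (op21 m) t).
Proof.
move=> mm Q; tpure x t; move: t; tpure y t; move: t; tpure z t.
by te; rewrite mm.
Qed.

Lemma op21_1l : (forall x, m (e \ox x) = x) ->
  forall Q (t : tens V Q), op21 m (op01 e t) = t.
Proof. by move=> h Q; tpure x t; te; rewrite h. Qed.

Lemma op21_1r : (forall x, m (x \ox e) = x) ->
  forall Q (t : tens V Q), op21 m (tmap idfun (op01 e) t) = t.
Proof. by move=> h Q; tpure x t; te; rewrite h. Qed.
End Alg.

Section Coalg.
Variables (V : lmodType k) (d : {linear V -> tens V V}) (e : {linear V -> k^o}).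
Lemma op12A :
  (forall x, tassoc (tmap d idfun (d x)) = tmap idfun d (d x)) ->
  forall Q (t : tens V Q),
  op12 d (op12 d t) = tmap idfun (op12 d) (op12 d t).
Proof.
move=> h Q; tpure x q; te.
transitivity (tmap idfun (@tassoc k V V Q) (tassoc (tassoc (tmap d idfun (d x)) \ox q))).
  move: (d x); tpure y z; te.
  by move: (d y); tpure y1 y2; te.
by rewrite h; move: (d x); tpure y z; te.
Qed.

Lemma op12_1l : (forall x, tlunit (tmap e idfun (d x)) = x) ->
  forall Q (t : tens V Q), op10 e (op12 d t) = t.
Proof.
move=> h Q; tpure x q; te; rewrite -{2}(h x).
by move: (d x); tpure y z; te; rewrite tpureZl.
Qed.

Lemma op12_1r : (forall x, trunit (tmap idfun e (d x)) = x) ->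
  forall Q (t : tens V Q), tmap idfun (op10 e) (op12 d t) = t.
Proof.
move=> h Q; tpure x q; te; rewrite -{2}(h x).
by move: (d x); tpure y z; te; rewrite tpureZl tpureZr.
Qed.
End Coalg.

Section Bialg.
Variables (V : lmodType k) (m : {linear tens V V -> V}) (u : V).
Variables (d : {linear V -> tens V V}) (e : {linear V -> k^o}) (S : {linear V -> V}).
Variable (c : {linear tens V V -> tens V V}).

Lemma op_comulM :
  (forall x y, d (m (x \ox y)) = tmap m m (tmid c (d x \ox d y))) ->
  forall Q (t : tens V (tens V Q)), op12 d (op21 m t) =
  tmap idfun (op21 m) (op21 m (tmap idfun (op22 c)
    (tmap idfun (tmap idfun (op12 d)) (op12 d t)))).
Proof.
move=> h Q; tpure x t; move: t; tpure y q; te; rewrite h.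
move: (d x); tpure x1 x2; te; move: (d y); tpure y1 y2; rewrite tmidE; te.
by move: (c _); tpure a b; te.
Qed.

Lemma op_counitM : (forall x y, e (m (x \ox y)) = (e x : k) * e y) ->
  forall Q (t : tens V (tens V Q)), op10 e (op21 m t) = op10 e (op10 e t).
Proof.
move=> h Q; tpure x t; move: t; tpure y q; te; rewrite h linearZ /=; te.
by rewrite scalerA.
Qed.

Lemma op_comul1 : d u = u \ox u -> forall Q (t : Q), op12 d (op01 u t) = op01 u (op01 u t).
Proof. by move=> h Q t; te; rewrite h; te. Qed.

Lemma op_antipodel : (forall x, m (tmap S idfun (d x)) = (e x : k) *: u) ->
  forall Q (t : tens V Q), op21 m (op11 S (op12 d t)) = op01 u (op10 e t).
Proof.
move=> h Q; tpure x q; te; rewrite tpureZr -tpureZl -h.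
by move: (d x); tpure a b; te.
Qed.

Lemma op_antipoder : (forall x, m (tmap idfun S (d x)) = (e x : k) *: u) ->
  forall Q (t : tens V Q), op21 m (tmap idfun (op11 S) (op12 d t)) = op01 u (op10 e t).
Proof.
move=> h Q; tpure x q; te; rewrite tpureZr -tpureZl -h.
by move: (d x); tpure a b; te.
Qed.
End Bialg.
End TailForms.

(** The final shape is evaluated beforehand, so that the tail form [lem] unifies with the unfolded
    semantics of the words. *)
Ltac rule_tac lem :=
  let post := fresh "post" in let t := fresh "t" in
  intros post t;
  match goal with |- @run ?k ?base ?ob ?sig ?w (@st _ _ _ ?l _) = _ =>
    let l' := eval lazy in (@wshape k base ob sig w l) in
    exact (congr1 (@st k base ob l') (lem _ t)) end.
Tactic Notation "rule" uconstr(l) ":" uconstr(a) "~>" uconstr(b) "by" constr(lem) :=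
  refine (@Rule _ _ _ _ l a b _); rule_tac lem.

(** Unfolds an equality of words into the equality of composites of [op] maps for which it
    stands. *)
Ltac word_eq W :=
  let h := fresh "h" in
  have h := W;
  match type of h with @run _ _ _ ?s _ _ = _ => try unfold s in h end;
  lazy [run foldl run1 happ step hcons hid strip nateq eq_cons projT1 projT2 fst snd
        nth gen21 gen22 gen12 gen11 gen20 gen10 gen01 gen00 sem dom cod st size cat
        eq_rect] in h;
  let h' := fresh "h" in
  match type of h with
    @existT _ (fun l => GRing.Lmodule.sort (@T ?k ?base ?ob l)) ?l ?x = existT _ _ ?y =>
    have h' := @st_inj k base ob l x y h; try unfold ob in h';
    lazy [T nth reverse_coercion] in h'
  end;
  lazy [reverse_coercion]; exact h'.

(* The arguments are the table of arities, the script, and the transpositions left after its last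
   rule. *)
Tactic Notation "diagram" uconstr(ars) uconstr(s) uconstr(ss) :=
  refine (@weq_eq _ _ _ _ _ ars _ _ _ s ss _ _ _); by [].

Section Antipode.
Variables (k : fieldType) (V : lmodType k).
Variables (m : {linear tens V V -> V}) (u : V).
Variables (d : {linear V -> tens V V}) (e : {linear V -> k^o}) (S : {linear V -> V}).
Variable (c : {linear tens V V -> tens V V}).
Hypothesis hmA : forall x y z, m (m (x \ox y) \ox z) = m (x \ox m (y \ox z)).
Hypothesis hml : forall x, m (u \ox x) = x.
Hypothesis hmr : forall x, m (x \ox u) = x.
Hypothesis hdA : forall x, tassoc (tmap d idfun (d x)) = tmap idfun d (d x).
Hypothesis hdl : forall x, tlunit (tmap e idfun (d x)) = x.
Hypothesis hdr : forall x, trunit (tmap idfun e (d x)) = x.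
Hypothesis hdm : forall x y, d (m (x \ox y)) = tmap m m (tmid c (d x \ox d y)).
Hypothesis hdu : d u = u \ox u.
Hypothesis hem : forall x y, e (m (x \ox y)) = (e x : k) * e y.
Hypothesis hSl : forall x, m (tmap S idfun (d x)) = (e x : k) *: u.
Hypothesis hSr : forall x, m (tmap idfun S (d x)) = (e x : k) *: u.
Hypothesis hCdr : forall Q (t : tens V (tens V Q)),
  tmap idfun (op22 c) (op22 c (tmap idfun (op12 d) t)) = op12 d (op22 c t).
Hypothesis hCdl : forall Q (t : tens V (tens V Q)),
  op22 c (tmap idfun (op22 c) (op12 d t)) = tmap idfun (op12 d) (op22 c t).
Hypothesis hCmr : forall Q (t : tens V (tens V (tens V Q))),
  op22 c (tmap idfun (op21 m) t) =
  op21 m (tmap idfun (op22 c) (op22 c t)).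
Hypothesis hCml : forall Q (t : tens V (tens V (tens V Q))),
  op22 c (op21 m t) = tmap idfun (op21 m) (op22 c (tmap idfun (op22 c) t)).
Hypothesis hCer : forall Q (t : tens V (tens V Q)), op10 e (op22 c t) = tmap idfun (op10 e) t.
Hypothesis hCel : forall Q (t : tens V (tens V Q)), tmap idfun (op10 e) (op22 c t) = op10 e t.
Hypothesis hCur : forall Q (t : tens V Q), op22 c (tmap idfun (op01 u) t) = op01 u t.
Hypothesis hCul : forall Q (t : tens V Q), op22 c (op01 u t) = tmap idfun (op01 u) t.

Section Words.
Variable Q : lmodType k.
Let ob (n : nat) : lmodType k := V.
Let sig : nat -> gen Q ob := nth (gen00 Q ob)
  [:: @gen21 k Q ob 0 0 0 m; @gen12 k Q ob 0 0 0 d; @gen10 k Q ob 0 e; @gen01 k Q ob 0 u;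
      @gen11 k Q ob 0 0 S; @gen22 k Q ob 0 0 0 0 c]%N.
Notation gm := 0%N.
Notation gd := 1%N.
Notation ge := 2%N.
Notation gu := 3%N.
Notation gS := 4%N.
Notation gC := 5%N.

Local Open Scope nat_scope.
Let ars := [:: ([:: 0; 0], [:: 0]); ([:: 0], [:: 0; 0]); ([:: 0], [::]); ([::], [:: 0]);
  ([:: 0], [:: 0]); ([:: 0; 0], [:: 0; 0])].
Let rmA : rule sig.
Proof. rule [:: 0; 0; 0] : [:: (0, gm); (0, gm)] ~> [:: (1, gm); (0, gm)] by (op21A hmA). Defined.
Let rml : rule sig.
Proof. rule [:: 0] : [:: (0, gu); (0, gm)] ~> [::] by (op21_1l hml). Defined.
Let rmr : rule sig.
Proof. rule [:: 0] : [:: (1, gu); (0, gm)] ~> [::] by (op21_1r hmr). Defined.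
Let rdA : rule sig.
Proof. rule [:: 0] : [:: (0, gd); (0, gd)] ~> [:: (0, gd); (1, gd)] by (op12A hdA). Defined.
Let rdl : rule sig.
Proof. rule [:: 0] : [:: (0, gd); (0, ge)] ~> [::] by (op12_1l hdl). Defined.
Let rdr : rule sig.
Proof. rule [:: 0] : [:: (0, gd); (1, ge)] ~> [::] by (op12_1r hdr). Defined.
Let rdm : rule sig.
Proof. rule [:: 0; 0] : [:: (0, gm); (0, gd)] ~> [:: (0, gd); (2, gd); (1, gC); (0, gm); (1, gm)]
  by (op_comulM hdm). Defined.
Let rem : rule sig.
Proof. rule [:: 0; 0] : [:: (0, gm); (0, ge)] ~> [:: (0, ge); (0, ge)] by (op_counitM hem). Defined.
Let rdu : rule sig.
Proof. rule [::] : [:: (0, gu); (0, gd)] ~> [:: (0, gu); (0, gu)] by (op_comul1 hdu). Defined.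
Let rSl : rule sig.
Proof. rule [:: 0] : [:: (0, gd); (0, gS); (0, gm)] ~> [:: (0, ge); (0, gu)] by (op_antipodel
  hSl). Defined.
Let rSr : rule sig.
Proof. rule [:: 0] : [:: (0, gd); (1, gS); (0, gm)] ~> [:: (0, ge); (0, gu)] by (op_antipoder
  hSr). Defined.
Let rCmr : rule sig.
Proof. rule [:: 0; 0; 0] : [:: (1, gm); (0, gC)] ~> [:: (0, gC); (1, gC); (0, gm)] by (hCmr).
  Defined.
Let rCml : rule sig.
Proof. rule [:: 0; 0; 0] : [:: (0, gm); (0, gC)] ~> [:: (1, gC); (0, gC); (1, gm)] by (hCml).
  Defined.
Let rCdr : rule sig.
Proof. rule [:: 0; 0] : [:: (1, gd); (0, gC); (1, gC)] ~> [:: (0, gC); (0, gd)] by (hCdr). Defined.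
Let rCdl : rule sig.
Proof. rule [:: 0; 0] : [:: (0, gd); (1, gC); (0, gC)] ~> [:: (0, gC); (1, gd)] by (hCdl). Defined.
Let rCel : rule sig.
Proof. rule [:: 0; 0] : [:: (0, gC); (1, ge)] ~> [:: (0, ge)] by (hCel). Defined.
Let rCer : rule sig.
Proof. rule [:: 0; 0] : [:: (0, gC); (0, ge)] ~> [:: (1, ge)] by (hCer). Defined.
Let rCur : rule sig.
Proof. rule [:: 0] : [:: (1, gu); (0, gC)] ~> [:: (0, gu)] by (hCur). Defined.
Let rCul : rule sig.
Proof. rule [:: 0] : [:: (0, gu); (0, gC)] ~> [:: (1, gu)] by (hCul). Defined.

(** Both sides are convolution inverses of the product in Hom(V (x) V, V), and the script spells out
    the uniqueness of inverses. Of the crossing c only naturality is known, so that the result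
    serves both for C_(H,H) and for the flip of B. *)
Lemma antipode_mul_word : weq sig [:: 0; 0] [:: (0, gm); (0, gS)]
  [:: (0, gC); (0, gS); (1, gS); (0, gm)].
Proof.
diagram ars [:: ([::], 0, 0, rflip rdr); ([::], 1, 1, rflip rCel); ([::], 0, 1, rflip rdr);
    ([::], 7, 0, rflip rmr); ([:: 1; 0; 2; 4; 3; 5; 4; 5; 5], 6, 1, rflip rSr);
    ([:: 5], 6, 2, rflip rCer); ([::], 9, 2, rflip rml); ([:: 7], 8, 2, rflip rSr);
    ([:: 7; 8], 10, 2, rmA); ([::], 11, 1, rflip rmA); ([:: 10; 9; 8], 6, 2, rflip rCdr);
    ([:: 8; 4; 3; 5; 4; 6; 5; 5; 4; 6; 5; 8], 6, 2, rCdr); ([:: 8; 9; 10], 11, 1, rmA);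
    ([::], 10, 2, rflip rmA); ([:: 8; 7], 8, 2, rSr); ([::], 2, 1, rflip rCdl);
    ([:: 1; 6; 5; 4], 2, 2, rCdr); ([::], 8, 2, rflip rSr);
    ([:: 6; 5; 4; 3; 7; 6; 5], 4, 2, rflip rdA); ([::], 0, 0, rflip rdA); ([::], 10, 2, rmA);
    ([::], 11, 1, rflip rmA); ([::], 12, 0, rflip rmA); ([:: 3], 2, 2, rflip rCdr);
    ([:: 1; 2; 5; 4; 6; 5; 9; 8; 7; 10; 9; 5; 4; 3; 6; 5; 4; 7; 6; 5; 8; 7; 6; 11], 7, 0, rflip
      rdm);
    ([::], 8, 0, rSl); ([:: 8; 7; 9; 8], 9, 0, rem); ([:: 8; 7; 9; 8], 9, 0, rml);
    ([:: 0; 6; 5; 4; 3; 2], 1, 0, rdl); ([:: 5; 4; 3; 2], 1, 0, rCer); ([::], 0, 1, rdl)] [::].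
Qed.

(** Dually, both sides are convolution inverses of the coproduct in Hom(V, V (x) V). *)
Lemma antipode_comul_word : weq sig [:: 0] [:: (0, gS); (0, gd)]
  [:: (0, gd); (1, gS); (0, gS); (0, gC)].
Proof.
diagram ars [:: ([::], 2, 0, rflip rmr); ([::], 2, 1, rflip rCur); ([::], 0, 0, rflip rdr);
    ([::], 6, 2, rflip rmr); ([:: 5; 4; 3; 2; 4; 3; 3; 2; 1; 4; 3; 2; 3; 7], 4, 2, rflip rSr);
    ([:: 3; 4], 5, 3, rflip rCul); ([:: 4], 4, 3, rflip rdl); ([:: 6; 5], 6, 3, rflip rSr);
    ([:: 5; 6; 7], 4, 3, rdA); ([::], 3, 2, rflip rdA); ([:: 7], 8, 3, rCml);
    ([:: 2; 1; 4; 3; 2; 6; 5; 4; 3; 6; 5; 4; 7; 6; 5; 7; 6; 8; 7; 9; 8; 10; 9; 13; 9; 8; 7; 10; 9;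
      8; 5; 6; 7], 8, 3, rflip rCml);
    ([:: 5; 4; 3; 2; 1; 6; 5; 4; 3; 2; 6; 5; 4], 3, 2, rdA); ([::], 4, 3, rflip rdA);
    ([:: 5], 6, 3, rSr); ([::], 9, 1, rCmr); ([:: 8; 11], 9, 2, rflip rCml);
    ([:: 7; 6], 7, 3, rflip rSr); ([:: 5; 4; 6], 5, 3, rdA); ([:: 4], 3, 2, rflip rdA);
    ([:: 2; 1], 0, 0, rflip rdA); ([::], 9, 2, rflip rmA); ([::], 12, 0, rflip rmA);
    ([:: 11; 10], 11, 1, rCml);
    ([:: 3; 2; 5; 6; 7; 10; 9; 8; 2; 4; 3; 5; 4; 6; 5; 7; 6; 7; 10], 7, 0, rflip rdm);
    ([:: 2; 1; 3; 2; 4; 3; 5; 4], 5, 0, rSl); ([::], 6, 0, rdu);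
    ([:: 4; 3; 2; 1; 5; 4; 3; 2; 6; 5; 4; 3; 3; 4; 5; 6; 7; 8], 9, 0, rml); ([::], 0, 0, rdl);
    ([::], 4, 0, rflip rCml); ([:: 0; 1; 2], 3, 0, rml)] [::].
Qed.
End Words.

Lemma antipode_mul x y : S (m (x \ox y)) = m (tmap S S (c (x \ox y))).
Proof.
have h (t : tens V (tens V k^o)) : op11 S (op21 m t) =
    op21 m (tmap idfun (op11 S) (op11 S (op22 c t))) :=
  st_inj (antipode_mul_word t).
apply: tpure1_inj; have := h (x \ox (y \ox (1 : k^o))); te => ->.
by move: (c _); tpure a b; te.
Qed.

Lemma antipode_comul x : d (S x) = c (tmap S S (d x)).
Proof.
have h (t : tens V k^o) : op12 d (op11 S t) =
    op22 c (op11 S (tmap idfun (op11 S) (op12 d t))) :=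
  st_inj (antipode_comul_word t).
apply: tpure1_inj; have := h (x \ox (1 : k^o)); te.
move/(congr1 (@tassocV k V V k^o)); rewrite tassocK => ->.
by move: (d x); tpure a b; te; rewrite tassocK.
Qed.
End Antipode.

(** * The antipode of B and its bijectivity *)

Section AntipodeB.
Variables (k : fieldType) (B : hopfAlgebra k).
Notation S := (antipodeB B).
Notation eps := (counitB B).
Notation D := (comulB B).

Lemma antipodeB1 : S 1 = 1.
Proof.
by have := antipodeBl (1 : B); rewrite comulB1 tmapE tmulE mulr1 counitB1 scale1r.
Qed.

Lemma counitB_antipode b : eps (S b) = eps b.
Proof.
have := counitB_r b (F := fun x => eps (S x)); rewrite -[X in _ -> X]/(eps (S b) = _).
move=> <-; last by lin.
have := congr1 eps (antipodeBl b); rewrite linearZ /= counitB1 [X in _ = X -> _]mulr1 => <-.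
move: (D b); tpure x y; rewrite tsumE; last by blin.
by te; rewrite counitBM mulrC.
Qed.

Let m : {linear tens B B -> B} := @tmul k B.
Let c : {linear tens B B -> tens B B} := @tflip k B B.

Let mE x y : m (x \ox y) = x * y.
Proof. exact: tmulE. Qed.

Let mA x y z : m (m (x \ox y) \ox z) = m (x \ox m (y \ox z)).
Proof. by rewrite !mE mulrA. Qed.
Let ml x : m (1 \ox x) = x.
Proof. by rewrite mE mul1r. Qed.
Let mr x : m (x \ox 1) = x.
Proof. by rewrite mE mulr1. Qed.
Let DM x y : D (m (x \ox y)) = tmap m m (tmid c (D x \ox D y)).
Proof. by rewrite mE comulBM. Qed.
Let epsM x y : eps (m (x \ox y)) = (eps x : k) * eps y.
Proof. by rewrite mE counitBM. Qed.
Let cDr Q (t : tens B (tens B Q)) :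
  tmap idfun (op22 c) (op22 c (tmap idfun (op12 D) t)) = op12 D (op22 c t).
Proof.
by move: t; tpure x t; move: t; tpure y q; te; move: (D y); tpure a b; te.
Qed.
Let cDl Q (t : tens B (tens B Q)) :
  op22 c (tmap idfun (op22 c) (op12 D t)) = tmap idfun (op12 D) (op22 c t).
Proof.
by move: t; tpure x t; move: t; tpure y q; te; move: (D x); tpure a b; te.
Qed.
Let cml Q (t : tens B (tens B (tens B Q))) :
  op22 c (op21 m t) = tmap idfun (op21 m) (op22 c (tmap idfun (op22 c) t)).
Proof. by move: t; tpure x t; move: t; tpure y t; move: t; tpure z q; te. Qed.
Let cmr Q (t : tens B (tens B (tens B Q))) :
  op22 c (tmap idfun (op21 m) t) = op21 m (tmap idfun (op22 c) (op22 c t)).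
Proof. by move: t; tpure x t; move: t; tpure y t; move: t; tpure z q; te. Qed.
Let cer Q (t : tens B (tens B Q)) :
  op10 eps (op22 c t) = tmap idfun (op10 eps) t.
Proof. by move: t; tpure x t; move: t; tpure y q; te; rewrite tpureZr. Qed.
Let cel Q (t : tens B (tens B Q)) :
  tmap idfun (op10 eps) (op22 c t) = op10 eps t.
Proof. by move: t; tpure x t; move: t; tpure y q; te; rewrite tpureZr. Qed.
Let cur Q (t : tens B Q) : op22 c (tmap idfun (op01 (1 : B)) t) = op01 (1 : B) t.
Proof. by move: t; tpure x q; te. Qed.
Let cul Q (t : tens B Q) : op22 c (op01 (1 : B) t) = tmap idfun (op01 (1 : B)) t.
Proof. by move: t; tpure x q; te. Qed.

Lemma antipodeBM x y : S (x * y) = S y * S x.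
Proof.
have := antipode_mul mA ml mr (@comulB_coassoc k B) (@counitBl k B) (@counitBr k B)
  DM epsM (@antipodeBl k B) (@antipodeBr k B) cDr cDl cer cel x y.
by rewrite mE /c; te.
Qed.

Lemma antipodeB_comul x : D (S x) = tflip (tmap S S (D x)).
Proof.
exact: (antipode_comul mA ml mr (@comulB_coassoc k B) (@counitBl k B) (@counitBr k B)
  DM (@comulB1 k B) (@antipodeBl k B) (@antipodeBr k B)).
Qed.

(* The iterate S^i reverses products exactly when i is odd. *)
Definition convB (i : nat) (x y : B) : B := if odd i then y * x else x * y.

Lemma iterSM i x y : iter i S (x * y) = convB i (iter i S x) (iter i S y).
Proof.
elim: i => //= i ->; rewrite /convB /=; case: (odd i) => /=; exact: antipodeBM.
Qed.

Lemma iterS_linear i : linear (iter i S).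
Proof. by elim: i => [|i IH] a x y //=; rewrite IH linearP. Qed.

Lemma iterS1 i : iter i S 1 = 1.
Proof. by elim: i => //= i ->; apply: antipodeB1. Qed.

Lemma iterS_counit i x : eps (iter i S x) = eps x.
Proof. by elim: i => //= i <-; apply: counitB_antipode. Qed.

(** Each application of S flips the coproduct, and in an even power the flips cancel. *)
Lemma iterS_comul i x : ~~ odd i -> D (iter i S x) = tmap (iter i S) (iter i S) (D x).
Proof.
move=> ei; rewrite -(even_halfK ei) -addnn; move: (i./2) => n.
elim: n x => [|n IH] x; first by rewrite /= tmap_id.
rewrite addSn addnS /= !antipodeB_comul IH.
have l1 := iterS_linear (n + n); move: (D x) => t; rewrite -[iter (n + n) S]/(mklin l1 : _ -> _).
pose S2 := S \o (S \o mklin l1).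
rewrite -[RHS]/(tmap S2 S2 t).
by move: t; tpure a b; te.
Qed.

Lemma convB_lin1 i (V : lmodType k) (f : V -> B) (y : B) : linear f -> linear (fun x => convB i (f
  x) y).
Proof. by rewrite /convB; case: odd => lf; lin. Qed.
Lemma convB_lin2 i (V : lmodType k) (f : V -> B) (y : B) : linear f -> linear (fun x => convB i y
  (f x)).
Proof. by rewrite /convB; case: odd => lf; lin. Qed.

(** In the convolution algebra of B, with the product reversed for odd i, a left inverse F and a
    right inverse F' of G agree: both equal F G F'. *)
Lemma convB_inv i (F G F' : B -> B) : linear F -> linear G -> linear F' ->
  (forall b, \tsum_(x, y <- D b) convB i (F x) (G y) = (eps b : k) *: 1) ->
  (forall b, \tsum_(x, y <- D b) convB i (G x) (F' y) = (eps b : k) *: 1) ->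
  F =1 F'.
Proof.
move=> lF lG lF' FG GF' b.
have c1l (x : B) : convB i 1 x = x by rewrite /convB; case: odd; rewrite ?mulr1 ?mul1r.
have c1r (x : B) : convB i x 1 = x by rewrite /convB; case: odd; rewrite ?mulr1 ?mul1r.
have cA (x y z : B) : convB i (convB i x y) z = convB i x (convB i y z).
  by rewrite /convB; case: odd; rewrite mulrA.
have cZr a (x y : B) : convB i x (a *: y) = a *: convB i x y.
  by rewrite /convB; case: odd; rewrite -?scalerAl -?scalerAr.
have cZl a (x y : B) : convB i (a *: x) y = a *: convB i x y.
  by rewrite /convB; case: odd; rewrite -?scalerAl -?scalerAr.
have cS (V W : lmodType k) (t : tens V W) (f : V -> W -> B) (x : B) : convB i x (tsum f t) = tsum
  (fun v w => convB i x (f v w)) t.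
  by rewrite /convB; case: odd; rewrite /tsum /fsum ?mulr_suml ?mulr_sumr.
have cS' (V W : lmodType k) (t : tens V W) (f : V -> W -> B) (x : B) : convB i (tsum f t) x = tsum
  (fun v w => convB i (f v w) x) t.
  by rewrite /convB; case: odd; rewrite /tsum /fsum ?mulr_suml ?mulr_sumr.
rewrite -(counitB_r b lF) -(counitB_l b lF').
transitivity (\tsum_(x, r <- D b) \tsum_(y, z <- D r) convB i (F x) (convB i (G y) (F' z))).
  apply: eq_tsum => x r; have := congr1 (convB i (F x)) (GF' r).
  by rewrite cS => ->; rewrite cZr c1r.
rewrite -(comulB_assoc (G := fun x y z => convB i (F x) (convB i (G y) (F' z)))).
- apply: eq_tsum => r z; have := congr1 (convB i ^~ (F' z)) (FG r).
  rewrite /= cS' cZl c1l => <-; apply: eq_tsum => x y; rewrite cA //.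
- by move=> *; apply: convB_lin1.
- by move=> x z; apply: convB_lin2; apply: convB_lin1.
by move=> x y; apply: convB_lin2; apply: convB_lin2.
Qed.

(* If a coalgebra endomorphism p is absorbed by a power of the antipode, it is
   absorbed by every smaller power, because S^i and S^i p are both convolution
   inverses of S^(i+1). *)
Lemma iterS_absorb (p : {linear B -> B}) i :
  (forall b, D (p b) = tmap p p (D b)) -> (forall b, eps (p b) = eps b) ->
  (forall b, iter i S (p b) = iter i S b) -> p =1 id.
Proof.
move=> pD pe; elim: i => // i IH h; apply: IH => b.
have li := iterS_linear i; have li1 := iterS_linear i.+1.
apply: (@convB_inv i (fun b => iter i S (p b)) (iter i.+1 S) (iter i S)) => //.
- by move=> a x y; rewrite linearP li.
- move=> x.
  transitivity (\tsum_(y, z <- D (p x)) convB i (iter i S y) (iter i.+1 S z)).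
    rewrite pD tsum_tmap; last by split=> ?; [apply: convB_lin1|apply: convB_lin2].
    by apply: eq_tsum => y z; rewrite h.
  under eq_tsum => y z do rewrite iterSr -iterSM.
  rewrite (antipodeB_r (F := iter i S)) // pe iterS1 //.
move=> x; under eq_tsum => y z do rewrite iterSr -iterSM.
by rewrite (antipodeB_l (F := iter i S)) // iterS1.
Qed.

(** Fitting decomposition of a power T of S: the projection p onto its image is a coalgebra map with
    T p = T, so [iterS_absorb] forces p = id. As a power of S, T is then invertible only together
    with S. *)
Lemma antipodeB_bij : bijective S.
Proof.
pose f i : 'End(B) := linfun (mklin (iterS_linear i)).
have fE i x : f i x = iter i S x by rewrite lfunE.
have fD i j : f (i + j)%N = (f i \o f j)%VF.
  by apply/lfunP => x; rewrite comp_lfunE !fE iterD.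
have sub i j : (limg (f (i + j)%N) <= limg (f i))%VS.
  by rewrite fD limg_comp limgS // subvf.
(* Otherwise the dimension of the image of S^n drops at every step, which is impossible for 1 + dim
   B steps. *)
have [n en] : exists n, \dim (limg (f n.+1)) = \dim (limg (f n)).
  apply: contrapT => /forallNP ne.
  have lt n : (\dim (limg (f n)) + n <= \dim {:B})%N.
    elim: n => [|n IH]; first by rewrite addn0 dimvS ?subvf.
    apply: leq_trans IH; rewrite addnS ltn_add2r ltn_neqAle.
    by apply/andP; split; [apply/eqP/ne|rewrite -addn1 dimvS].
  by have := lt (\dim {:B}).+1; rewrite addnS ltnNge leq_addl.
have en1 : limg (f n.+1) = limg (f n).
  by apply/eqP; rewrite eqEdim en -{1}addn1 sub /=.
have stable j : limg (f (n + j)%N) = limg (f n).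
  elim: j => [|j IH]; first by rewrite addn0.
  by rewrite addnS -addn1 addnC fD limg_comp IH -limg_comp -fD add1n.
(* What matters is that [N.*2] is even, for [iterS_comul], at least n, where the images have
   stabilised, and positive, so that one factor S can be split off at the end. *)
pose N := (n + n.+2)%N.
have eN : ~~ odd N.*2 by rewrite odd_double.
pose T := f N.*2; have TE x : T x = iter N.*2 S x := fE _ x.
have eT : limg (T \o T)%VF = limg T.
  have e2 : N.*2 = (n + (n.+2 + N))%N by rewrite addnA -addnn.
  by rewrite /T -fD {1}e2 -addnA e2 !stable.
have injT x : T (T x) = 0 -> T x = 0.
  move=> e; have := limg_ker_dim T (limg T); rewrite -limg_comp eT => /eqP.
  rewrite -[X in _ == X]add0n eqn_add2r dimv_eq0 => /eqP e0.
  apply/eqP; rewrite -memv0 -e0 memv_cap memv_img ?memvf //=.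
  by rewrite memv_ker e.
(* A generalised inverse: T T g is the identity on the image of T T, which is the image of T. *)
pose g : 'End(B) := ((T \o T)^-1)%VF.
have gK x : T (T (g (T x))) = T x.
  have := @limg_lfunVK _ _ _ (T \o T)%VF (T x).
  by rewrite comp_lfunE; apply; rewrite eT memv_img ?memvf.
(* The projection onto the image of T along its kernel, factored as G T. *)
pose p : {linear B -> B} := (T \o g \o T)%VF.
pose G : {linear B -> B} := (T \o g)%VF.
have pE x : p x = T (g (T x)) by rewrite /p /= !comp_lfunE.
have GE x : G x = T (g x) by rewrite /G /= !comp_lfunE.
have Tp x : T (p x) = T x by rewrite pE gK.
have pT x : p (T x) = T x.
  apply/eqP; rewrite -subr_eq0 pE -linearB; apply/eqP; apply: injT.
  by rewrite !linearB /= gK subrr.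
have DT x : D (T x) = tmap T T (D x).
  by rewrite TE iterS_comul //; apply: eq_tmap => y; rewrite TE.
have GT x : G (T x) = p x by rewrite GE pE.
have comp1 (h h' h2 : {linear B -> B}) : (forall x, h (h' x) = h2 x) ->
    forall t, tmap h h (tmap h' h' t) = tmap h2 h2 t.
  by move=> e t; move: t; tpure a b; te; rewrite !e.
(* T is a coalgebra map, so D (p b) lies in the image of T (x) T, where p (x) p is the identity.
   Writing p as G T and using T p = T then replaces p b by b. *)
have pD b : D (p b) = tmap p p (D b).
  have -> : D (p b) = tmap p p (D (p b)).
    by rewrite {1 2}pE !DT (comp1 _ _ T).
  by rewrite -(comp1 _ _ _ GT) -DT Tp DT (comp1 _ _ _ GT).
have pe b : eps (p b) = eps b.
  by rewrite -(iterS_counit N.*2 (p b)) -TE Tp TE iterS_counit.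
have pid : p =1 id.
  by apply: (@iterS_absorb p N.*2) => // b; rewrite -!TE Tp.
have e2 : N.*2 = (N.*2.-1).+1 by rewrite prednK // /N addnS double_gt0.
have KS x : G (iter N.*2.-1 S (S x)) = x by rewrite -iterSr -e2 -TE GT pid.
have SK x : exists y, S y = x.
  by exists (iter N.*2.-1 S (g (T x))); rewrite -iterS -e2 -TE -pE pid.
exists (fun x => G (iter N.*2.-1 S x)) => x; first exact: KS.
by have [y <-] := SK x; rewrite KS.
Qed.

Notation Sinv := (@antipodeB_inv k B).

Lemma antipodeB_invK b : S (Sinv b) = b.
Proof.
have [g gK Kg] := antipodeB_bij.
by rewrite /antipodeB_inv; case: xgetP => [y _ //|] /(_ (g b)) /=; rewrite Kg.
Qed.

Lemma antipodeB_inv_linear : linear Sinv.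
Proof.
by move=> a x y; apply: (bij_inj antipodeB_bij); rewrite linearP !antipodeB_invK.
Qed.

HB.instance Definition _ :=
  GRing.isLinear.Build k B B *:%R Sinv antipodeB_inv_linear.

(** S is injective and reverses products, so applying it leads back to the antipode axiom. *)
Lemma antipodeB_invl (V : lmodType k) (F : B -> V) (b : B) : linear F ->
  \tsum_(x, y <- D b) F (Sinv y * x) = (eps b : k) *: F 1.
Proof.
move=> lF; rewrite -[F]/(mklin lF : _ -> _); move: (mklin lF) => {lF} G.
rewrite -linear_tsum -linearZ; congr (G _); apply: (bij_inj antipodeB_bij).
rewrite linear_tsum linearZ /= antipodeB1 -(antipodeB_l (F := id) b); last by lin.
by apply: eq_tsum => x y; rewrite antipodeBM antipodeB_invK.
Qed.

Lemma antipodeB_invr (V : lmodType k) (F : B -> V) (b : B) : linear F ->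
  \tsum_(x, y <- D b) F (y * Sinv x) = (eps b : k) *: F 1.
Proof.
move=> lF; rewrite -[F]/(mklin lF : _ -> _); move: (mklin lF) => {lF} G.
rewrite -linear_tsum -linearZ; congr (G _); apply: (bij_inj antipodeB_bij).
rewrite linear_tsum linearZ /= antipodeB1 -(antipodeB_r (F := id) b); last by lin.
by apply: eq_tsum => x y; rewrite antipodeBM antipodeB_invK.
Qed.
End AntipodeB.

Section BraidInverse.
Variables (k : fieldType) (B : hopfAlgebra k) (V W : ydData B).
Hypotheses (yV : is_yd V) (yW : is_yd W).
Notation act := (yd_act _).
Notation coact := (yd_coact _).
Notation Sinv := (@antipodeB_inv k B).

Definition braidV (t : tens W V) : tens V W :=
  \tsum_(w, v <- t) \tsum_(b, v0 <- coact v) (v0 \ox act (Sinv b \ox w)).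

Lemma braidV_linear : linear braidV.
Proof. by rewrite /braidV; lin. Qed.
HB.instance Definition _ :=
  GRing.isLinear.Build k (tens W V) (tens V W) *:%R braidV braidV_linear.

Lemma braidVE w v :
  braidV (w \ox v) = \tsum_(b, v0 <- coact v) (v0 \ox act (Sinv b \ox w)).
Proof. by rewrite /braidV tsumE; [|blin]. Qed.

(** The two actions cancel by S^-1(b_2) b_1 = eps(b) 1; in [braidVK] they cancel by b_2 S^-1(b_1) =
    eps(b) 1. *)
Lemma braidK : cancel (@braid k B V W) braidV.
Proof.
have [a1 aM _ c1 _] := yV; have [a1' aM' _ _ _] := yW.
move=> t; move: t; tpure v w.
transitivity (\tsum_(b, v0 <- coact v) \tsum_(c, v00 <- coact v0)
  (v00 \ox act (Sinv c * b \ox w))).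
  rewrite braidE; move: (coact v); tpure b v0.
  rewrite !tsumE; [|blin..]; rewrite braidVE.
  by apply: eq_tsum => c v00; rewrite aM'.
rewrite -(coact_assoc (G := fun b c v0 => v0 \ox act (Sinv c * b \ox w))) //;
  try by move=> *; lin.
under eq_tsum => b v0 do
  [rewrite (antipodeB_invl (F := fun z => v0 \ox act (z \ox w))); last by lin].
rewrite -{2}(c1 v); move: (coact v); tpure b v0.
by rewrite tsumE; [te; rewrite a1' tpureZl|blin].
Qed.

Lemma braidVK : cancel braidV (@braid k B V W).
Proof.
have [a1 aM _ c1 _] := yV; have [a1' aM' _ _ _] := yW.
move=> t; move: t; tpure w v.
transitivity (\tsum_(b, v0 <- coact v) \tsum_(c, v00 <- coact v0)
  (act (c * Sinv b \ox w) \ox v00)).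
  rewrite braidVE; move: (coact v); tpure b v0.
  rewrite !tsumE; [|blin..]; rewrite braidE.
  by apply: eq_tsum => c v00; rewrite aM'.
rewrite -(coact_assoc (G := fun b c v0 => act (c * Sinv b \ox w) \ox v0)) //;
  try by move=> *; lin.
under eq_tsum => b v0 do
  [rewrite (antipodeB_invr (F := fun z => act (z \ox w) \ox v0)); last by lin].
rewrite -{2}(c1 v); move: (coact v); tpure b v0.
by rewrite tsumE; [te; rewrite a1' tpureZr|blin].
Qed.

End BraidInverse.

(** * Smash products *)

Section TwistedProduct.
Variables (k : fieldType) (A K : lmodType k).
Variables (mA : {linear tens A A -> A}) (mK : {linear tens K K -> K}) (uA : A) (uK : K).
Variable (tau : {linear tens K A -> tens A K}).
Hypothesis mAA : forall x y z, mA (mA (x \ox y) \ox z) = mA (x \ox mA (y \ox z)).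
Hypothesis mKA : forall x y z, mK (mK (x \ox y) \ox z) = mK (x \ox mK (y \ox z)).
Hypothesis mA1l : forall x, mA (uA \ox x) = x.
Hypothesis mA1r : forall x, mA (x \ox uA) = x.
Hypothesis mK1l : forall x, mK (uK \ox x) = x.
Hypothesis mK1r : forall x, mK (x \ox uK) = x.
Hypothesis tauA : forall Q (t : tens K (tens A (tens A Q))),
  op22 tau (tmap idfun (op21 mA) t) =
  op21 mA (tmap idfun (op22 tau) (op22 tau t)).
Hypothesis tauK : forall Q (t : tens K (tens K (tens A Q))),
  op22 tau (op21 mK t) =
  tmap idfun (op21 mK) (op22 tau (tmap idfun (op22 tau) t)).
Hypothesis tau1A : forall x, tau (x \ox uA) = uA \ox x.
Hypothesis tau1K : forall a, tau (uK \ox a) = a \ox uK.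

(** A product on A (x) K from a twisting tau of K past A. The hypotheses on tau make it a
    distributive law between the two algebras; smash products and braided tensor products are both
    of this kind. *)
Definition twist_mul (t : tens (tens A K) (tens A K)) : tens A K :=
  tmap mA mK (tmid tau t).
HB.instance Definition _ := GRing.Linear.copy twist_mul (tmap mA mK \o tmid tau).

Definition twist_op (Q : lmodType k) :
    tens A (tens K (tens A (tens K Q))) -> tens A (tens K Q) :=
  tmap idfun (op21 mK) \o op21 mA \o tmap idfun (op22 tau).
HB.instance Definition _ Q := GRing.Linear.on (@twist_op Q).

Lemma twist_opE (Q : lmodType k) p q (x : Q) :
  tassoc (twist_mul (p \ox q) \ox x) = twist_op (tassoc (p \ox tassoc (q \ox x))).
Proof.
rewrite /twist_op /twist_mul; move: p; tpure a y; move: q; tpure b z; te.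
by rewrite tmidE; move: (tau _); tpure b' y'; te.
Qed.

Section Words.
Variable Q : lmodType k.
Let ob (n : nat) : lmodType k := nth K [:: A; K] n.
Let sig : nat -> gen Q ob := nth (gen00 Q ob)
  [:: @gen21 k Q ob 0 0 0 mA; @gen21 k Q ob 1 1 1 mK; @gen22 k Q ob 1 0 0 1 tau]%N.
Local Open Scope nat_scope.
Notation gmA := 0.
Notation gmK := 1.
Notation gt := 2.
Let ars := [:: ([:: 0; 0], [:: 0]);
  ([:: 1; 1], [:: 1]);
  ([:: 1; 0], [:: 0; 1])].
Let rA : rule sig.
Proof. rule [:: 0; 0; 0] : [:: (0, gmA); (0, gmA)] ~> [:: (1, gmA); (0, gmA)] by (op21A mAA).
  Defined.
Let rK : rule sig.
Proof. rule [:: 1; 1; 1] : [:: (0, gmK); (0, gmK)] ~> [:: (1, gmK); (0, gmK)] by (op21A mKA).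
  Defined.
Let tA : rule sig.
Proof. rule [:: 1; 0; 0] : [:: (1, gmA); (0, gt)] ~> [:: (0, gt); (1, gt); (0, gmA)] by (tauA).
  Defined.
Let tK : rule sig.
Proof. rule [:: 1; 1; 0] : [:: (0, gmK); (0, gt)] ~> [:: (1, gt); (0, gt); (1, gmK)] by (tauK).
  Defined.

Lemma twist_assoc_word : weq sig [:: 0; 1; 0; 1; 0; 1] [:: (1, gt); (0, gmA); (1, gmK); (1, gt);
  (0, gmA); (1, gmK)]
  [:: (3, gt); (2, gmA); (3, gmK); (1, gt); (0, gmA); (1, gmK)].
Proof.
diagram ars [:: ([:: 1; 2; 4; 3], 4, 0, rA); ([::], 1, 2, tK); ([:: 4; 3; 5; 4], 5, 1, rK);
    ([:: 0; 4; 3; 2; 1], 2, 1, rflip tA)]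
  [:: 1].
Qed.

Lemma twist_op_assoc (t : tens A (tens K (tens A (tens K (tens A (tens K Q)))))) :
  twist_op (twist_op t) = twist_op (tmap idfun (tmap idfun (twist_op (Q:=Q))) t).
Proof.
have h :
    tmap idfun (op21 mK) (op21 mA (tmap idfun (op22 tau)
      (tmap idfun (op21 mK) (op21 mA (tmap idfun (op22 tau) t))))) =
    tmap idfun (op21 mK) (op21 mA (tmap idfun (op22 tau)
     (tmap idfun (tmap idfun (tmap idfun (op21 mK)))
      (tmap idfun (tmap idfun (op21 mA))
        (tmap idfun (tmap idfun (tmap idfun (op22 tau))) t))))).
  word_eq (twist_assoc_word t).
rewrite {1 2}/twist_op /= {}h.
rewrite -[LHS]/(twist_op _); congr twist_op.
by move: t; tpure a t; move: t; tpure x t; rewrite /twist_op; te.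
Qed.
End Words.

Lemma twist_mulA p q r :
  twist_mul (twist_mul (p \ox q) \ox r) = twist_mul (p \ox twist_mul (q \ox r)).
Proof.
apply: tpure1_inj; apply: (can_inj (@tassocK _ _ _ _)).
rewrite !twist_opE twist_op_assoc; congr twist_op.
by move: p; tpure a x; te.
Qed.

Lemma twist_mul1l p : twist_mul (uA \ox uK \ox p) = p.
Proof.
move: p; tpure a x; rewrite /twist_mul tmidE tau1K; te.
by rewrite mA1l mK1l.
Qed.

Lemma twist_mul1r p : twist_mul (p \ox (uA \ox uK)) = p.
Proof.
move: p; tpure a x; rewrite /twist_mul tmidE tau1A; te.
by rewrite mA1r mK1r.
Qed.

End TwistedProduct.

Section AlgebraFacts.
Variables (k : fieldType) (B : hopfAlgebra k).

Section YDAlg.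
Variables (A : algData B) (hA : is_ydalg A).

Lemma ydalg_yd : is_yd A. Proof. by case: hA. Qed.
Lemma ydalg_mulA x y z : alg_mul A (alg_mul A (x \ox y) \ox z) = alg_mul A (x \ox alg_mul A (y \ox
  z)).
Proof. by case: hA => _ []. Qed.
Lemma ydalg_mul1l x : alg_mul A (alg_one A \ox x) = x.
Proof. by case: hA => _ []. Qed.
Lemma ydalg_mul1r x : alg_mul A (x \ox alg_one A) = x.
Proof. by case: hA => _ []. Qed.
Lemma ydalg_mul_ydm : @yd_morph k B (yd_tens A A) A (alg_mul A).
Proof. by case: hA. Qed.
Lemma alg_unitE (a : k) : alg_unit A a = a *: alg_one A.
Proof. by rewrite -linearZ /= /alg_one -[X in alg_unit A X]mulr1. Qed.
(** A morphism out of the unit object picks an invariant vector, and such a vector crosses any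
    strand freely by [braid_invl] and [braid_invr]. *)
Lemma ydalg_one_inv : yd_invariant (alg_one A).
Proof.
case: hA => _ _ _ [h1 h2]; split=> [b|].
  by rewrite -h1 /=; te; rewrite linearZ.
by rewrite h2 /=; te.
Qed.
End YDAlg.

Section Hopf.
Variables (H : hopfData B) (hH : is_braided_hopf H).
Lemma hopf_ydalg : is_ydalg H. Proof. by case: hH. Qed.
Lemma comul_ydm : @yd_morph k B H (yd_tens H H) (comul H).
Proof. by case: hH => _ []. Qed.
Lemma counit_ydm : @yd_morph k B H (yd_unit B) (counit H).
Proof. by case: hH => _ []. Qed.
Lemma antipode_ydm : @yd_morph k B H H (antipode H).
Proof. by case: hH => _ []. Qed.
Lemma comul_assoc x : tassoc (tmap (comul H) idfun (comul H x)) = tmap idfun (comul H) (comul H x).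
Proof. by case: hH => _ _ []. Qed.
Lemma counit_l x : tlunit (tmap (counit H) idfun (comul H x)) = x.
Proof. by case: hH => _ _ []. Qed.
Lemma counit_r x : trunit (tmap idfun (counit H) (comul H x)) = x.
Proof. by case: hH => _ _ []. Qed.
Lemma comulM x y : comul H (alg_mul H (x \ox y)) =
  tmap (alg_mul H) (alg_mul H) (tmid (@braid k B H H) (comul H x \ox comul H y)).
Proof. by case: hH => _ _ _ [[h _] _] _; rewrite h tmapE. Qed.
Lemma comul1 : comul H (alg_one H) = alg_one H \ox alg_one H.
Proof. by case: hH => _ _ _ [[_ h] _] _; rewrite h /alg_one /=; te. Qed.
Lemma counitM x y : counit H (alg_mul H (x \ox y)) = (counit H x : k) * counit H y.
Proof. by case: hH => _ _ _ [_ [h _]] _; apply: h. Qed.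
Lemma counit1 : counit H (alg_one H) = 1.
Proof. by case: hH => _ _ _ [_ [_ h]] _. Qed.
Lemma antipode_l x : alg_mul H (tmap (antipode H) idfun (comul H x)) = (counit H x : k) *: alg_one
  H.
Proof. by case: hH => _ _ _ _ h; rewrite -alg_unitE; case: (h x). Qed.
Lemma antipode_r x : alg_mul H (tmap idfun (antipode H) (comul H x)) = (counit H x : k) *: alg_one
  H.
Proof. by case: hH => _ _ _ _ h; rewrite -alg_unitE; case: (h x). Qed.
End Hopf.

Section YDMid.
Implicit Types V W X Y Z : ydData B.

Lemma ydm_tmid X V W Y V' W' (c : {linear tens V W -> tens V' W'}) :
  @yd_morph k B (yd_tens V W) (yd_tens V' W') c ->
  @yd_morph k B (yd_tens (yd_tens X V) (yd_tens W Y)) (yd_tens (yd_tens X V') (yd_tens W' Y))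
   (tmid c).
Proof.
move=> mc.
have h := ydm_comp (ydm_assocV X V' (yd_tens W' Y))
  (ydm_comp (ydm_tmapr X (ydm_op22 Y mc)) (ydm_assoc X V (yd_tens W Y))).
by refine (eq_ydm _ h).
Qed.
End YDMid.
End AlgebraFacts.

Lemma op_module_alg (k : fieldType) (A K : lmodType k) (act : {linear tens K A -> A})
    (m : {linear tens A A -> A}) (d : {linear K -> tens K K}) (c : {linear tens K A -> tens A K}) :
  (forall x a a', act (x \ox m (a \ox a')) =
     m (tmap act act (tmid c (d x \ox (a \ox a'))))) ->
  forall Q (t : tens K (tens A (tens A Q))), op21 act (tmap idfun (op21 m) t) =
  op21 m (tmap idfun (op21 act) (op21 act (tmap idfun (op22 c) (op12 d t)))).
Proof.
move=> h Q; tpure x t; move: t; tpure a t; move: t; tpure a' q; te; rewrite h.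
move: (d x); tpure x1 x2; te; rewrite tmidE.
by move: (c _); tpure b y; te.
Qed.

Lemma op_module (k : fieldType) (A K : lmodType k) (act : {linear tens K A -> A})
    (m : {linear tens K K -> K}) :
  (forall x y a, act (m (x \ox y) \ox a) = act (x \ox act (y \ox a))) ->
  forall Q (t : tens K (tens K (tens A Q))),
    op21 act (op21 m t) = op21 act (tmap idfun (op21 act) t).
Proof.
by move=> h Q; tpure x t; move: t; tpure y t; move: t; tpure a q; te; rewrite h.
Qed.

Section Invariants.
Variables (k : fieldType) (B : hopfAlgebra k).

Lemma yd_invariant_tens (V W : ydData B) (v : V) (w : W) :
  yd_invariant v -> yd_invariant w -> @yd_invariant k B (yd_tens V W) (v \ox w).
Proof.
move=> [v1 v2] [w1 w2]; split=> [b|]; last first.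
  by rewrite coact_tens v2 w2 !tsumE; [rewrite mulr1|blin..].
rewrite act_tens -[in RHS](counitBl b) /=.
move: (comulB B b); tpure x y; rewrite tsumE; last by blin.
by te; rewrite v1 w1 tpureZl tpureZr [counitB B (_ *: y)]linearZ /= scalerA.
Qed.

Lemma invariant_ydm (V : ydData B) (v : V) (f : {linear k^o -> V}) :
  yd_invariant v -> (forall a : k, f a = a *: v) -> @yd_morph k B (yd_unit B) V f.
Proof.
move=> [v1 v2] e; split=> [b a|a] /=.
  by te; rewrite !e tpureZr linearZ /= v1 scalerA mulrC.
by te; rewrite e linearZ /= v2 tpureZr.
Qed.
End Invariants.

Section TwistAlg.
Variables (k : fieldType) (B : hopfAlgebra k) (A K : algData B).
Variable tau : {linear tens K A -> tens A K}.
Hypotheses (hA : is_ydalg A) (hK : is_ydalg K).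
Notation mA := (alg_mul A).
Notation mK := (alg_mul K).
Hypothesis tauA : forall Q (t : tens K (tens A (tens A Q))),
  op22 tau (tmap idfun (op21 mA) t) =
  op21 mA (tmap idfun (op22 tau) (op22 tau t)).
Hypothesis tauK : forall Q (t : tens K (tens K (tens A Q))),
  op22 tau (op21 mK t) =
  tmap idfun (op21 mK) (op22 tau (tmap idfun (op22 tau) t)).
Hypothesis tau1A : forall x, tau (x \ox alg_one A) = alg_one A \ox x.
Hypothesis tau1K : forall a, tau (alg_one K \ox a) = a \ox alg_one K.
Hypothesis tau_ydm : @yd_morph k B (yd_tens K A) (yd_tens A K) tau.

(** [smash act] and [braided_tens A A'] are convertible to this for tau = [smash_twist] and tau =
    C_(A',A). *)
Definition twist_alg : algData B :=
  @AlgData k B (yd_tens A K) (tmap mA mK \o tmid tau)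
    (tmap (alg_unit A) (alg_unit K) \o @tpure k k^o k^o (1 : k)).

Lemma twist_oneE : alg_one twist_alg = alg_one A \ox alg_one K.
Proof. by rewrite /alg_one /=; te. Qed.

Lemma twist_kalg : is_kalg twist_alg.
Proof.
have mE t : alg_mul twist_alg t = twist_mul mA mK tau t by [].
split=> [x y z|x|x]; rewrite ?twist_oneE !mE.
- exact: (twist_mulA (ydalg_mulA hA) (ydalg_mulA hK) tauA tauK).
- exact: (twist_mul1l (ydalg_mul1l hA) (ydalg_mul1l hK) tau1K).
exact: (twist_mul1r (ydalg_mul1r hA) (ydalg_mul1r hK) tau1A).
Qed.

Lemma twist_ydalg : is_ydalg twist_alg.
Proof.
split; first exact: yd_tensP (ydalg_yd hA) (ydalg_yd hK).
- exact: twist_kalg.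
- exact: (ydm_comp (ydm_tmap (ydalg_mul_ydm hA) (ydalg_mul_ydm hK)) (ydm_tmid A K tau_ydm)).
apply: (@invariant_ydm _ _ (yd_tens A K) (alg_one A \ox alg_one K)) => [|a].
  by apply: yd_invariant_tens; apply: ydalg_one_inv.
by rewrite /=; te; rewrite [alg_unit K a]alg_unitE tpureZr.
Qed.
End TwistAlg.

Section Smash.
Variables (k : fieldType) (B : hopfAlgebra k) (A : algData B) (K : hopfData B).
Variables (act : {linear tens K A -> A}).
Hypotheses (hA : is_ydalg A) (hK : is_braided_hopf K) (hact : module_algebra act).
Notation C V W := (@braid k B V W).
Notation mA := (alg_mul A).
Notation mK := (alg_mul K).
Notation d := (comul K).

Let yA := ydalg_yd hA.
Let aK := hopf_ydalg hK.
Let yK := ydalg_yd aK.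

Definition smash_twist : tens K A -> tens A K :=
  tmap act idfun \o @tassocV k K A K \o tmap idfun (C K A) \o @tassoc k K K A \o
  tmap (comul K) idfun.
HB.instance Definition _ := GRing.Linear.on smash_twist.

Lemma smash_twist_op (Q : lmodType k) (t : tens K (tens A Q)) :
  op22 smash_twist t = op21 act (tmap idfun (op22 (C K A)) (op12 d t)).
Proof.
move: t; tpure x t; move: t; tpure a q; te; rewrite /smash_twist; te.
move: (d x); tpure x1 x2; te.
by move: (C K A _); tpure b y; te.
Qed.

Section Words.
Variable Q : lmodType k.
Let ob (n : nat) : lmodType k := nth (K : lmodType k) [:: A : lmodType k; K : lmodType k] n.
Let sig : nat -> gen Q ob := nth (gen00 Q ob)
  [:: @gen21 k Q ob 0 0 0 mA; @gen21 k Q ob 1 1 1 mK; @gen12 k Q ob 1 1 1 d;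
      @gen21 k Q ob 1 0 0 act; @gen22 k Q ob 1 1 1 1 (C K K); @gen22 k Q ob 1 0 0 1 (C K A)]%N.

Let act_mul_op := op_module (let: And5 _ _ h _ _ := hact in h).
Let act_alg_op := op_module_alg (let: And5 _ _ _ h _ := hact in h).
Let hdm := comulM hK.
Let hdA := comul_assoc hK.
Let braid_mA := braid_op21r yK (ydalg_mul_ydm hA).
Let braid_mK := braid_op21l yA (ydalg_mul_ydm aK).
Let braid_dK := braid_op12l yA (comul_ydm hK).
Let braid_act := @braid_op21r k B K A A K yK act (let: And5 h _ _ _ _ := hact in h).
Local Open Scope nat_scope.
Notation gmA := 0.
Notation gmK := 1.
Notation gd := 2.
Notation ga := 3.
Notation gKK := 4.
Notation gKA := 5.
Let ars := [:: ([:: 0; 0], [:: 0]);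
  ([:: 1; 1], [:: 1]);
  ([:: 1], [:: 1; 1]);
  ([:: 1; 0], [:: 0]);
  ([:: 1; 1], [:: 1; 1]);
  ([:: 1; 0], [:: 0; 1])].
Let actM : rule sig.
Proof. rule [:: 1; 1; 0] : [:: (0, gmK); (0, ga)] ~> [:: (1, ga); (0, ga)] by (act_mul_op). Defined.
Let actA : rule sig.
Proof. rule [:: 1; 0; 0] : [:: (1, gmA); (0, ga)] ~> [:: (0, gd); (1, gKA); (0, ga); (1, ga); (0,
  gmA)] by (act_alg_op). Defined.
Let dM : rule sig.
Proof. rule [:: 1; 1] : [:: (0, gmK); (0, gd)] ~> [:: (0, gd); (2, gd); (1, gKK); (0, gmK); (1,
  gmK)] by (op_comulM hdm). Defined.
Let dA : rule sig.
Proof. rule [:: 1] : [:: (0, gd); (0, gd)] ~> [:: (0, gd); (1, gd)] by (op12A hdA). Defined.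
Let nmA : rule sig.
Proof. rule [:: 1; 0; 0] : [:: (1, gmA); (0, gKA)] ~> [:: (0, gKA); (1, gKA); (0, gmA)] by
  (braid_mA). Defined.
Let nmK : rule sig.
Proof. rule [:: 1; 1; 0] : [:: (0, gmK); (0, gKA)] ~> [:: (1, gKA); (0, gKA); (1, gmK)] by
  (braid_mK). Defined.
Let nd : rule sig.
Proof. rule [:: 1; 0] : [:: (0, gd); (1, gKA); (0, gKA)] ~> [:: (0, gKA); (1, gd)] by (braid_dK).
  Defined.
Let na : rule sig.
Proof. rule [:: 1; 1; 0] : [:: (1, ga); (0, gKA)] ~> [:: (0, gKK); (1, gKA); (0, ga)] by
  (braid_act). Defined.

(** The module algebra axiom splits x once more; coassociativity and naturality of the crossing turn
    this into two successive twists. *)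
Lemma tauA_word : weq sig [:: 1; 0; 0] [:: (1, gmA); (0, gd); (1, gKA); (0, ga)]
  [:: (0, gd); (1, gKA); (0, ga); (1, gd); (2, gKA); (1, ga); (0, gmA)].
Proof.
diagram ars [:: ([:: 0], 1, 1, nmA); ([::], 3, 0, actA); ([:: 2; 1], 0, 0, dA); ([:: 3], 1, 1,
  nd)] [:: 3; 2].
Qed.

(** The coproduct of a product brings in C_(K,K), which is absorbed when the crossing is slid back
    over the inner action ([na]). *)
Lemma tauK_word : weq sig [:: 1; 1; 0] [:: (0, gmK); (0, gd); (1, gKA); (0, ga)]
  [:: (1, gd); (2, gKA); (1, ga); (0, gd); (1, gKA); (0, ga); (1, gmK)].
Proof.
diagram ars [:: ([::], 0, 0, dM); ([::], 4, 1, nmK); ([:: 3; 4; 5], 6, 0, actM); ([:: 2; 5], 3, 1,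
  rflip na)]
  [:: 0; 1; 2; 5].
Qed.

End Words.

Lemma smash_twistA Q (t : tens K (tens A (tens A Q))) :
  op22 smash_twist (tmap idfun (op21 mA) t) =
  op21 mA (tmap idfun (op22 smash_twist) (op22 smash_twist t)).
Proof.
rewrite !smash_twist_op (eq_tmap (g' := op21 act \o
  (tmap idfun (op22 (C K A)) \o op12 d)) (fun=> erefl) (@smash_twist_op _)).
have h : op21 act (tmap idfun (op22 (C K A)) (op12 d (tmap idfun (op21 mA) t))) =
  op21 mA (tmap idfun (op21 act) (tmap idfun (tmap idfun (op22 (C K A)))
    (tmap idfun (op12 d)
      (op21 act (tmap idfun (op22 (C K A)) (op12 d t)))))).
  word_eq (tauA_word t).
rewrite h; congr (op21 mA _).
by move: (op21 act _); tpure x q; te.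
Qed.

Lemma smash_twistK Q (t : tens K (tens K (tens A Q))) :
  op22 smash_twist (op21 mK t) =
  tmap idfun (op21 mK) (op22 smash_twist (tmap idfun (op22 smash_twist) t)).
Proof.
rewrite !smash_twist_op (eq_tmap (g' := op21 act \o
  (tmap idfun (op22 (C K A)) \o op12 d)) (fun=> erefl) (@smash_twist_op _)).
have h : op21 act (tmap idfun (op22 (C K A)) (op12 d (op21 mK t))) =
  tmap idfun (op21 mK) (op21 act (tmap idfun (op22 (C K A)) (op12 d
   (tmap idfun (op21 act) (tmap idfun (tmap idfun (op22 (C K A)))
    (tmap idfun (op12 d) t)))))).
  word_eq (tauK_word t).
rewrite h; do 4?congr (_ _).
by move: t {h}; tpure x q; te.
Qed.

Lemma smash_twist1A x : smash_twist (x \ox alg_one A) = alg_one A \ox x.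
Proof.
rewrite /smash_twist; te; rewrite -{2}(counit_l hK x).
move: (d x); tpure x1 x2; te; rewrite (braid_invr _ yK (ydalg_one_inv hA)); te.
by case: hact => _ _ _ _ ->; rewrite alg_unitE tpureZl tpureZr.
Qed.

Lemma smash_twist1K a : smash_twist (alg_one K \ox a) = a \ox alg_one K.
Proof.
rewrite /smash_twist; te; rewrite (comul1 hK); te.
rewrite (braid_invl _ yA (ydalg_one_inv aK)); te.
by case: hact => _ -> _ _ _.
Qed.

Lemma smash_twist_ydm : @yd_morph k B (yd_tens K A) (yd_tens A K) smash_twist.
Proof.
have mact : @yd_morph k B (yd_tens K A) A act by case: hact.
exact: (ydm_comp (ydm_tmap mact (ydm_id K)) (ydm_comp (ydm_assocV K A K)
  (ydm_comp (ydm_tmapr K (braid_ydm yK yA)) (ydm_comp (ydm_assoc K K A)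
    (ydm_tmap (comul_ydm hK) (ydm_id A)))))).
Qed.

Lemma smash_ydalg : is_ydalg (smash act).
Proof.
exact: (twist_ydalg (tau := smash_twist) hA aK smash_twistA smash_twistK smash_twist1A
  smash_twist1K smash_twist_ydm).
Qed.

End Smash.

Section BraidedTensor.
Variables (k : fieldType) (B : hopfAlgebra k) (A A' : algData B).
Hypotheses (hA : is_ydalg A) (hA' : is_ydalg A').
Notation C V W := (@braid k B V W).

Lemma braided_tens_ydalg : is_ydalg (braided_tens A A').
Proof.
have yA := ydalg_yd hA; have yA' := ydalg_yd hA'.
apply: (twist_ydalg (tau := C A' A) hA hA').
- exact: (braid_op21r yA' (ydalg_mul_ydm hA)).
- exact: (braid_op21l yA (ydalg_mul_ydm hA')).
- by move=> x; apply: braid_invr => //; apply: ydalg_one_inv.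
- by move=> x; apply: braid_invl => //; apply: ydalg_one_inv.
exact: braid_ydm.
Qed.
End BraidedTensor.

Lemma tpure0l (k : fieldType) (V W : lmodType k) (w : W) : (0 : V) \ox w = 0.
Proof. by rewrite -(scale0r (0 : V)) tpureZl scale0r. Qed.

Lemma tpureBl (k : fieldType) (V W : lmodType k) (v v' : V) (w : W) :
  (v - v') \ox w = v \ox w - v' \ox w.
Proof.
have := (tpure_bilin V W).1 w (-1) v' v; rewrite /= !scaleN1r => e.
by rewrite addrC e addrC.
Qed.

(** * Hopf pairings *)

Section Nondegenerate.
Variables (k : fieldType) (U H V : lmodType k) (ev : {linear tens U H -> k^o}).
Hypothesis ev_sep : forall f, (forall x, ev (f \ox x) = 0) -> f = 0.

(** Induction on the length of a sum representing t: an evaluation that does not vanish on the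
    second factor f of the first term lets that term be eliminated. *)
Lemma tens_sep (t : tens V U) :
  (forall x, \tsum_(v, f <- t) ((ev (f \ox x) : k) *: v) = 0) -> t = 0.
Proof.
rewrite [X in _ -> X = _](tens_span t) /tsum /fsum; move: (repr t) => {t} s.
have [n] := ubnP (size s); elim: n s => // n IH [|[v f] s] /=; first by rewrite !big_nil.
rewrite ltnS => sz h.
have [/ev_sep f0|] := pselect (forall x, ev (f \ox x) = 0).
  rewrite big_cons f0 linear0 add0r; apply: IH => // x.
  have := h x; rewrite big_cons /= f0 tpure0l.
  by rewrite linear0 scale0r add0r.
move/existsNP => [x0 /eqP c0]; set c : k := ev (f \ox x0) in c0.
(* Evaluating at x0 expresses v through the other first factors, so the sum is rewritten over [s']
   with one term less. *)
have ve : v = - (c^-1 *: \sum_(p <- s) (ev (p.2 \ox x0) : k) *: p.1).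
  have /eqP := h x0; rewrite big_cons /= -/c addr_eq0 => /eqP e.
  by rewrite -scalerN -e scalerA mulVf // scale1r.
pose s' := [seq (p.1, p.2 - (c^-1 * ev (p.2 \ox x0)) *: f) | p <- s].
have -> : \sum_(p <- (v, f) :: s) p.1 \ox p.2 = \sum_(p <- s') p.1 \ox p.2.
  rewrite big_cons big_map /= {1}ve.
  have -> : - (c^-1 *: \sum_(p <- s) (ev (p.2 \ox x0) : k) *: p.1) \ox f =
     - \sum_(p <- s) (c^-1 * ev (p.2 \ox x0)) *: (p.1 \ox f).
    rewrite -scaleNr tpureZl -[in RHS]scaleN1r.
    pose L := HB.pack_for {linear V -> tens V U} (fun v => v \ox f)
      (GRing.isLinear.Build k V (tens V U) *:%R (fun v => v \ox f) (lin_tpurel f (@lin_id k V))).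
    rewrite -[X in _ *: X = _]/(L _) linear_sum !scaler_sumr; apply: eq_bigr => p _.
    by rewrite /L /= tpureZl !scalerA mulN1r mulNr.
  rewrite addrC -sumrB; apply: eq_bigr => p _.
  by rewrite linearB /= tpureZr.
apply: IH => [|x]; first by rewrite size_map.
rewrite big_map /=.
have := h x; rewrite big_cons /= {1}ve => e.
transitivity (\sum_(p <- s) (ev (p.2 \ox x) : k) *: p.1 -
   (ev (f \ox x) : k) *: (c^-1 *: \sum_(p <- s) (ev (p.2 \ox x0) : k) *: p.1)); last first.
  by rewrite -scalerN addrC.
rewrite !scaler_sumr -sumrB; apply: eq_bigr => p _.
have -> : (p.2 - (c^-1 * ev (p.2 \ox x0)) *: f) \ox x =
   p.2 \ox x - (c^-1 * ev (p.2 \ox x0)) *: (f \ox x).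
  by rewrite tpureBl tpureZl.
rewrite linearB linearZ /= scalerBl !scalerA; congr (_ - _ *: _).
by rewrite [LHS]mulrC mulrA.
Qed.
End Nondegenerate.

Lemma op22_tassoc (k : fieldType) (V W V' W' Q : lmodType k)
  (f : {linear tens V W -> tens V' W'}) (p : tens V W) (q : Q) :
  op22 f (tassoc (p \ox q)) = tassoc (f p \ox q).
Proof. by move: p; tpure v w; te. Qed.

Lemma op22_cancel (k : fieldType) (V W : lmodType k) (f : {linear tens V W -> tens W V})
    (g : {linear tens W V -> tens V W}) : (forall t, g (f t) = t) ->
  forall Q (t : tens V (tens W Q)), op22 g (op22 f t) = t.
Proof.
by move=> h Q; tpure v t; move: t; tpure w q; te; rewrite op22_tassoc h; te.
Qed.

Section Pairing.
Variables (k : fieldType) (B : hopfAlgebra k) (H U : hopfData B).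
Hypotheses (hH : is_braided_hopf H) (hU : is_braided_hopf U).
Variable (ev : {linear tens U H -> k^o}).
Notation C V W := (@braid k B V W).
Notation mH := (alg_mul H).
Notation mU := (alg_mul U).
Notation dH := (comul H).
Notation dU := (comul U).
Let ev2 (t : tens (tens U U) (tens H H)) : k :=
  tlunit (tmap ev ev (tmid (C U H) t)).

(** The properties of the evaluation on which the proof draws: a pairing of braided Hopf algebras
    for which H separates U. It holds for the whole finite dual and passes to braided Hopf
    subalgebras. *)
Record hopf_pairing : Prop := HopfPairing {
  ev_ydm : @yd_morph k B (yd_tens U H) (yd_unit B) ev;
  ev_mulr : forall f x y, ev (f \ox mH (x \ox y)) = ev2 (dU f \ox (x \ox y));
  ev_mull : forall f g x, ev (mU (f \ox g) \ox x) = ev2 ((f \ox g) \ox dH x);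
  ev_1r : forall f, ev (f \ox alg_one H) = counit U f;
  ev_1l : forall x, ev (alg_one U \ox x) = counit H x;
  ev_antipode : forall f x, ev (antipode U f \ox x) = ev (f \ox antipode H x);
  ev_sep : forall f, (forall x, ev (f \ox x) = 0) -> f = 0
}.
Hypothesis hev : hopf_pairing.
Hypothesis HC : forall t, C H H (C H H t) = t.

Let yH := ydalg_yd (hopf_ydalg hH).
Let yU := ydalg_yd (hopf_ydalg hU).

Lemma op_ev_mulr Q (t : tens U (tens H (tens H Q))) :
  op20 ev (tmap idfun (op21 mH) t) =
  op20 ev (op20 ev (tmap idfun (op22 (C U H)) (op12 dU t))).
Proof.
move: t; tpure f t; move: t; tpure x t; move: t; tpure y q; te; rewrite (ev_mulr hev) /ev2.
move: (dU f); tpure f1 f2; te; rewrite tmidE; te.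
move: (C U H _); tpure x' f'; te.
rewrite [op20 ev (_ *: _)]linearZ /=; te; rewrite ?linearZ /= ?scalerA mulrC //.
Qed.

Lemma op_ev_mull Q (t : tens U (tens U (tens H Q))) :
  op20 ev (op21 mU t) =
  op20 ev (op20 ev (tmap idfun (op22 (C U H))
   (tmap idfun (tmap idfun (op12 dH)) t))).
Proof.
move: t; tpure f t; move: t; tpure g t; move: t; tpure x q; te; rewrite (ev_mull hev) /ev2.
move: (dH x); tpure x1 x2; te; rewrite tmidE; te.
move: (C U H _); tpure x' f'; te.
rewrite [op20 ev (_ *: _)]linearZ /=; te; rewrite ?linearZ /= ?scalerA mulrC //.
Qed.

(** C_(U,H) is injective, so it may be applied to both sides; the results in H (x) U are then
    compared by evaluating U at an arbitrary y. Under the evaluation, crossings with U become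
    crossings of H with H. *)
Lemma braid_UHK (t : tens U H) : C H U (C U H t) = t.
Proof.
apply: (can_inj (braidK yU yH)); move: t; tpure f z.
apply/eqP; rewrite -subr_eq0; apply/eqP; apply: (tens_sep (ev_sep hev)) => y.
set s := _ - _.
apply: tpure1_inj.
have -> : (\tsum_(v, g <- s) ((ev (g \ox y) : k) *: v)) \ox (1 : k^o) =
    tmap idfun (op20 ev) (tassoc (s \ox (y \ox (1 : k^o)))).
  move: s => s; move: s; tpure v g; rewrite tsumE; last by blin.
  by te; rewrite tpureZl -tpureZr.
have HCop Q (t : tens H (tens H Q)) : op22 (C H H) (op22 (C H H) t) = t.
  exact: op22_cancel.
(* Naturality of [ev] inserts a crossing C_(H,H) together with C_(U,H), and C_(H,H) C_(H,H) = 1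
   removes the former. *)
have e1 (t : tens U (tens H (tens H k^o))) :
    tmap idfun (op20 ev) (op22 (C U H) t) =
    op20 ev (tmap idfun (op22 (C H H)) t).
  rewrite -(braid_op20l yH (ev_ydm hev)); congr (tmap _ _ (op22 _ _)).
  by move: t; tpure a b; te; rewrite HCop.
have e2 (t : tens H (tens U (tens H k^o))) :
    op20 ev (tmap idfun (op22 (C H H)) (op22 (C H U) t)) =
    tmap idfun (op20 ev) t.
  exact: (braid_op20r yH (ev_ydm hev)).
rewrite /s.
have -> : tassoc ((C U H (C H U (C U H (f \ox z))) - C U H (f \ox z)) \ox (y \ox (1 : k^o))) =
   op22 (C U H) (op22 (C H U) (op22 (C U H) (f \ox (z \ox (y \ox (1 : k^o)))))) -
   op22 (C U H) (f \ox (z \ox (y \ox (1 : k^o)))).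
  rewrite !op22E !op22_tassoc -[RHS]linearB; congr (tassoc _).
  exact: tpureBl.
by rewrite linearB /= e1 e2 subrr tpure0l.
Qed.

Lemma braid_HUK (t : tens H U) : C U H (C H U t) = t.
Proof. by rewrite -(braidVK yU yH t) braid_UHK. Qed.

End Pairing.

Section OpYdm.
Variables (k : fieldType) (B : hopfAlgebra k).
Implicit Types V W X Y Z : ydData B.

Lemma braid_natT V W V' W' (f : {linear V -> V'}) (g : {linear W -> W'}) (t : tens V W) :
  yd_morph f -> yd_morph g ->
  @braid k B V' W' (tmap f g t) = tmap g f (@braid k B V W t).
Proof. by move=> mf mg; move: t; tpure v w; te; rewrite (braid_nat v w mf mg). Qed.
End OpYdm.

Section Skew.
Variables (k : fieldType) (B : hopfAlgebra k) (H : hopfData B) (hH : is_braided_hopf H).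
Notation C := (@braid k B H H).
Notation mH := (alg_mul H).
Notation dH := (comul H).
Notation S := (antipode H).
Let aH := hopf_ydalg hH.
Let yH := ydalg_yd aH.

Lemma antipode_braid_mul t : S (mH t) = mH (tmap S S (C t)).
Proof.
move: t; tpure x y; apply: (antipode_mul (ydalg_mulA aH) (ydalg_mul1l aH) (ydalg_mul1r aH)
  (comul_assoc hH) (counit_l hH) (counit_r hH) (comulM hH) (counitM hH) (antipode_l hH)
  (antipode_r hH)).
- exact: (braid_op12r yH (comul_ydm hH)).
- exact: (braid_op12l yH (comul_ydm hH)).
- exact: (braid_op10r yH (counit_ydm hH)).
- exact: (braid_op10l yH (counit_ydm hH)).
Qed.

Hypothesis HC : forall t, C (C t) = t.
Variable iS : {linear H -> H}.
Hypotheses (SK : cancel S iS) (iSK : cancel iS S).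

Lemma iS_ydm : @yd_morph k B H H iS.
Proof. by apply: (@ydm_can k B H H S iS) => //; apply: antipode_ydm. Qed.

Lemma antipode_one : S (alg_one H) = alg_one H.
Proof.
by have := antipode_l hH (alg_one H); rewrite (comul1 hH) tmapE (ydalg_mul1r aH) (counit1 hH)
  scale1r.
Qed.

(** After S is applied, the crossing produced by [antipode_braid_mul] cancels C, and the antipode
    axiom remains. *)
Lemma skew_antipoder x : mH (tmap idfun iS (C (dH x))) = (counit H x : k) *: alg_one H.
Proof.
apply: (can_inj SK); rewrite antipode_braid_mul linearZ /= antipode_one.
rewrite (@braid_natT k B H H H H idfun iS _ (ydm_id H) iS_ydm) HC.
rewrite -(antipode_r hH); congr (mH _).
by move: (dH x); tpure a b; te; rewrite iSK.
Qed.

Lemma skew_antipodel x : mH (tmap iS idfun (C (dH x))) = (counit H x : k) *: alg_one H.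
Proof.
apply: (can_inj SK); rewrite antipode_braid_mul linearZ /= antipode_one.
rewrite (@braid_natT k B H H H H iS idfun _ iS_ydm (ydm_id H)) HC.
rewrite -(antipode_l hH); congr (mH _).
by move: (dH x); tpure a b; te; rewrite iSK.
Qed.

Lemma op_skewr Q (t : tens H Q) :
  op21 mH (tmap idfun (op11 iS) (op22 C (op12 dH t))) = op01 (alg_one H) (op10 (counit H) t).
Proof.
move: t; tpure x q; te; rewrite op22_tassoc tpureZr -tpureZl -skew_antipoder /=.
by move: (C (dH x)); tpure a b; te.
Qed.

Lemma op_skewl Q (t : tens H Q) :
  op21 mH (op11 iS (op22 C (op12 dH t))) = op01 (alg_one H) (op10 (counit H) t).
Proof.
move: t; tpure x q; te; rewrite op22_tassoc tpureZr -tpureZl -skew_antipodel /=.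
by move: (C (dH x)); tpure a b; te.
Qed.
End Skew.

Section Harpoon.
Variables (k : fieldType) (B : hopfAlgebra k) (H U : hopfData B).
Hypotheses (hH : is_braided_hopf H) (hU : is_braided_hopf U).
Variable (ev : {linear tens U H -> k^o}).
Hypothesis hev : hopf_pairing ev.
Notation C V W := (@braid k B V W).
Hypothesis HC : forall t, C H H (C H H t) = t.
Notation mH := (alg_mul H).
Notation mU := (alg_mul U).
Notation dH := (comul H).
Notation dU := (comul U).
Let aH := hopf_ydalg hH.
Let aU := hopf_ydalg hU.
Let yH := ydalg_yd aH.
Let yU := ydalg_yd aU.
Notation hp := (@harpoon k B H U ev).

Lemma harpoon_op Q (t : tens U (tens H Q)) :
  op21 hp t = tmap idfun (op20 ev) (op22 (C U H) (tmap idfun (op12 dH) t)).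
Proof.
move: t; tpure f t; move: t; tpure x q; te; rewrite /harpoon; te.
move: (dH x); tpure a b; te.
by move: (C U H _); tpure a' f'; te; rewrite tpureZl tpureZr.
Qed.

Lemma harpoon_ydm : @yd_morph k B (yd_tens U H) H hp.
Proof.
exact: (ydm_comp (ydm_runit yH) (ydm_comp (ydm_tmapr H (ev_ydm hev))
  (ydm_comp (ydm_op22 H (braid_ydm yU yH)) (ydm_tmapr U (comul_ydm hH))))).
Qed.

(* nl_X_f and nr_f_X are the naturality of the braiding of X, on the left and on the right of f,
   and y_XYZ is the Yang-Baxter equation. *)
Section Words.
Variable Q : lmodType k.
Let ob (n : nat) : lmodType k := nth (H : lmodType k) [:: H : lmodType k; U : lmodType k] n.
Let sig : nat -> gen Q ob := nth (gen00 Q ob)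
  [:: @gen21 k Q ob 0 0 0 mH;
      @gen12 k Q ob 0 0 0 dH;
      @gen21 k Q ob 1 1 1 mU;
      @gen12 k Q ob 1 1 1 dU;
      @gen20 k Q ob 1 0 ev;
      @gen21 k Q ob 1 0 0 hp;
      @gen22 k Q ob 0 0 0 0 (C H H);
      @gen22 k Q ob 1 0 0 1 (C U H)]%N.
Local Open Scope nat_scope.
Notation gmH := 0.
Notation gdH := 1.
Notation gmU := 2.
Notation gdU := 3.
Notation gev := 4.
Notation ghp := 5.
Notation gHH := 6.
Notation gUH := 7.
Let ars := [:: ([:: 0; 0], [:: 0]); ([:: 0], [:: 0; 0]); ([:: 1; 1], [:: 1]); ([:: 1], [:: 1; 1]);
  ([:: 1; 0], [::]); ([:: 1; 0], [:: 0]); ([:: 0; 0], [:: 0; 0]); ([:: 1; 0], [:: 0; 1])].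
Let hpE : rule sig.
Proof. rule [:: 1; 0] : [:: (0, ghp)] ~> [:: (1, gdH); (0, gUH); (1, gev)] by (harpoon_op). Defined.
Let dM : rule sig.
Proof. rule [:: 0; 0] : [:: (0, gmH); (0, gdH)] ~> [:: (0, gdH); (2, gdH); (1, gHH); (0, gmH); (1,
  gmH)] by (op_comulM (comulM hH)). Defined.
Let dA : rule sig.
Proof. rule [:: 0] : [:: (0, gdH); (0, gdH)] ~> [:: (0, gdH); (1, gdH)] by (op12A (comul_assoc
  hH)). Defined.
Let evH : rule sig.
Proof. rule [:: 1; 0; 0] : [:: (1, gmH); (0, gev)] ~> [:: (0, gdU); (1, gUH); (0, gev); (0, gev)]
  by (op_ev_mulr hev). Defined.
Let evU : rule sig.
Proof. rule [:: 1; 1; 0] : [:: (0, gmU); (0, gev)] ~> [:: (2, gdH); (1, gUH); (0, gev); (0, gev)]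
  by (op_ev_mull hev). Defined.
Let nl_U_mH : rule sig.
Proof. rule [:: 1; 0; 0] : [:: (1, gmH); (0, gUH)] ~> [:: (0, gUH); (1, gUH); (0, gmH)] by
  (braid_op21r yU (ydalg_mul_ydm aH)). Defined.
Let nl_U_dH : rule sig.
Proof. rule [:: 1; 0] : [:: (1, gdH); (0, gUH); (1, gUH)] ~> [:: (0, gUH); (0, gdH)] by
  (braid_op12r yU (comul_ydm hH)). Defined.
Let nr_mU_H : rule sig.
Proof. rule [:: 1; 1; 0] : [:: (0, gmU); (0, gUH)] ~> [:: (1, gUH); (0, gUH); (1, gmU)] by
  (braid_op21l yH (ydalg_mul_ydm aU)). Defined.
Let nr_dU_H : rule sig.
Proof. rule [:: 1; 0] : [:: (0, gdU); (1, gUH); (0, gUH)] ~> [:: (0, gUH); (1, gdU)] by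
  (braid_op12l yH (comul_ydm hU)). Defined.
Let nr_ev_H : rule sig.
Proof. rule [:: 1; 0; 0] : [:: (1, gHH); (0, gUH); (1, gev)] ~> [:: (0, gev)] by (braid_op20l yH
  (ev_ydm hev)). Defined.
Let y_UHH : rule sig.
Proof. rule [:: 1; 0; 0] : [:: (1, gHH); (0, gUH); (1, gUH)] ~> [:: (0, gUH); (1, gUH); (0, gHH)]
  by (braid_op22r yU (braid_ydm yH yH)). Defined.
Let HHH : rule sig.
Proof. rule [:: 0; 0] : [:: (0, gHH); (0, gHH)] ~> [::] by (op22_cancel HC). Defined.

(** Naturality of [ev] trades a crossing of the two strands H for one of U with H; C_(H,H) being an
    involution, the orientation of the former is immaterial. *)
Lemma op_evHH_word : weq sig [:: 1; 0; 0] [:: (1, gHH); (0, gev)]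
  [:: (0, gUH); (1, gev)].
Proof.
diagram ars [:: ([::], 1, 0, rflip nr_ev_H); ([::], 0, 1, HHH)] [::].
Qed.

(** The crossing C_(U,H) in the pairing of a product cancels against C, which leaves the nested
    pairing <u_2, x> <u_1, y>. *)
Lemma op_ev_nested_word : weq sig [:: 1; 0; 0] [:: (1, gHH); (1, gmH); (0, gev)]
  [:: (0, gdU); (1, gev); (0, gev)].
Proof.
diagram ars [:: ([::], 1, 0, evH); ([:: 0; 3], 1, 1, nr_ev_H)] [::].
Qed.

Lemma op_harpoonA_word : weq sig [:: 1; 1; 0] [:: (0, gmU); (0, ghp)]
  [:: (1, ghp); (0, ghp)].
Proof.
diagram ars [:: ([::], 1, 0, hpE); ([:: 0], 1, 0, nr_mU_H); ([::], 3, 1, evU); ([:: 2; 1], 0, 2,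
  rflip dA);
    ([:: 3], 1, 1, nl_U_dH); ([:: 4; 3; 2], 3, 0, rflip hpE); ([::], 0, 1, rflip hpE)] [::].
Qed.

Lemma op_harpoonM_word : weq sig [:: 1; 0; 0] [:: (1, gmH); (0, ghp)]
  [:: (0, gdU); (1, gUH); (0, ghp); (1, ghp); (0, gmH)].
Proof.
diagram ars [:: ([::], 1, 0, hpE); ([::], 0, 1, dM); ([:: 4], 5, 1, evH); ([::], 3, 0, nl_U_mH);
    ([:: 5], 4, 1, rflip nr_dU_H); ([:: 2; 3; 7; 6], 4, 2, y_UHH);
    ([:: 9; 8; 7; 6; 9], 7, 1, nr_ev_H); ([::], 2, 0, rflip nr_dU_H);
    ([:: 0; 1; 4], 2, 1, nl_U_dH); ([:: 0; 1; 2; 3; 6; 5; 4], 5, 1, rflip hpE);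
    ([:: 4; 3; 2], 3, 0, rflip hpE)] [:: 2].
Qed.

(** [harpoon] consumes the last factor of a coproduct, so by coassociativity the first factor is
    left alone. This is what makes the action of U compatible with the product of R # H. *)
Lemma op_harpoon_comul_word : weq sig [:: 1; 0] [:: (0, ghp); (0, gdH)]
  [:: (1, gdH); (0, gUH); (1, ghp)].
Proof.
diagram ars [:: ([::], 0, 0, hpE); ([:: 2], 1, 0, rflip nl_U_dH); ([::], 0, 1, dA); ([:: 1], 2, 1,
  rflip hpE)] [::].
Qed.
End Words.

Lemma op_evHH Q (t : tens U (tens H (tens H Q))) :
  op20 ev (tmap idfun (op22 (C H H)) t) =
  tmap idfun (op20 ev) (op22 (C U H) t).
Proof. word_eq (op_evHH_word t). Qed.

Lemma op_ev_nested Q (t : tens U (tens H (tens H Q))) :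
  op20 ev (tmap idfun (op21 mH) (tmap idfun (op22 (C H H)) t)) =
  op20 ev (tmap idfun (op20 ev) (op12 dU t)).
Proof. word_eq (op_ev_nested_word t). Qed.

Lemma op_harpoonA Q (t : tens U (tens U (tens H Q))) :
  op21 hp (op21 mU t) =
  op21 hp (tmap idfun (op21 hp) t).
Proof. word_eq (op_harpoonA_word t). Qed.

Lemma op_harpoonM Q (t : tens U (tens H (tens H Q))) :
  op21 hp (tmap idfun (op21 mH) t) =
  op21 mH (tmap idfun (op21 hp) (op21 hp (tmap idfun (op22 (C U H)) (op12 dU t)))).
Proof. word_eq (op_harpoonM_word t). Qed.

Lemma op_harpoon_comul Q (t : tens U (tens H Q)) :
  op12 dH (op21 hp t) =
  tmap idfun (op21 hp) (op22 (C U H) (tmap idfun (op12 dH) t)).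
Proof. word_eq (op_harpoon_comul_word t). Qed.

Lemma harpoon_module_algebra : module_algebra hp.
Proof.
split=> [|x|f g x|f x y|f].
- exact: harpoon_ydm.
- apply: tpure1_inj; rewrite -op21E harpoon_op; te.
  rewrite -[in RHS](counit_r hH x).
  move: (dH x); tpure a b; te.
  by rewrite (braid_invl _ yH (ydalg_one_inv aU)); te; rewrite (ev_1l hev) tpureZl tpureZr.
- by apply: tpure1_inj; have := op_harpoonA (f \ox (g \ox (x \ox (1 : k^o)))); te.
- apply: tpure1_inj; have := op_harpoonM (f \ox (x \ox (y \ox (1 : k^o)))); te => ->.
  move: (dU f); tpure f1 f2; te; rewrite tmidE /=.
  by move: (C U H _); tpure x' f'; te.
apply: tpure1_inj; rewrite -op21E harpoon_op; te; rewrite (comul1 hH); te.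
by rewrite (braid_invr _ yU (ydalg_one_inv aH)); te; rewrite (ev_1r hev) alg_unitE tpureZl tpureZr.
Qed.
Section Skew.
Variable iS : {linear H -> H}.
Hypotheses (SK : cancel (antipode H) iS) (iSK : cancel iS (antipode H)).
Let iS_ydm := iS_ydm hH SK iSK.
Let op_skewr := op_skewr hH HC SK iSK.

Section Words.
Variable Q : lmodType k.
Let ob (n : nat) : lmodType k := nth (H : lmodType k) [:: H : lmodType k; U : lmodType k] n.
Let sig : nat -> gen Q ob := nth (gen00 Q ob)
  [:: @gen21 k Q ob 0 0 0 mH;
      @gen12 k Q ob 0 0 0 dH;
      @gen01 k Q ob 0 (alg_one H);
      @gen10 k Q ob 0 (counit H);
      @gen11 k Q ob 0 0 iS;
      @gen20 k Q ob 1 0 ev;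
      @gen21 k Q ob 1 0 0 hp;
      @gen22 k Q ob 0 0 0 0 (C H H);
      @gen22 k Q ob 1 0 0 1 (C U H)]%N.
Local Open Scope nat_scope.
Notation gmH := 0.
Notation gdH := 1.
Notation guH := 2.
Notation geH := 3.
Notation giS := 4.
Notation gev := 5.
Notation ghp := 6.
Notation gHH := 7.
Notation gUH := 8.
Let ars := [:: ([:: 0; 0], [:: 0]); ([:: 0], [:: 0; 0]); ([::], [:: 0]); ([:: 0], [::]); ([:: 0],
  [:: 0]); ([:: 1; 0], [::]); ([:: 1; 0], [:: 0]); ([:: 0; 0], [:: 0; 0]); ([:: 1; 0], [:: 0; 1])].
Let hpE : rule sig.
Proof. rule [:: 1; 0] : [:: (0, ghp)] ~> [:: (1, gdH); (0, gUH); (1, gev)] by (harpoon_op). Defined.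
Let mA : rule sig.
Proof. rule [:: 0; 0; 0] : [:: (0, gmH); (0, gmH)] ~> [:: (1, gmH); (0, gmH)] by (op21A
  (ydalg_mulA aH)). Defined.
Let dA : rule sig.
Proof. rule [:: 0] : [:: (0, gdH); (0, gdH)] ~> [:: (0, gdH); (1, gdH)] by (op12A (comul_assoc
  hH)). Defined.
Let del : rule sig.
Proof. rule [:: 0] : [:: (0, gdH); (0, geH)] ~> [::] by (op12_1l (counit_l hH)). Defined.
Let mur : rule sig.
Proof. rule [:: 0] : [:: (1, guH); (0, gmH)] ~> [::] by (op21_1r (ydalg_mul1r aH)). Defined.
Let skl : rule sig.
Proof. rule [:: 0] : [:: (0, gdH); (0, gHH); (1, giS); (0, gmH)] ~> [:: (0, geH); (0, guH)] by
  (op_skewr). Defined.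
Let nl_U_dH : rule sig.
Proof. rule [:: 1; 0] : [:: (1, gdH); (0, gUH); (1, gUH)] ~> [:: (0, gUH); (0, gdH)] by
  (braid_op12r yU (comul_ydm hH)). Defined.
Let nl_H_dH : rule sig.
Proof. rule [:: 0; 0] : [:: (1, gdH); (0, gHH); (1, gHH)] ~> [:: (0, gHH); (0, gdH)] by
  (braid_op12r yH (comul_ydm hH)). Defined.
Let nl_U_eH : rule sig.
Proof. rule [:: 1; 0] : [:: (0, gUH); (0, geH)] ~> [:: (1, geH)] by (braid_op10r yU (counit_ydm
  hH)). Defined.
Let y_UHH : rule sig.
Proof. rule [:: 1; 0; 0] : [:: (1, gHH); (0, gUH); (1, gUH)] ~> [:: (0, gUH); (1, gUH); (0, gHH)]
  by (braid_op22r yU (braid_ydm yH yH)). Defined.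
Let evHH : rule sig.
Proof. rule [:: 1; 0; 0] : [:: (1, gHH); (0, gev)] ~> [:: (0, gUH); (1, gev)] by (op_evHH). Defined.

(** [evHH] and the Yang-Baxter equation move f away from the factors of y that are multiplied
    together; coassociativity then makes these a crossed coproduct, which [skl] collapses. *)
Lemma op_harpoon_skew_word : weq sig [:: 0; 1; 0] [:: (2, gdH); (2, gHH); (1, ghp); (0, gmH); (1,
  giS); (0, gmH)]
  [:: (1, gev)].
Proof.
diagram ars [:: ([:: 3; 2], 3, 1, hpE); ([::], 6, 0, mA); ([:: 2; 3; 4], 1, 2, rflip nl_H_dH);
    ([:: 3], 4, 2, evHH); ([::], 2, 1, y_UHH); ([::], 0, 2, rflip dA); ([::], 1, 1, nl_U_dH);
    ([:: 3; 2], 3, 1, skl); ([:: 2], 1, 1, nl_U_eH); ([::], 0, 2, del); ([::], 1, 0, mur)] [::].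
Qed.
End Words.

Lemma op_harpoon_skew Q (t : tens H (tens U (tens H Q))) :
  op21 mH (tmap idfun (op11 iS) (op21 mH (tmap idfun (op21 hp) (tmap idfun (tmap idfun (op22 (C H
    H))) (tmap idfun (tmap idfun (op12 dH)) t))))) =
  tmap idfun (op20 ev) t.
Proof. word_eq (op_harpoon_skew_word t). Qed.

End Skew.
End Harpoon.

(** * The coaction of U on R: the action of H on R, the action of U on R # H, and theta *)

Section Coaction.
Variables (k : fieldType) (B : hopfAlgebra k) (H U : hopfData B) (R : algData B).
Hypotheses (hH : is_braided_hopf H) (hU : is_braided_hopf U) (hR : is_ydalg R).
Variable (ev : {linear tens U H -> k^o}) (psi : {linear R -> tens R U}).
Hypotheses (hev : hopf_pairing ev) (hpsi : comodule_algebra psi).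
Notation C V W := (@braid k B V W).
Hypothesis HC : forall t, C H H (C H H t) = t.
Notation mH := (alg_mul H).
Notation mU := (alg_mul U).
Notation mR := (alg_mul R).
Notation dH := (comul H).
Notation dU := (comul U).
Let aH := hopf_ydalg hH.
Let aU := hopf_ydalg hU.
Let yH := ydalg_yd aH.
Let yU := ydalg_yd aU.
Let yR := ydalg_yd hR.
Notation hp := (@harpoon k B H U ev).
Notation al := (@coact_action k B H U ev R psi).

Let UHK := braid_UHK hH hU hev HC.
Let HUK := braid_HUK hH hU hev HC.

Lemma psi_ydm : @yd_morph k B R (yd_tens R U) psi. Proof. by case: hpsi. Qed.
Lemma coact_assoc_r r : tassoc (tmap psi idfun (psi r)) = tmap idfun dU (psi r).
Proof. by case: hpsi. Qed.
Lemma coact_counit r : trunit (tmap idfun (counit U) (psi r)) = r.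
Proof. by case: hpsi. Qed.
Lemma coactM x y : psi (mR (x \ox y)) = tmap mR mU (tmid (C U R) (psi x \ox psi y)).
Proof. by case: hpsi => _ _ _ [h _]; rewrite h tmapE. Qed.
Lemma coact1 : psi (alg_one R) = alg_one R \ox alg_one U.
Proof. by case: hpsi => _ _ _ [_ h]; rewrite h /alg_one /=; te. Qed.

Lemma alpha_op Q (t : tens H (tens R Q)) : op21 al t =
  tmap idfun (op20 ev) (tmap idfun (op22 (C H U))
    (op22 (C H R) (tmap idfun (op12 psi) t))).
Proof.
move: t; tpure h t; move: t; tpure r q; te; rewrite /coact_action; te.
move: (psi r); tpure r0 u; te.
move: (C H R _); tpure r' h'; te.
by move: (C H U _); tpure u' h0; te; rewrite tpureZl tpureZr.
Qed.

Lemma op_coactA Q (t : tens R Q) :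
  op12 psi (op12 psi t) = tmap idfun (op12 dU) (op12 psi t).
Proof.
move: t; tpure r q; te.
transitivity (tmap idfun (@tassoc k U U Q) (tassoc (tassoc (tmap psi idfun (psi r)) \ox q))).
  move: (psi r); tpure r0 u; te.
  by move: (psi r0); tpure r1 u1; te.
by rewrite coact_assoc_r; move: (psi r); tpure r0 u; te.
Qed.

Lemma op_coactM Q (t : tens R (tens R Q)) : op12 psi (op21 mR t) =
  tmap idfun (op21 mU) (op21 mR (tmap idfun (op22 (C U R))
    (tmap idfun (tmap idfun (op12 psi)) (op12 psi t)))).
Proof.
move: t; tpure x t; move: t; tpure y q; te; rewrite coactM.
move: (psi x); tpure x0 u; te; move: (psi y); tpure y0 v; te; rewrite tmidE /=.
by move: (C U R _); tpure y1 u1; te.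
Qed.

(** The operator rho(f # 1) of the RL-condition, as shown by [RL_rhoE]. *)
Definition rho_act : tens U H -> H :=
  @tlunit k H \o tmap ev idfun \o @tassocV k U H H \o tmap idfun dH.
HB.instance Definition _ := GRing.Linear.on rho_act.
Notation rh := rho_act.

Lemma rho_op Q (t : tens U (tens H Q)) :
  op21 rh t = op20 ev (tmap idfun (op12 dH) t).
Proof.
move: t; tpure f t; move: t; tpure x q; te; rewrite /rho_act; te.
by move: (dH x); tpure a b; te; rewrite tpureZl.
Qed.

Lemma alpha_ydm : @yd_morph k B (yd_tens H R) R al.
Proof.
exact: (ydm_comp (ydm_runit yR) (ydm_comp (ydm_tmapr R (ev_ydm hev))
  (ydm_comp (ydm_tmapr R (braid_ydm yH yU)) (ydm_comp (ydm_op22 U (braid_ydm yH yR))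
    (ydm_tmapr H psi_ydm))))).
Qed.

Section Words.
Variable Q : lmodType k.
Let ob (n : nat) : lmodType k := nth (H : lmodType k) [:: H : lmodType k; U : lmodType k; R :
  lmodType k] n.
Let sig : nat -> gen Q ob := nth (gen00 Q ob)
  [:: @gen20 k Q ob 1 0 ev;
      @gen22 k Q ob 1 0 0 1 (C U H);
      @gen22 k Q ob 0 1 1 0 (C H U);
      @gen22 k Q ob 1 1 1 1 (C U U)]%N.
Local Open Scope nat_scope.
Notation gev := 0.
Notation gUH := 1.
Notation gHU := 2.
Notation gUU := 3.
Let ars := [:: ([:: 1; 0], [::]); ([:: 1; 0], [:: 0; 1]); ([:: 0; 1], [:: 1; 0]); ([:: 1; 1], [::
  1; 1])].
Let UHU : rule sig.
Proof. rule [:: 1; 0] : [:: (0, gUH); (0, gHU)] ~> [::] by (op22_cancel UHK). Defined.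
Let nr_ev_U : rule sig.
Proof. rule [:: 1; 0; 1] : [:: (1, gHU); (0, gUU); (1, gev)] ~> [:: (0, gev)] by (braid_op20l yU
  (ev_ydm hev)). Defined.

(** The counterpart of [op_evHH] for two strands U; here C_(H,U) C_(U,H) = 1 takes the place of the
    involution on H (x) H. *)
Lemma op_evUU_word : weq sig [:: 1; 1; 0] [:: (0, gUU); (1, gev)]
  [:: (1, gUH); (0, gev)].
Proof.
diagram ars [:: ([::], 0, 1, rflip UHU); ([::], 1, 0, nr_ev_U)] [::].
Qed.
End Words.

Lemma op_evUU Q (t : tens U (tens U (tens H Q))) :
  tmap idfun (op20 ev) (op22 (C U U) t) =
  op20 ev (tmap idfun (op22 (C U H)) t).
Proof. word_eq (op_evUU_word t). Qed.
Section Words.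
Variable Q : lmodType k.
Let ob (n : nat) : lmodType k := nth (H : lmodType k) [:: H : lmodType k; U : lmodType k; R :
  lmodType k] n.
Let sig : nat -> gen Q ob := nth (gen00 Q ob)
  [:: @gen21 k Q ob 0 0 0 mH;
      @gen12 k Q ob 0 0 0 dH;
      @gen21 k Q ob 1 1 1 mU;
      @gen12 k Q ob 1 1 1 dU;
      @gen20 k Q ob 1 0 ev;
      @gen21 k Q ob 2 2 2 mR;
      @gen12 k Q ob 2 2 1 psi;
      @gen21 k Q ob 1 0 0 hp;
      @gen21 k Q ob 0 2 2 al;
      @gen21 k Q ob 1 0 0 rh;
      @gen22 k Q ob 0 0 0 0 (C H H);
      @gen22 k Q ob 1 0 0 1 (C U H);
      @gen22 k Q ob 0 1 1 0 (C H U);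
      @gen22 k Q ob 1 1 1 1 (C U U);
      @gen22 k Q ob 0 2 2 0 (C H R);
      @gen22 k Q ob 1 2 2 1 (C U R)]%N.
Local Open Scope nat_scope.
Notation gmH := 0.
Notation gdH := 1.
Notation gmU := 2.
Notation gdU := 3.
Notation gev := 4.
Notation gmR := 5.
Notation gpsi := 6.
Notation ghp := 7.
Notation gal := 8.
Notation grh := 9.
Notation gHH := 10.
Notation gUH := 11.
Notation gHU := 12.
Notation gUU := 13.
Notation gHR := 14.
Notation gUR := 15.
Let ars := [:: ([:: 0; 0], [:: 0]); ([:: 0], [:: 0; 0]); ([:: 1; 1], [:: 1]); ([:: 1], [:: 1; 1]);
  ([:: 1; 0], [::]); ([:: 2; 2], [:: 2]); ([:: 2], [:: 2; 1]); ([:: 1; 0], [:: 0]); ([:: 0; 2],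
  [:: 2]); ([:: 1; 0], [:: 0]); ([:: 0; 0], [:: 0; 0]); ([:: 1; 0], [:: 0; 1]); ([:: 0; 1], [:: 1;
  0]); ([:: 1; 1], [:: 1; 1]); ([:: 0; 2], [:: 2; 0]); ([:: 1; 2], [:: 2; 1])].
Let hpE : rule sig.
Proof. rule [:: 1; 0] : [:: (0, ghp)] ~> [:: (1, gdH); (0, gUH); (1, gev)] by (harpoon_op ev).
  Defined.
Let hpA : rule sig.
Proof. rule [:: 1; 1; 0] : [:: (0, gmU); (0, ghp)] ~> [:: (1, ghp); (0, ghp)] by (op_harpoonA hH
  hU hev). Defined.
Let hpM : rule sig.
Proof. rule [:: 1; 0; 0] : [:: (1, gmH); (0, ghp)] ~> [:: (0, gdU); (1, gUH); (0, ghp); (1, ghp);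
  (0, gmH)] by (op_harpoonM hH hU hev). Defined.
Let hpD : rule sig.
Proof. rule [:: 1; 0] : [:: (0, ghp); (0, gdH)] ~> [:: (1, gdH); (0, gUH); (1, ghp)] by
  (op_harpoon_comul hH hU ev). Defined.
Let alE : rule sig.
Proof. rule [:: 0; 2] : [:: (0, gal)] ~> [:: (1, gpsi); (0, gHR); (1, gHU); (1, gev)] by
  (alpha_op). Defined.
Let rhE : rule sig.
Proof. rule [:: 1; 0] : [:: (0, grh)] ~> [:: (1, gdH); (0, gev)] by (rho_op). Defined.
Let dM : rule sig.
Proof. rule [:: 0; 0] : [:: (0, gmH); (0, gdH)] ~> [:: (0, gdH); (2, gdH); (1, gHH); (0, gmH); (1,
  gmH)] by (op_comulM (comulM hH)). Defined.
Let dA : rule sig.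
Proof. rule [:: 0] : [:: (0, gdH); (0, gdH)] ~> [:: (0, gdH); (1, gdH)] by (op12A (comul_assoc
  hH)). Defined.
Let evH : rule sig.
Proof. rule [:: 1; 0; 0] : [:: (1, gmH); (0, gev)] ~> [:: (0, gdU); (1, gUH); (0, gev); (0, gev)]
  by (op_ev_mulr hev). Defined.
Let evU : rule sig.
Proof. rule [:: 1; 1; 0] : [:: (0, gmU); (0, gev)] ~> [:: (2, gdH); (1, gUH); (0, gev); (0, gev)]
  by (op_ev_mull hev). Defined.
Let HUH : rule sig.
Proof. rule [:: 0; 1] : [:: (0, gHU); (0, gUH)] ~> [::] by (op22_cancel HUK). Defined.
Let pA : rule sig.
Proof. rule [:: 2] : [:: (0, gpsi); (0, gpsi)] ~> [:: (0, gpsi); (1, gdU)] by (op_coactA). Defined.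
Let pM : rule sig.
Proof. rule [:: 2; 2] : [:: (0, gmR); (0, gpsi)] ~> [:: (0, gpsi); (2, gpsi); (1, gUR); (0, gmR);
  (1, gmU)] by (op_coactM). Defined.
Let nl_H_mR : rule sig.
Proof. rule [:: 0; 2; 2] : [:: (1, gmR); (0, gHR)] ~> [:: (0, gHR); (1, gHR); (0, gmR)] by
  (braid_op21r yH (ydalg_mul_ydm hR)). Defined.
Let nl_H_psi : rule sig.
Proof. rule [:: 0; 2] : [:: (1, gpsi); (0, gHR); (1, gHU)] ~> [:: (0, gHR); (0, gpsi)] by
  (braid_op12r yH psi_ydm). Defined.
Let nl_U_psi : rule sig.
Proof. rule [:: 1; 2] : [:: (1, gpsi); (0, gUR); (1, gUU)] ~> [:: (0, gUR); (0, gpsi)] by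
  (braid_op12r yU psi_ydm). Defined.
Let nl_H_ev : rule sig.
Proof. rule [:: 0; 1; 0] : [:: (0, gHU); (1, gHH); (0, gev)] ~> [:: (1, gev)] by (braid_op20r yH
  (ev_ydm hev)). Defined.
Let nl_U_ev : rule sig.
Proof. rule [:: 1; 1; 0] : [:: (0, gUU); (1, gUH); (0, gev)] ~> [:: (1, gev)] by (braid_op20r yU
  (ev_ydm hev)). Defined.
Let nl_U_dH : rule sig.
Proof. rule [:: 1; 0] : [:: (1, gdH); (0, gUH); (1, gUH)] ~> [:: (0, gUH); (0, gdH)] by
  (braid_op12r yU (comul_ydm hH)). Defined.
Let nl_U_mR : rule sig.
Proof. rule [:: 1; 2; 2] : [:: (1, gmR); (0, gUR)] ~> [:: (0, gUR); (1, gUR); (0, gmR)] by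
  (braid_op21r yU (ydalg_mul_ydm hR)). Defined.
Let nl_U_al : rule sig.
Proof. rule [:: 1; 0; 2] : [:: (1, gal); (0, gUR)] ~> [:: (0, gUH); (1, gUR); (0, gal)] by
  (braid_op21r yU alpha_ydm). Defined.
Let nr_mH_R : rule sig.
Proof. rule [:: 0; 0; 2] : [:: (0, gmH); (0, gHR)] ~> [:: (1, gHR); (0, gHR); (1, gmH)] by
  (braid_op21l yR (ydalg_mul_ydm aH)). Defined.
Let nr_ev_R : rule sig.
Proof. rule [:: 1; 0; 2] : [:: (1, gHR); (0, gUR); (1, gev)] ~> [:: (0, gev)] by (braid_op20l yR
  (ev_ydm hev)). Defined.
Let nr_dH_R : rule sig.
Proof. rule [:: 0; 2] : [:: (0, gdH); (1, gHR); (0, gHR)] ~> [:: (0, gHR); (1, gdH)] by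
  (braid_op12l yR (comul_ydm hH)). Defined.
Let nr_mU_R : rule sig.
Proof. rule [:: 1; 1; 2] : [:: (0, gmU); (0, gUR)] ~> [:: (1, gUR); (0, gUR); (1, gmU)] by
  (braid_op21l yR (ydalg_mul_ydm aU)). Defined.
Let nr_dU_R : rule sig.
Proof. rule [:: 1; 2] : [:: (0, gdU); (1, gUR); (0, gUR)] ~> [:: (0, gUR); (1, gdU)] by
  (braid_op12l yR (comul_ydm hU)). Defined.
Let nr_dU_H : rule sig.
Proof. rule [:: 1; 0] : [:: (0, gdU); (1, gUH); (0, gUH)] ~> [:: (0, gUH); (1, gdU)] by
  (braid_op12l yH (comul_ydm hU)). Defined.
Let nr_hp_R : rule sig.
Proof. rule [:: 1; 0; 2] : [:: (0, ghp); (0, gHR)] ~> [:: (1, gHR); (0, gUR); (1, ghp)] by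
  (braid_op21l yR (harpoon_ydm hH hU hev)). Defined.
Let y_UHR : rule sig.
Proof. rule [:: 1; 0; 2] : [:: (1, gHR); (0, gUR); (1, gUH)] ~> [:: (0, gUH); (1, gUR); (0, gHR)]
  by (braid_op22r yU (braid_ydm yH yR)). Defined.
Let evUU : rule sig.
Proof. rule [:: 1; 1; 0] : [:: (0, gUU); (1, gev)] ~> [:: (1, gUH); (0, gev)] by (op_evUU). Defined.

(** Pairing r_1 with a product in H splits r_1 by its coproduct ([evH]), which amounts to coacting
    twice. *)
Lemma op_alphaA_word : weq sig [:: 0; 0; 2] [:: (0, gmH); (0, gal)]
  [:: (1, gal); (0, gal)].
Proof.
diagram ars [:: ([::], 1, 0, alE); ([::], 1, 0, nl_H_psi); ([::], 0, 0, nr_mH_R); ([:: 2], 3, 1,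
  evH);
    ([::], 2, 0, rflip pA); ([::], 1, 0, rflip nl_H_psi); ([:: 3], 4, 2, HUH);
    ([:: 4; 3; 2], 3, 0, rflip nl_H_psi); ([::], 0, 1, rflip nl_H_psi); ([::], 4, 0, rflip alE);
    ([::], 0, 1, rflip alE)] [::].
Qed.

(** psi is multiplicative, and pairing a product in U with h splits h by its coproduct ([evU]). *)
Lemma op_alphaM_word : weq sig [:: 0; 2; 2] [:: (1, gmR); (0, gal)]
  [:: (0, gdH); (1, gHR); (0, gal); (1, gal); (0, gmR)].
Proof.
diagram ars [:: ([::], 1, 0, alE); ([::], 1, 0, nl_H_psi); ([::], 0, 0, nl_H_mR); ([::], 2, 0, pM);
    ([::], 6, 1, evU); ([:: 1; 5; 4; 3], 2, 2, rflip nr_dH_R); ([::], 4, 2, rflip nl_H_psi);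
    ([:: 6; 7], 8, 2, HUH); ([:: 8; 7; 6; 5; 8], 6, 1, nr_ev_R);
    ([:: 5; 4; 3], 4, 1, rflip nl_H_psi); ([:: 3; 2; 1; 0; 2], 1, 0, rflip nr_dH_R);
    ([:: 5; 4; 3; 6; 5; 4; 7; 6; 5], 6, 0, rflip nl_H_psi);
    ([:: 0; 1; 5; 4; 3; 2; 6; 5; 4; 3; 7; 6; 5; 4; 8; 7; 6; 5], 6, 1, rflip alE);
    ([:: 5; 4; 3; 2], 3, 0, rflip alE)] [:: 2].
Qed.

Lemma op_betaA_word : weq sig [:: 1; 1; 2; 0] [:: (0, gmU); (0, gUR); (1, ghp)]
  [:: (1, gUR); (2, ghp); (0, gUR); (1, ghp)].
Proof.
diagram ars [:: ([::], 0, 0, nr_mU_R); ([::], 2, 1, hpA)] [:: 1].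
Qed.

Lemma op_betaM_word : weq sig [:: 1; 2; 0; 2; 0] [:: (2, gdH); (3, gHR); (2, gal); (1, gmR); (2,
  gmH); (0, gUR); (1, ghp)]
  [:: (0, gdU); (1, gUR); (2, gUH); (0, gUR); (1, ghp); (2, gUR); (3, ghp); (1, gdH); (2, gHR);
    (1, gal); (0, gmR); (1, gmH)].
Proof.
diagram ars [:: ([:: 4], 5, 1, hpM); ([::], 3, 0, nl_U_mR); ([:: 2], 3, 1, nl_U_al);
    ([:: 6; 5], 4, 2, rflip nr_dU_R); ([::], 3, 1, rflip nr_dU_H); ([::], 2, 0, rflip nr_dU_R);
    ([:: 1; 2; 3; 4; 5; 10; 9; 8], 6, 3, y_UHR); ([:: 0; 1; 2; 5], 3, 2, nl_U_dH);
    ([:: 11; 10; 9; 8; 7; 11; 10], 8, 2, rflip nr_hp_R); ([:: 5; 4; 6; 5], 6, 1, rflip hpD)] [::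
      2; 5; 4].
Qed.

(** In R # H, h_1 acts on s_0 by pairing with a component of its coaction. Coassociativity of psi
    merges this pairing with that of x_1 into the pairing of s_1 with h_1 x_1, and h_2 x_2
    remains. *)
Lemma op_theta_l_word : weq sig [:: 0; 2; 0] [:: (1, gpsi); (2, grh); (0, gdH); (1, gHR); (0,
  gal); (1, gmH)]
  [:: (0, gHR); (1, gmH); (0, gpsi); (1, grh)].
Proof.
diagram ars [:: ([:: 1; 2; 3], 4, 2, rhE); ([:: 3; 4; 5], 6, 0, alE);
    ([:: 0; 5; 4; 3; 6; 5; 4; 7; 6; 5; 8; 7; 6], 8, 1, rflip nl_H_ev);
    ([:: 6; 5; 4; 3; 2; 1; 7; 6; 5; 4], 2, 1, nl_H_psi); ([:: 1; 2; 3; 4; 5; 6], 6, 2, rflip HUH);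
    ([:: 8; 7; 6; 5; 4; 3; 9; 8; 7; 6; 5; 4; 11; 10; 9; 8; 7; 6; 5], 6, 0, nl_H_psi);
    ([:: 2; 3; 4; 7], 5, 0, nl_H_psi);
    ([:: 1; 0; 4; 3; 5; 4; 6; 5; 7; 6; 8; 7; 9], 1, 0, nr_dH_R);
    ([:: 0; 1; 6; 5; 4; 3; 8; 7; 6; 5; 4], 5, 0, pA); ([:: 4; 3; 2; 1], 6, 1, rflip evH);
    ([:: 5], 2, 2, rflip dM); ([:: 1], 3, 1, rflip rhE)] [::].
Qed.

(** [harpoon] uses the last factor of the coproduct of x and [rho_act] the first, so they commute by
    coassociativity. *)
Lemma op_theta_beta_word : weq sig [:: 1; 2; 0] [:: (1, gpsi); (2, grh); (0, gUR); (1, ghp)]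
  [:: (0, gUR); (1, ghp); (0, gpsi); (1, grh)].
Proof.
diagram ars [:: ([:: 1], 2, 2, rhE); ([::], 4, 1, hpE); ([:: 3], 2, 3, rflip dA); ([::], 4, 1,
  rflip nl_U_ev);
    ([:: 3; 6], 4, 2, nl_U_dH); ([:: 1; 0], 1, 0, nl_U_psi); ([:: 0; 1; 5; 4], 2, 2, rflip hpE);
    ([::], 3, 1, rflip rhE)] [:: 1].
Qed.

(** As psi is multiplicative, theta of r s (x) x pairs x_1 with a product of r_1 and s_1, which
    [evU] separates into two applications of [rho_act]. Hence r has to act through r_0 and rho(r_1),
    the shape of the isomorphism. *)
Lemma op_theta_r_word : weq sig [:: 2; 2; 0] [:: (0, gpsi); (1, gUR); (2, grh); (1, gpsi); (2,
  grh); (0, gmR)]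
  [:: (0, gmR); (0, gpsi); (1, grh)].
Proof.
diagram ars [:: ([:: 4], 5, 1, rhE); ([:: 2; 3], 4, 2, rhE); ([:: 5], 4, 3, rflip dA);
    ([:: 3; 2; 1; 4; 3; 2], 3, 1, rflip nl_U_psi); ([:: 5], 6, 1, evUU);
    ([:: 2; 3; 4], 5, 1, rflip evU); ([:: 0], 1, 0, rflip pM); ([:: 0; 1], 2, 1, rflip rhE)] [::].
Qed.
End Words.

Lemma op_alphaA Q (t : tens H (tens H (tens R Q))) :
  op21 al (op21 mH t) =
  op21 al (tmap idfun (op21 al) t).
Proof. word_eq (op_alphaA_word t). Qed.

Lemma op_alphaM Q (t : tens H (tens R (tens R Q))) :
  op21 al (tmap idfun (op21 mR) t) =
  op21 mR (tmap idfun (op21 al) (op21 al (tmap idfun (op22 (C H R)) (op12 dH t)))).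
Proof. word_eq (op_alphaM_word t). Qed.

Lemma op_betaA Q (t : tens U (tens U (tens R (tens H Q)))) :
  tmap idfun (op21 hp) (op22 (C U R) (op21 mU t)) =
  tmap idfun (op21 hp) (op22 (C U R) (tmap idfun (tmap idfun (op21 hp)) (tmap idfun (op22 (C U R))
    t))).
Proof. word_eq (op_betaA_word t). Qed.

Lemma op_betaM Q (t : tens U (tens R (tens H (tens R (tens H Q))))) :
  tmap idfun (op21 hp) (op22 (C U R) (tmap idfun (tmap idfun (op21 mH)) (tmap idfun (op21 mR)
    (tmap idfun (tmap idfun (op21 al)) (tmap idfun (tmap idfun (tmap idfun (op22 (C H R)))) (tmap
    idfun (tmap idfun (op12 dH)) t)))))) =
  tmap idfun (op21 mH) (op21 mR (tmap idfun (op21 al) (tmap idfun (tmap idfun (op22 (C H R)))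
    (tmap idfun (op12 dH) (tmap idfun (tmap idfun (tmap idfun (op21 hp))) (tmap idfun (tmap idfun
    (op22 (C U R))) (tmap idfun (op21 hp) (op22 (C U R) (tmap idfun (tmap idfun (op22 (C U H)))
    (tmap idfun (op22 (C U R)) (op12 dU t))))))))))).
Proof. word_eq (op_betaM_word t). Qed.

Lemma op_theta_l Q (t : tens H (tens R (tens H Q))) :
  tmap idfun (op21 mH) (op21 al (tmap idfun (op22 (C H R)) (op12 dH (tmap idfun (tmap idfun (op21
    rh)) (tmap idfun (op12 psi) t))))) =
  tmap idfun (op21 rh) (op12 psi (tmap idfun (op21 mH) (op22 (C H R) t))).
Proof. word_eq (op_theta_l_word t). Qed.

Lemma op_theta_beta Q (t : tens U (tens R (tens H Q))) :
  tmap idfun (op21 hp) (op22 (C U R) (tmap idfun (tmap idfun (op21 rh)) (tmap idfun (op12 psi)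
    t))) =
  tmap idfun (op21 rh) (op12 psi (tmap idfun (op21 hp) (op22 (C U R) t))).
Proof. word_eq (op_theta_beta_word t). Qed.

Lemma op_theta_r Q (t : tens R (tens R (tens H Q))) :
  op21 mR (tmap idfun (tmap idfun (op21 rh)) (tmap idfun (op12 psi) (tmap idfun (tmap idfun (op21
    rh)) (tmap idfun (op22 (C U R)) (op12 psi t))))) =
  tmap idfun (op21 rh) (op12 psi (op21 mR t)).
Proof. word_eq (op_theta_r_word t). Qed.

Lemma alpha_module_algebra : module_algebra al.
Proof.
split=> [|r|x y r|h r s|h].
- exact: alpha_ydm.
- apply: tpure1_inj; rewrite -op21E alpha_op; te.
  rewrite -[in RHS](coact_counit r).
  move: (psi r); tpure r0 u; te.
  rewrite (braid_invl _ yR (ydalg_one_inv aH)); te.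
  by rewrite (braid_invl _ yU (ydalg_one_inv aH)); te; rewrite (ev_1r hev) tpureZl tpureZr.
- by apply: tpure1_inj; have := op_alphaA (x \ox (y \ox (r \ox (1 : k^o)))); te.
- apply: tpure1_inj; have := op_alphaM (h \ox (r \ox (s \ox (1 : k^o)))); te => ->.
  move: (dH h); tpure h1 h2; te; rewrite tmidE /=.
  by move: (C H R _); tpure r' h'; te.
apply: tpure1_inj; rewrite -op21E alpha_op; te; rewrite coact1; te.
rewrite (braid_invr _ yH (ydalg_one_inv hR)); te.
rewrite (braid_invr _ yH (ydalg_one_inv aU)); te.
by rewrite (ev_1l hev) alg_unitE tpureZl tpureZr.
Qed.

End Coaction.

Lemma tail1_inj (k : fieldType) (V W : lmodType k) :
  injective (fun t : tens V W => tassoc (t \ox (1 : k^o))).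
Proof. by move=> s t /= /(can_inj (@tassocK k V W k^o)) /tpure1_inj. Qed.

Lemma tassoc_tail (k : fieldType) (V W X Y : lmodType k) (f : {linear X -> Y})
    (a : tens V W) (x : X) :
  tmap idfun (tmap idfun f) (tassoc (a \ox x)) = tassoc (a \ox f x).
Proof. by move: a; tpure v w; te. Qed.

(** * The natural action of a smash product A # K on A, and the smash product (R # H) # U *)

Section SmashRep.
Variables (k : fieldType) (B : hopfAlgebra k) (A : algData B) (K : hopfData B).
Variables (act : {linear tens K A -> A}).
Hypotheses (hA : is_ydalg A) (hK : is_braided_hopf K) (hact : module_algebra act).
Notation C V W := (@braid k B V W).
Notation mA := (alg_mul A).
Notation mK := (alg_mul K).
Notation d := (comul K).

Lemma smash_one : alg_one (smash act) = alg_one A \ox alg_one K.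
Proof. by rewrite /alg_one /=; te. Qed.

(* For the action of U on H this is the map lambda of the RL-condition. *)
Definition smash_rep : tens (tens A K) A -> A := mA \o tmap idfun act \o @tassoc k A K A.
HB.instance Definition _ := GRing.Linear.on smash_rep.

Lemma smash_repE a x b : smash_rep (a \ox x \ox b) = mA (a \ox act (x \ox b)).
Proof. by rewrite /smash_rep; te. Qed.

Lemma smash_rep_one b : smash_rep (alg_one (smash act) \ox b) = b.
Proof.
by rewrite smash_one smash_repE; case: hact => _ -> _ _ _; apply: (ydalg_mul1l hA).
Qed.

Lemma smash_mul_op (Q : lmodType k) (s t : tens A K) (q : Q) :
  tmap idfun (op21 mK) (op21 mA (tmap idfun (op21 act)
   (tmap idfun (tmap idfun (op22 (C K A))) (tmap idfun (op12 d)
     (tassoc (s \ox tassoc (t \ox q))))))) =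
  tassoc (alg_mul (smash act) (s \ox t) \ox q).
Proof.
move: s; tpure a x; move: t; tpure b y; te; rewrite tmidE; te.
move: (d x); tpure x1 x2; te.
by move: (C K A _); tpure b' x'; te.
Qed.

Section Words.
Variable Q : lmodType k.
Let ob (n : nat) : lmodType k := nth (A : lmodType k) [:: A : lmodType k; K : lmodType k] n.
Let sig : nat -> gen Q ob := nth (gen00 Q ob)
  [:: @gen21 k Q ob 0 0 0 mA;
      @gen21 k Q ob 1 1 1 mK;
      @gen12 k Q ob 1 1 1 d;
      @gen21 k Q ob 1 0 0 act;
      @gen22 k Q ob 1 0 0 1 (C K A)]%N.
Local Open Scope nat_scope.
Notation gmA := 0.
Notation gmK := 1.
Notation gd := 2.
Notation ga := 3.
Notation gKA := 4.
Let ars := [:: ([:: 0; 0], [:: 0]); ([:: 1; 1], [:: 1]); ([:: 1], [:: 1; 1]); ([:: 1; 0], [:: 0]);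
  ([:: 1; 0], [:: 0; 1])].
Let mA : rule sig.
Proof. rule [:: 0; 0; 0] : [:: (0, gmA); (0, gmA)] ~> [:: (1, gmA); (0, gmA)] by (op21A
  (ydalg_mulA hA)). Defined.
Let actM : rule sig.
Proof. rule [:: 1; 1; 0] : [:: (0, gmK); (0, ga)] ~> [:: (1, ga); (0, ga)] by (op_module (let:
  And5 _ _ h _ _ := hact in h)). Defined.
Let actA : rule sig.
Proof. rule [:: 1; 0; 0] : [:: (1, gmA); (0, ga)] ~> [:: (0, gd); (1, gKA); (0, ga); (1, ga); (0,
  gmA)] by (op_module_alg (let: And5 _ _ _ h _ := hact in h)). Defined.

Lemma op_smash_repM_word : weq sig [:: 0; 1; 0; 1; 0] [:: (1, gd); (2, gKA); (1, ga); (0, gmA);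
  (1, gmK); (1, ga); (0, gmA)]
  [:: (3, ga); (2, gmA); (1, ga); (0, gmA)].
Proof.
diagram ars [:: ([::], 4, 1, actM); ([:: 3; 4], 5, 0, mA); ([:: 2; 1; 0], 1, 1, rflip actA)] [::].
Qed.
End Words.

Lemma op_smash_repM Q (t : tens A (tens K (tens A (tens K (tens A Q))))) :
  op21 mA (tmap idfun (op21 act) (tmap idfun (op21 mK) (op21 mA (tmap idfun (op21 act) (tmap idfun
    (tmap idfun (op22 (C K A))) (tmap idfun (op12 d) t)))))) =
  op21 mA (tmap idfun (op21 act) (tmap idfun (tmap idfun (op21 mA)) (tmap idfun (tmap idfun (tmap
    idfun (op21 act))) t))).
Proof. word_eq (op_smash_repM_word t). Qed.

Lemma smash_repM s t b :
  smash_rep (alg_mul (smash act) (s \ox t) \ox b) = smash_rep (s \ox smash_rep (t \ox b)).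
Proof.
have e (u : tens A K) c : smash_rep (u \ox c) \ox (1 : k^o) =
    op21 mA (tmap idfun (op21 act) (tassoc (u \ox (c \ox (1 : k^o))))).
  by rewrite /smash_rep; move: u; tpure a x; te.
apply: tpure1_inj; rewrite !e -smash_mul_op op_smash_repM.
by congr (op21 _ _); move: s; tpure a x; te; rewrite -e; te.
Qed.

Lemma smash_rep_ydm : @yd_morph k B (yd_tens (yd_tens A K) A) A smash_rep.
Proof.
have mact : @yd_morph k B (yd_tens K A) A act by case: hact.
exact: (ydm_comp (ydalg_mul_ydm hA) (ydm_comp (ydm_tmapr A mact) (ydm_assoc A K A))).
Qed.
End SmashRep.

Section ExtendedAction.
Variables (k : fieldType) (B : hopfAlgebra k) (H U : hopfData B) (R : algData B).
Hypotheses (hH : is_braided_hopf H) (hU : is_braided_hopf U) (hR : is_ydalg R).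
Variable (ev : {linear tens U H -> k^o}) (psi : {linear R -> tens R U}).
Hypotheses (hev : hopf_pairing ev) (hpsi : comodule_algebra psi).
Notation C V W := (@braid k B V W).
Hypothesis HC : forall t, C H H (C H H t) = t.
Notation dU := (comul U).
Let aH := hopf_ydalg hH.
Let aU := hopf_ydalg hU.
Let yH := ydalg_yd aH.
Let yU := ydalg_yd aU.
Let yR := ydalg_yd hR.
Notation hp := (@harpoon k B H U ev).
Notation al := (@coact_action k B H U ev R psi).
Notation RH := (smash al).
Notation be := (@extended_action k B H U ev R).

Lemma beta_op (Q : lmodType k) (u : U) (m : tens R H) (q : Q) :
  tmap idfun (op21 hp) (op22 (C U R) (u \ox tassoc (m \ox q))) =
  tassoc (be (u \ox m) \ox q).
Proof.
move: m; tpure r h; rewrite /extended_action; te.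
by move: (C U R _); tpure r' u'; te.
Qed.

Lemma braid_smash_op (Q : lmodType k) (u : U) (m : tens R H) (q : Q) :
  tmap idfun (op22 (C U H)) (op22 (C U R) (u \ox tassoc (m \ox q))) =
  tassoc (tassoc (C U (yd_tens R H) (u \ox m) \ox q)).
Proof.
move: m; tpure r h; te; rewrite (braid_hexr _ _ _ yU).
move: (C U R _); tpure r' u'; te.
by move: (C U H _); tpure h' u0; te.
Qed.

Lemma beta_ydm : @yd_morph k B (yd_tens U RH) RH be.
Proof.
exact: (ydm_comp (ydm_tmapr R (harpoon_ydm hH hU hev)) (ydm_op22 H (braid_ydm yU yR))).
Qed.

Lemma beta_module_algebra : module_algebra (A := RH) be.
Proof.
have hhp := harpoon_module_algebra hH hU hev.
split=> [|m|u v m|u m n|u].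
- exact: beta_ydm.
- move: m; tpure r h; rewrite /extended_action; te.
  by rewrite (braid_invl _ yR (ydalg_one_inv aU)); te; case: hhp => _ -> _ _ _.
- apply: tail1_inj => /=; rewrite -!beta_op.
  have := op_betaA hH hU hR psi hev (u \ox (v \ox tassoc (m \ox (1 : k^o)))).
  by rewrite op21E ![tmap idfun _ (u \ox _)]tmapE /= !beta_op.
- apply: tail1_inj => /=; rewrite -beta_op -(smash_mul_op al).
  have := op_betaM hH hU hR hev hpsi (u \ox tassoc (m \ox tassoc (n \ox (1 : k^o)))).
  rewrite ![tmap idfun _ (u \ox _)]tmapE /= => ->.
  pose X := tassoc (n \ox (1 : k^o)); rewrite -/X op12E.
  rewrite -[RHS]/(tassoc (alg_mul RH (tmap be be (tmid (C U RH) (dU u \ox (m \ox n)))) \ox (1 :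
    k^o))).
  move: (dU u); tpure u1 u2; rewrite tassocE ![tmap idfun _ (u1 \ox _)]tmapE /= braid_smash_op
    tmidE /=.
  (* The word treats R and H as separate strands; [claim] groups them again into elements of R # H,
     and [mulE] does the same for the product. *)
  have claim (t : tens (tens R H) U) :
      tmap idfun (tmap idfun (tmap idfun (op21 hp (X:=k^o))))
       (tmap idfun (tmap idfun (op22 (C U R))) (tmap idfun (op21 hp) (op22 (C U R)
         (u1 \ox tassoc (tassoc (t \ox X)))))) =
      tassoc (tmap idfun (@tassoc k R H k^o) (tassoc (tmap be be
        (tassocV (u1 \ox tassoc (t \ox n))) \ox (1 : k^o)))).
    move: t; tpure m' u'; te; rewrite beta_op /= -(beta_op u' n) -/X.
    apply: etrans; last exact: (@tassoc_tail k R H (tens R (tens U (tens H k^o))) (tens R (tens H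
      k^o))
      (tmap idfun (op21 hp (X:=k^o))) (be (u1 \ox m')) _).
    by congr (tmap _ _ _); apply: (@tassoc_tail k R H _ _ (op22 (C U R))).
  have mulE (s : tens (tens R H) (tens R H)) :
      tmap idfun (op21 (alg_mul H) (X:=k^o)) (op21 (alg_mul R) (tmap idfun (op21 al)
       (tmap idfun (tmap idfun (op22 (C H R))) (tmap idfun (op12 (comul H))
        (tassoc (tmap idfun (@tassoc k R H k^o) (tassoc (s \ox (1 : k^o))))))))) =
      tassoc (alg_mul RH s \ox (1 : k^o)).
    by move: s; tpure x y; rewrite tassocE tmapE -smash_mul_op.
  by apply: etrans; [|exact: mulE]; rewrite -claim.
rewrite (@alg_unitE k B RH) smash_one /extended_action; te.
rewrite (braid_invr _ yU (ydalg_one_inv hR)); te.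
by case: hhp => _ _ _ _ ->; rewrite alg_unitE linearZ.
Qed.
End ExtendedAction.

Lemma tsumB (k : fieldType) (V W Z : lmodType k) (f : V -> W -> Z) s t : bilin f ->
  tsum f (s - t) = tsum f s - tsum f t.
Proof. by move=> bf; rewrite -[LHS]/(mklin (tsum_is_linear bf) _) linearB. Qed.

(** * The lift given by the RL-condition *)

Section TransportYdm.
Variables (k : fieldType) (B : hopfAlgebra k) (V W H : ydData B).
Variables (mu : {linear tens W H -> H}) (nu : {linear tens V H -> H}) (g : {linear V -> W}).
Hypotheses (yV : is_yd V) (yW : is_yd W) (yH : is_yd H).
Notation act := (yd_act _).
Notation coact := (yd_coact _).
Notation Sinv := (@antipodeB_inv k B).

Lemma pair_act (X : ydData B) (m : {linear tens X H -> H}) (b : B) (w : X) (x : H) :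
  is_yd X -> @yd_morph k B (yd_tens X H) H m ->
  m (act (b \ox w) \ox x) =
  \tsum_(b1, b2 <- comulB B b) act (b1 \ox m (w \ox act (antipodeB B b2 \ox x))).
Proof.
move=> yX [m1 _]; have [a1 aM _ _ _] := yH.
under eq_tsum => b1 b2 do rewrite -m1 act_tens linear_tsum.
rewrite (comulB_assoc (G := fun x1 y1 q => m (act (x1 \ox w) \ox act (y1 \ox act (antipodeB B q
  \ox x)))));
  try by move=> *; lin.
under eq_tsum => b1 b2 do under eq_tsum => y q do rewrite -aM.
under eq_tsum => b1 b2 do
  [rewrite (antipodeB_r (F := fun z => m (act (b1 \ox w) \ox act (z \ox x)))); last by lin].
by rewrite (counitB_r (F := fun z => m (act (z \ox w) \ox act (1 \ox x)))) ?a1 //; lin.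
Qed.

(** Multiplying the coaction of m (w (x) x_0) by S^-1(x_(-1)) removes the contribution of x and
    leaves that of w. *)
Lemma pair_coact (X : ydData B) (m : {linear tens X H -> H}) (w : X) (x : H) :
  is_yd X -> @yd_morph k B (yd_tens X H) H m ->
  \tsum_(b, w0 <- coact w) (b \ox m (w0 \ox x)) =
  \tsum_(c, x0 <- coact x) \tsum_(b, y <- coact (m (w \ox x0))) (b * Sinv c \ox y).
Proof.
move=> yX [_ m2]; have [_ _ _ c1 _] := yH.
transitivity (\tsum_(c, x0 <- coact x) \tsum_(a, w0 <- coact w) \tsum_(d, x00 <- coact x0)
  (a * d * Sinv c \ox m (w0 \ox x00))); last first.
  apply: eq_tsum => c x0; rewrite m2 coact_tens.
  move: (coact w); tpure a w0; move: (coact x0); tpure d x00.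
  by rewrite !tsumE; [te; rewrite tsumE //; blin|blin..].
rewrite exch_tsum; apply: eq_tsum => a w0.
rewrite -(coact_assoc (G := fun c d x0 => a * d * Sinv c \ox m (w0 \ox x0))) //;
  try by move=> *; lin.
under eq_tsum => c x0 do under eq_tsum => c1' c2' do rewrite -mulrA.
under eq_tsum => c x0 do
  [rewrite (antipodeB_invr (F := fun z => a * z \ox m (w0 \ox x0))); last by lin].
rewrite -{1}(c1 x) mulr1; move: (coact x); tpure b x0.
by rewrite tsumE; [te; rewrite tpureZr linearZ /= tpureZr|blin].
Qed.

Hypotheses (mmu : @yd_morph k B (yd_tens W H) H mu) (mnu : @yd_morph k B (yd_tens V H) H nu).
Hypothesis gE : forall v x, mu (g v \ox x) = nu (v \ox x).
Hypothesis sep : forall (Z : lmodType k) (s : tens Z W),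
  (forall x, \tsum_(z, w <- s) (z \ox mu (w \ox x)) = 0) -> s = 0.

Lemma sep_inj w w' : (forall x, mu (w \ox x) = mu (w' \ox x)) -> w = w'.
Proof.
move=> h; have /(congr1 (@tlunit k W)) : (1 : k^o) \ox (w - w') = 0.
  apply: sep => x; rewrite tsumE; last by blin.
  by rewrite tpureBl linearB /= h subrr linear0.
by rewrite tlunitE scale1r linear0 => /eqP; rewrite subr_eq0 => /eqP.
Qed.

(** By [pair_act] and [pair_coact] both conditions on g reduce to [gE] once mu is applied. The
    coaction takes values in B (x) W, which is why [sep] allows coefficients. *)
Lemma transport_ydm : @yd_morph k B V W g.
Proof.
split=> [b v|v].
  apply: sep_inj => x; rewrite gE (pair_act _ _ _ yV mnu) (pair_act _ _ _ yW mmu).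
  by apply: eq_tsum => b1 b2; rewrite gE.
apply/eqP; rewrite -subr_eq0; apply/eqP; apply: sep => x.
rewrite tsumB; last by blin.
rewrite (pair_coact _ _ yW mmu) tsum_tmap; last by blin.
rewrite -[X in _ - X](eq_tsum (f := fun b v0 => b \ox nu (v0 \ox x))); last first.
  by move=> b v0 /=; rewrite gE.
rewrite (pair_coact _ _ yV mnu) [X in X - _](eq_tsum (g := fun c x0 =>
  \tsum_(b, y <- coact (nu (v \ox x0))) (b * Sinv c \ox y))) ?subrr // => c x0.
by rewrite gE.
Qed.
End TransportYdm.

Section Faithful.
Variables (k : fieldType) (B : hopfAlgebra k) (H U : hopfData B).
Hypotheses (hH : is_braided_hopf H) (hU : is_braided_hopf U).
Variable (ev : {linear tens U H -> k^o}).
Hypothesis hev : hopf_pairing ev.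
Notation C V W := (@braid k B V W).
Hypothesis HC : forall t, C H H (C H H t) = t.
Variable iS : {linear H -> H}.
Hypotheses (SK : cancel (antipode H) iS) (iSK : cancel iS (antipode H)).
Notation mH := (alg_mul H).
Notation dH := (comul H).
Let aH := hopf_ydalg hH.
Let aU := hopf_ydalg hU.
Let yH := ydalg_yd aH.
Let yU := ydalg_yd aU.
Notation hp := (@harpoon k B H U ev).
Notation la := (@smash_rep k B H U hp).
Notation rh := (rho_act ev).

Lemma RL_lambdaE t x : RL_lambda ev t x = la (t \ox x).
Proof.
move: t; tpure h f; rewrite smash_repE /RL_lambda /= /harpoon; te.
move: (dH x); tpure a b; te; rewrite tmidE; te.
by move: (C U H _); tpure a' f'; te; rewrite tpureZr linearZ.
Qed.

Lemma RL_rhoE f x : RL_rho ev (f \ox alg_one H) x = rh (f \ox x).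
Proof.
have [_ e1] := ydalg_one_inv aH; have [a1 _ _ _ _] := yH.
rewrite /RL_rho tsumE; last by blin.
rewrite e1 tsumE; last by blin.
rewrite comulB1 tsumE; last by blin.
rewrite /rho_act; te; move: (dH x); tpure a b; rewrite tsumE; last by blin.
by te; rewrite !a1 (ydalg_mul1r aH).
Qed.

(** The right-hand side depends on t only through its action on H, so this action determines every
    partial evaluation of t. *)
Lemma lambda_ev t y :
  \tsum_(h, f <- t) ((ev (f \ox y) : k) *: h) =
  \tsum_(p, q <- C H H (dH y)) mH (la (t \ox p) \ox iS q).
Proof.
apply: tpure1_inj.
move: t; tpure h f; rewrite !tsumE; [|blin..].
have := op_harpoon_skew hH hU hev HC SK iSK (h \ox (f \ox (y \ox (1 : k^o)))); te => e.
rewrite tpureZl -tpureZr -e op22_tassoc /=.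
move: (C H H (dH y)); tpure p q; rewrite tsumE; last by blin.
by te; rewrite smash_repE.
Qed.

Lemma lambda_sep (Z : lmodType k) (s : tens Z (smash hp)) :
  (forall x, \tsum_(z, t <- s) (z \ox la (t \ox x)) = 0) -> s = 0.
Proof.
move=> h; apply: (can_inj (@tassocVK k Z H U)); rewrite [RHS]linear0.
apply: (tens_sep (ev_sep hev)) => y.
transitivity (\tsum_(z, t <- s) (z \ox \tsum_(p, q <- C H H (dH y)) mH (la (t \ox p) \ox iS q))).
  move: s {h} => s; move: s; tpure z t; rewrite tsumE; last by blin.
  rewrite -lambda_ev; move: t; tpure h f; rewrite tassocVE !tsumE; [|blin..].
  by rewrite tpureZr.
under eq_tsum => z t do rewrite linear_tsum.
rewrite exch_tsum.
transitivity (\tsum_(p, q <- C H H (dH y)) (0 : tens Z H)).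
  apply: eq_tsum => p q.
  (* Multiplication of the second factor by S^-1(q), which carries the vanishing sum [h p] to the
     summand. *)
  pose G : {linear tens Z H -> tens Z H} := tmap idfun (mklin (lin_comp mH (lin_tpurel (iS q)
    (@lin_id k H)))).
  rewrite -(linear0 G) -(h p) linear_tsum; apply: eq_tsum => z t.
  by apply: esym; apply: tmapE.
by rewrite /tsum /fsum big1.
Qed.

Let yHU := ydalg_yd (smash_ydalg aH hU (harpoon_module_algebra hH hU hev)).

Lemma rho_ydm : @yd_morph k B (yd_tens U H) H rh.
Proof.
exact: (ydm_comp (ydm_lunit yH) (ydm_comp (ydm_tmap (ev_ydm hev) (ydm_id H))
  (ydm_comp (ydm_assocV U H H) (ydm_tmapr U (comul_ydm hH))))).
Qed.

Lemma lambda_inj w w' : (forall x, la (w \ox x) = la (w' \ox x)) -> w = w'.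
Proof. exact: (sep_inj (@lambda_sep)). Qed.

Lemma RL_lift : RL_condition ev -> exists g : {linear U -> smash hp},
  @yd_morph k B U (smash hp) g /\ forall u x, la (g u \ox x) = rh (u \ox x).
Proof.
move=> hRL.
have /choice [g gE] (u : U) : exists w : smash hp, forall x, la (w \ox x) = rh (u \ox x).
  by have [w e] := hRL u; exists w => x; rewrite -RL_lambdaE -e RL_rhoE.
have lg : linear g.
  move=> a u v; apply: lambda_inj => x; rewrite gE.
  have [bl _] := tpure_bilin U H; have [bl' _] := tpure_bilin (smash hp) H.
  by rewrite [in LHS]bl bl' !linearP /= !gE.
exists (mklin lg); split=> //.
refine (@transport_ydm k B U (smash hp) H la rh (mklin lg) yU yHU yH
  (smash_rep_ydm aH (harpoon_module_algebra hH hU hev)) rho_ydm gE (@lambda_sep)).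
Qed.
End Faithful.

(** * The convolution inverse of the lift g *)

Section Inverse.
Variables (k : fieldType) (B : hopfAlgebra k) (H U : hopfData B).
Hypotheses (hH : is_braided_hopf H) (hU : is_braided_hopf U).
Variable (ev : {linear tens U H -> k^o}).
Hypothesis hev : hopf_pairing ev.
Notation C V W := (@braid k B V W).
Hypothesis HC : forall t, C H H (C H H t) = t.
Variable iS : {linear H -> H}.
Hypotheses (SK : cancel (antipode H) iS) (iSK : cancel iS (antipode H)).
Notation mH := (alg_mul H).
Notation dH := (comul H).
Notation dU := (comul U).
Let aH := hopf_ydalg hH.
Let aU := hopf_ydalg hU.
Let yH := ydalg_yd aH.
Let yU := ydalg_yd aU.
Notation hp := (@harpoon k B H U ev).
Notation la := (@smash_rep k B H U hp).
Notation rh := (rho_act ev).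
Let iSm := iS_ydm hH SK iSK.

Lemma op_evS Q (t : tens U (tens H Q)) :
  op20 ev (op11 (antipode U) t) = op20 ev (tmap idfun (op11 (antipode H)) t).
Proof. by move: t; tpure f t; move: t; tpure x q; te; rewrite (ev_antipode hev). Qed.

Lemma op_ev1 Q (t : tens U Q) :
  op20 ev (tmap idfun (op01 (alg_one H)) t) = op10 (counit U) t.
Proof. by move: t; tpure f q; te; rewrite (ev_1r hev). Qed.

Section Words.
Variable Q : lmodType k.
Let ob (n : nat) : lmodType k := nth (H : lmodType k) [:: H : lmodType k; U : lmodType k] n.
Let sig : nat -> gen Q ob := nth (gen00 Q ob)
  [:: @gen21 k Q ob 0 0 0 mH;
      @gen12 k Q ob 0 0 0 dH;
      @gen01 k Q ob 0 (alg_one H);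
      @gen10 k Q ob 0 (counit H);
      @gen11 k Q ob 0 0 iS;
      @gen11 k Q ob 0 0 (antipode H);
      @gen11 k Q ob 1 1 (antipode U);
      @gen12 k Q ob 1 1 1 dU;
      @gen22 k Q ob 1 1 1 1 (braidV (V:=U) (W:=U));
      @gen20 k Q ob 1 0 ev;
      @gen21 k Q ob 1 0 0 rh;
      @gen22 k Q ob 0 0 0 0 (C H H);
      @gen22 k Q ob 1 0 0 1 (C U H);
      @gen22 k Q ob 1 1 1 1 (C U U)]%N.
Local Open Scope nat_scope.
Notation gmH := 0.
Notation gdH := 1.
Notation guH := 2.
Notation geH := 3.
Notation giS := 4.
Notation gSH := 5.
Notation gSU := 6.
Notation gdU := 7.
Notation gVV := 8.
Notation gev := 9.
Notation grh := 10.
Notation gHH := 11.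
Notation gUH := 12.
Notation gUU := 13.
Let ars := [:: ([:: 0; 0], [:: 0]); ([:: 0], [:: 0; 0]); ([::], [:: 0]); ([:: 0], [::]); ([:: 0],
  [:: 0]); ([:: 0], [:: 0]); ([:: 1], [:: 1]); ([:: 1], [:: 1; 1]); ([:: 1; 1], [:: 1; 1]); ([::
  1; 0], [::]); ([:: 1; 0], [:: 0]); ([:: 0; 0], [:: 0; 0]); ([:: 1; 0], [:: 0; 1]); ([:: 1; 1],
  [:: 1; 1])].
Let rhE : rule sig.
Proof. rule [:: 1; 0] : [:: (0, grh)] ~> [:: (1, gdH); (0, gev)] by (rho_op ev). Defined.
Let mA : rule sig.
Proof. rule [:: 0; 0; 0] : [:: (0, gmH); (0, gmH)] ~> [:: (1, gmH); (0, gmH)] by (op21A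
  (ydalg_mulA aH)). Defined.
Let der : rule sig.
Proof. rule [:: 0] : [:: (0, gdH); (1, geH)] ~> [::] by (op12_1r (counit_r hH)). Defined.
Let mul : rule sig.
Proof. rule [:: 0] : [:: (0, guH); (0, gmH)] ~> [::] by (op21_1l (ydalg_mul1l aH)). Defined.
Let Sl : rule sig.
Proof. rule [:: 0] : [:: (0, gdH); (0, gSH); (0, gmH)] ~> [:: (0, geH); (0, guH)] by (op_antipodel
  (antipode_l hH)). Defined.
Let evH : rule sig.
Proof. rule [:: 1; 0; 0] : [:: (1, gmH); (0, gev)] ~> [:: (0, gdU); (1, gUH); (0, gev); (0, gev)]
  by (op_ev_mulr hev). Defined.
Let evS : rule sig.
Proof. rule [:: 1; 0] : [:: (0, gSU); (0, gev)] ~> [:: (1, gSH); (0, gev)] by (op_evS). Defined.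
Let VU : rule sig.
Proof. rule [:: 1; 1] : [:: (0, gVV); (0, gUU)] ~> [::] by (op22_cancel (braidVK yU yU)). Defined.
Let nl_U_ev : rule sig.
Proof. rule [:: 1; 1; 0] : [:: (0, gUU); (1, gUH); (0, gev)] ~> [:: (1, gev)] by (braid_op20r yU
  (ev_ydm hev)). Defined.
Let nl_U_SH : rule sig.
Proof. rule [:: 1; 0] : [:: (1, gSH); (0, gUH)] ~> [:: (0, gUH); (0, gSH)] by (braid_op11r (X :=
  U) (antipode_ydm hH)). Defined.
Let nl_H_eH : rule sig.
Proof. rule [:: 0; 0] : [:: (0, gHH); (0, geH)] ~> [:: (1, geH)] by (braid_op10r yH (counit_ydm
  hH)). Defined.

(** By [lambda_ev] the left side is <sigma u, x>. Naturality of the evaluation undoes the inverse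
    braiding, and the pairings join to <u, S(p_1) p_2 S^-1(q)> with p (x) q = C (Delta x), which the
    antipode axiom reduces to <u, S^-1 x>. *)
Lemma op_sigma_word : weq sig [:: 1; 0] [:: (0, gdU); (0, gSU); (0, gVV); (2, gdH); (2, gHH); (1,
  grh); (2, giS); (1, gmH); (0, gev)]
  [:: (1, giS); (0, gev)].
Proof.
diagram ars [:: ([:: 5], 6, 1, rhE); ([:: 5; 6], 6, 0, rflip nl_U_ev);
    ([:: 2; 3; 4; 8; 7; 6; 5; 9; 8; 7; 6], 7, 0, VU); ([:: 1; 2; 3; 4; 5; 6; 8; 7], 8, 0, evS);
    ([:: 7], 6, 1, rflip nl_U_SH); ([:: 0; 1; 2; 3; 4; 5; 8], 6, 0, rflip evH);
    ([:: 4], 5, 1, rflip mA); ([:: 2], 3, 1, Sl); ([:: 2], 1, 1, nl_H_eH);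
    ([:: 2; 1; 0], 1, 2, der); ([:: 0], 1, 1, mul)] [::].
Qed.
End Words.

Lemma op_sigma Q (t : tens U (tens H Q)) :
  op20 ev (tmap idfun (op21 mH) (tmap idfun (tmap idfun (op11 iS)) (tmap idfun (op21 rh) (tmap
    idfun (tmap idfun (op22 (C H H))) (tmap idfun (tmap idfun (op12 dH)) (op22 (braidV (V:=U)
    (W:=U)) (op11 (antipode U) (op12 dU t)))))))) =
  op20 ev (tmap idfun (op11 iS) t).
Proof. word_eq (op_sigma_word t). Qed.

Section Convolution.
Variable g : {linear U -> smash hp}.
Hypothesis gE : forall u x, la (g u \ox x) = rh (u \ox x).
Notation HU := (smash hp).
Let aHU := smash_ydalg aH hU (harpoon_module_algebra hH hU hev).

(* The map sigma of the header. *)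
Definition lift_antipode_inv : U -> U :=
  op20 ev (X:=U) \o tmap idfun g \o braidV (V:=U) (W:=U) \o
  tmap (antipode U) idfun \o dU.
HB.instance Definition _ := GRing.Linear.on lift_antipode_inv.
Notation sg := lift_antipode_inv.

Lemma ev_lift u x : ev (sg u \ox x) = ev (u \ox iS x).
Proof.
have e1 (a : U) (w : tens H U) : ev (op20 ev (X:=U) (a \ox w) \ox x) =
    ev (a \ox \tsum_(h, f <- w) ((ev (f \ox x) : k) *: h)).
  move: w; tpure h f; rewrite tsumE; last by blin.
  by rewrite op20E tpureZl tpureZr [LHS]linearZ [RHS]linearZ /=; apply: mulrC.
have e (t : tens U U) : ev (op20 ev (X:=U) (tmap idfun g t) \ox x) =
   op20 ev (tmap idfun (op21 mH) (tmap idfun (tmap idfun (op11 iS))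
      (tmap idfun (op21 rh) (tmap idfun (tmap idfun (op22 (C H H)))
       (tmap idfun (tmap idfun (op12 dH)) (tassoc (t \ox (x \ox (1 : k^o))))))))).
  move: t; tpure a v; rewrite tmapE e1 (lambda_ev hH hU hev HC SK iSK); te.
  rewrite op22_tassoc /=; move: (C H H (dH x)); tpure p q; rewrite tsumE; last by blin.
  by te; rewrite gE; rewrite -[LHS]mulr1.
rewrite [LHS]e.
have := op_sigma (u \ox (x \ox (1 : k^o))); te.
have -> (s : tens U U) q : op22 (braidV (V:=U) (W:=U)) (op11 (antipode U) (tassoc (s \ox q))) =
    tassoc (braidV (V:=U) (W:=U) (tmap (antipode U) idfun s) \ox q) :> tens U (tens U (tens H k^o)).
  by move: s; tpure a b; te.
by move=> ->; rewrite -[RHS]mulr1.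
Qed.

Lemma op_ev_lift Q (t : tens U (tens H Q)) :
  op20 ev (op11 sg t) = op20 ev (tmap idfun (op11 iS) t).
Proof. by move: t; tpure f t; move: t; tpure x q; te; rewrite ev_lift. Qed.

Section Words.
Variable Q : lmodType k.
Let ob (n : nat) : lmodType k := nth (H : lmodType k) [:: H : lmodType k; U : lmodType k] n.
Let sig : nat -> gen Q ob := nth (gen00 Q ob)
  [:: @gen21 k Q ob 0 0 0 mH;
      @gen12 k Q ob 0 0 0 dH;
      @gen01 k Q ob 0 (alg_one H);
      @gen10 k Q ob 0 (counit H);
      @gen11 k Q ob 0 0 iS;
      @gen12 k Q ob 1 1 1 dU;
      @gen10 k Q ob 1 (counit U);
      @gen11 k Q ob 1 1 sg;
      @gen20 k Q ob 1 0 ev;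
      @gen21 k Q ob 1 0 0 rh;
      @gen22 k Q ob 0 0 0 0 (C H H)]%N.
Local Open Scope nat_scope.
Notation gmH := 0.
Notation gdH := 1.
Notation guH := 2.
Notation geH := 3.
Notation giS := 4.
Notation gdU := 5.
Notation geU := 6.
Notation gsg := 7.
Notation gev := 8.
Notation grh := 9.
Notation gHH := 10.
Let ars := [:: ([:: 0; 0], [:: 0]); ([:: 0], [:: 0; 0]); ([::], [:: 0]); ([:: 0], [::]); ([:: 0],
  [:: 0]); ([:: 1], [:: 1; 1]); ([:: 1], [::]); ([:: 1], [:: 1]); ([:: 1; 0], [::]); ([:: 1; 0],
  [:: 0]); ([:: 0; 0], [:: 0; 0])].
Let rhE : rule sig.
Proof. rule [:: 1; 0] : [:: (0, grh)] ~> [:: (1, gdH); (0, gev)] by (rho_op ev). Defined.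
Let dA : rule sig.
Proof. rule [:: 0] : [:: (0, gdH); (0, gdH)] ~> [:: (0, gdH); (1, gdH)] by (op12A (comul_assoc
  hH)). Defined.
Let del : rule sig.
Proof. rule [:: 0] : [:: (0, gdH); (0, geH)] ~> [::] by (op12_1l (counit_l hH)). Defined.
Let skl : rule sig.
Proof. rule [:: 0] : [:: (0, gdH); (0, gHH); (1, giS); (0, gmH)] ~> [:: (0, geH); (0, guH)] by
  (op_skewr hH HC SK iSK). Defined.
Let skr : rule sig.
Proof. rule [:: 0] : [:: (0, gdH); (0, gHH); (0, giS); (0, gmH)] ~> [:: (0, geH); (0, guH)] by
  (op_skewl hH HC SK iSK). Defined.
Let ev1 : rule sig.
Proof. rule [:: 1] : [:: (1, guH); (0, gev)] ~> [:: (0, geU)] by (op_ev1). Defined.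
Let sgE : rule sig.
Proof. rule [:: 1; 0] : [:: (0, gsg); (0, gev)] ~> [:: (1, giS); (0, gev)] by (op_ev_lift). Defined.
Let nest : rule sig.
Proof. rule [:: 1; 0; 0] : [:: (1, gHH); (1, gmH); (0, gev)] ~> [:: (0, gdU); (1, gev); (0, gev)]
  by (op_ev_nested hH hev). Defined.
Let nl_H_iS : rule sig.
Proof. rule [:: 0; 0] : [:: (1, giS); (0, gHH)] ~> [:: (0, gHH); (0, giS)] by (braid_op11r (X :=
  H) iSm). Defined.
Let nr_iS_H : rule sig.
Proof. rule [:: 0; 0] : [:: (0, giS); (0, gHH)] ~> [:: (0, gHH); (1, giS)] by (braid_op11l (X :=
  H) iSm). Defined.

(** The two pairings join by [nest] into one pairing of u with a crossed product, where the skew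
    antipode S^-1 leaves the counit. [op_sigma_rho_word] runs the same way with S^-1 on the other
    factor. *)
Lemma op_rho_sigma_word : weq sig [:: 1; 0] [:: (0, gdU); (1, gsg); (1, grh); (0, grh)]
  [:: (0, geU)].
Proof.
diagram ars [:: ([::], 3, 0, rhE); ([::], 2, 1, rhE); ([:: 1], 2, 1, sgE);
    ([:: 0; 1; 3; 2], 3, 0, rflip nest); ([:: 1], 2, 1, nr_iS_H); ([::], 0, 1, rflip dA);
    ([::], 1, 1, skl); ([::], 2, 0, ev1); ([:: 1; 0], 1, 0, del)] [::].
Qed.

Lemma op_sigma_rho_word : weq sig [:: 1; 0] [:: (0, gdU); (0, gsg); (1, grh); (0, grh)]
  [:: (0, geU)].
Proof.
diagram ars [:: ([::], 3, 0, rhE); ([::], 2, 1, rhE); ([:: 1; 2; 3], 4, 0, sgE);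
    ([:: 0; 2; 1; 3; 2], 3, 0, rflip nest); ([::], 2, 1, nl_H_iS); ([::], 0, 1, rflip dA);
    ([::], 1, 1, skr); ([::], 2, 0, ev1); ([:: 1; 0], 1, 0, del)] [::].
Qed.
End Words.

Lemma op_rho_sigma Q (t : tens U (tens H Q)) :
  op21 rh (tmap idfun (op21 rh) (tmap idfun (op11 sg) (op12 dU t))) =
  op10 (counit U) t.
Proof. word_eq (op_rho_sigma_word t). Qed.

Lemma op_sigma_rho Q (t : tens U (tens H Q)) :
  op21 rh (tmap idfun (op21 rh) (op11 sg (op12 dU t))) =
  op10 (counit U) t.
Proof. word_eq (op_sigma_rho_word t). Qed.

Lemma lambda_lift2 s x : la (alg_mul HU (tmap g g s) \ox x) \ox (1 : k^o) =
  op21 rh (tmap idfun (op21 rh) (tassoc (s \ox (x \ox (1 : k^o))))).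
Proof.
move: s; tpure a b; rewrite tmapE (smash_repM aH (harpoon_module_algebra hH hU hev)) !gE.
by te.
Qed.

(** Faithfulness turns the identity rho(u_1) rho(sigma u_2) = eps(u) of operators on H into one in H
    # U; with [lift_convl], g and g sigma are convolution inverses. *)
Lemma lift_convr u :
  alg_mul HU (tmap g g (tmap idfun sg (dU u))) = (counit U u : k) *: alg_one HU.
Proof.
apply: (lambda_inj hH hU hev HC SK iSK) => x; apply: tpure1_inj.
rewrite lambda_lift2 tpureZl linearZ /= (smash_rep_one aH (harpoon_module_algebra hH hU hev)).
have := op_rho_sigma (u \ox (x \ox (1 : k^o))); rewrite op12E op10E tpureZl => <-.
by congr (op21 _ (tmap _ _ _)); move: (dU u); tpure a b; te.
Qed.

Lemma lift_convl u :
  alg_mul HU (tmap g g (tmap sg idfun (dU u))) = (counit U u : k) *: alg_one HU.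
Proof.
apply: (lambda_inj hH hU hev HC SK iSK) => x; apply: tpure1_inj.
rewrite lambda_lift2 tpureZl linearZ /= (smash_rep_one aH (harpoon_module_algebra hH hU hev)).
have := op_sigma_rho (u \ox (x \ox (1 : k^o))); rewrite op12E op10E tpureZl => <-.
by congr (op21 _ (tmap _ _ _)); move: (dU u); tpure a b; te.
Qed.

Lemma lift_one : g (alg_one U) = alg_one HU.
Proof.
apply: (lambda_inj hH hU hev HC SK iSK) => x.
rewrite (smash_rep_one aH (harpoon_module_algebra hH hU hev)) gE -[RHS](counit_l hH x).
rewrite /rho_act; te; move: (dH x); tpure a b; te.
by rewrite (ev_1l hev).
Qed.
End Convolution.
End Inverse.

(** * The isomorphism *)

Section Isomorphism.
Variables (k : fieldType) (B : hopfAlgebra k) (H U : hopfData B) (R : algData B).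
Hypotheses (hH : is_braided_hopf H) (hU : is_braided_hopf U) (hR : is_ydalg R).
Variables (ev : {linear tens U H -> k^o}) (psi : {linear R -> tens R U}).
Hypotheses (hev : hopf_pairing ev) (hpsi : comodule_algebra psi).
Notation C V W := (@braid k B V W).
Hypothesis HC : forall t, C H H (C H H t) = t.
Variable iS : {linear H -> H}.
Hypotheses (SK : cancel (antipode H) iS) (iSK : cancel iS (antipode H)).
Notation mH := (alg_mul H).
Notation dH := (comul H).
Notation mR := (alg_mul R).
Notation hp := (@harpoon k B H U ev).
Notation al := (@coact_action k B H U ev R psi).
Notation RH := (smash al).
Notation be := (@extended_action k B H U ev R).
Notation X := (@smash k B RH U be).
Notation HU := (@smash k B H U hp).
Notation Y := (braided_tens R HU).
Notation mW := (alg_mul HU).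
Notation la := (@smash_rep k B H U hp).
Notation rh := (rho_act ev).
Let aH := hopf_ydalg hH.
Let aU := hopf_ydalg hU.
Let yH := ydalg_yd aH.
Let yU := ydalg_yd aU.
Let yR := ydalg_yd hR.
Let mhp := harpoon_module_algebra hH hU hev.
Let aHU := smash_ydalg aH hU mhp.
Let yHU := ydalg_yd aHU.
Let mal := alpha_module_algebra hH hU hR hev hpsi HC.
Let aRH := smash_ydalg hR hH mal.
Let mbe := beta_module_algebra hH hU hR hev hpsi.
Let aX := smash_ydalg aRH hU mbe.
Let aY := braided_tens_ydalg hR aHU.
Variable g : {linear U -> HU}.
Hypothesis gm : @yd_morph k B U HU g.
Hypothesis gE : forall u x, la (g u \ox x) = rh (u \ox x).
Notation sg := (lift_antipode_inv g).

Lemma op_lambdaM Q (t : tens HU (tens HU (tens H Q))) :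
  op21 la (op21 mW t) = op21 la (tmap idfun (op21 la) t).
Proof.
move: t; tpure a t; move: t; tpure b t; move: t; tpure x q; rewrite !op21E tmapE /= !op21E.
exact: (congr1 (fun z => z \ox q) (smash_repM aH mhp a b x)).
Qed.

Lemma op_liftE Q (t : tens U (tens H Q)) : op21 la (op11 g t) = op21 rh t.
Proof. by move: t; tpure u t; move: t; tpure x q; te; rewrite gE. Qed.

Lemma op_coact_counit Q (t : tens R Q) : tmap idfun (op10 (counit U)) (op12 psi t) = t.
Proof.
move: t; tpure r q; te; rewrite -[in RHS](coact_counit hpsi r).
by move: (psi r); tpure r0 u; te; rewrite tpureZl tpureZr.
Qed.

Lemma op_lift_convr Q (t : tens U Q) :
  op21 mW (tmap idfun (op11 g) (op11 g (tmap idfun (op11 sg) (op12 (comul U) t)))) =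
  op01 (alg_one HU) (op10 (counit U) t).
Proof.
move: t; tpure u q; rewrite op12E op10E op01E tpureZr -tpureZl.
rewrite -(lift_convr hH hU hev HC SK iSK gE).
by move: (comul U u); tpure a b; te.
Qed.

Lemma op_lift_convl Q (t : tens U Q) :
  op21 mW (tmap idfun (op11 g) (op11 g (op11 sg (op12 (comul U) t)))) =
  op01 (alg_one HU) (op10 (counit U) t).
Proof.
move: t; tpure u q; rewrite op12E op10E op01E tpureZr -tpureZl.
rewrite -(lift_convl hH hU hev HC SK iSK gE).
by move: (comul U u); tpure a b; te.
Qed.

Section Words.
Variable Q : lmodType k.
Let ob (n : nat) : lmodType k := nth (H : lmodType k) [:: H : lmodType k; U : lmodType k; R :
  lmodType k; HU : lmodType k] n.
Let sig : nat -> gen Q ob := nth (gen00 Q ob)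
  [:: @gen21 k Q ob 0 0 0 mH;
      @gen12 k Q ob 0 0 0 dH;
      @gen21 k Q ob 2 2 2 mR;
      @gen12 k Q ob 1 1 1 (comul U);
      @gen10 k Q ob 1 (counit U);
      @gen21 k Q ob 3 3 3 mW;
      @gen01 k Q ob 3 (alg_one HU);
      @gen12 k Q ob 2 2 1 psi;
      @gen21 k Q ob 1 0 0 hp;
      @gen21 k Q ob 0 2 2 al;
      @gen21 k Q ob 1 0 0 rh;
      @gen21 k Q ob 3 0 0 la;
      @gen11 k Q ob 1 3 g;
      @gen11 k Q ob 1 1 sg;
      @gen22 k Q ob 0 2 2 0 (C H R);
      @gen22 k Q ob 1 2 2 1 (C U R);
      @gen22 k Q ob 3 2 2 3 (C HU R)]%N.
Local Open Scope nat_scope.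
Notation gmH := 0.
Notation gdH := 1.
Notation gmR := 2.
Notation gdU := 3.
Notation geU := 4.
Notation gmW := 5.
Notation guW := 6.
Notation gpsi := 7.
Notation ghp := 8.
Notation gal := 9.
Notation grh := 10.
Notation gla := 11.
Notation gga := 12.
Notation gsg := 13.
Notation gHR := 14.
Notation gUR := 15.
Notation gWR := 16.
Let ars := [:: ([:: 0; 0], [:: 0]); ([:: 0], [:: 0; 0]); ([:: 2; 2], [:: 2]); ([:: 1], [:: 1; 1]);
  ([:: 1], [::]); ([:: 3; 3], [:: 3]); ([::], [:: 3]); ([:: 2], [:: 2; 1]); ([:: 1; 0], [:: 0]);
  ([:: 0; 2], [:: 2]); ([:: 1; 0], [:: 0]); ([:: 3; 0], [:: 0]); ([:: 1], [:: 3]); ([:: 1], [::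
  1]); ([:: 0; 2], [:: 2; 0]); ([:: 1; 2], [:: 2; 1]); ([:: 3; 2], [:: 2; 3])].
Let thl : rule sig.
Proof. rule [:: 0; 2; 0] : [:: (1, gpsi); (2, grh); (0, gdH); (1, gHR); (0, gal); (1, gmH)] ~> [::
  (0, gHR); (1, gmH); (0, gpsi); (1, grh)] by (op_theta_l hH hU hR hev hpsi HC). Defined.
Let thb : rule sig.
Proof. rule [:: 1; 2; 0] : [:: (1, gpsi); (2, grh); (0, gUR); (1, ghp)] ~> [:: (0, gUR); (1, ghp);
  (0, gpsi); (1, grh)] by (op_theta_beta hH hU hev hpsi). Defined.
Let thr : rule sig.
Proof. rule [:: 2; 2; 0] : [:: (0, gpsi); (1, gUR); (2, grh); (1, gpsi); (2, grh); (0, gmR)] ~>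
  [:: (0, gmR); (0, gpsi); (1, grh)] by (op_theta_r hH hU hev hpsi HC). Defined.
Let mWA : rule sig.
Proof. rule [:: 3; 3; 3] : [:: (0, gmW); (0, gmW)] ~> [:: (1, gmW); (0, gmW)] by (op21A
  (ydalg_mulA aHU)). Defined.
Let mWl : rule sig.
Proof. rule [:: 3] : [:: (0, guW); (0, gmW)] ~> [::] by (op21_1l (ydalg_mul1l aHU)). Defined.
Let laM : rule sig.
Proof. rule [:: 3; 3; 0] : [:: (0, gmW); (0, gla)] ~> [:: (1, gla); (0, gla)] by (op_lambdaM).
  Defined.
Let gaE : rule sig.
Proof. rule [:: 1; 0] : [:: (0, gga); (0, gla)] ~> [:: (0, grh)] by (op_liftE). Defined.
Let pA : rule sig.
Proof. rule [:: 2] : [:: (0, gpsi); (0, gpsi)] ~> [:: (0, gpsi); (1, gdU)] by (op_coactA hpsi).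
  Defined.
Let pe : rule sig.
Proof. rule [:: 2] : [:: (0, gpsi); (1, geU)] ~> [::] by (op_coact_counit). Defined.
Let cvr : rule sig.
Proof. rule [:: 1] : [:: (0, gdU); (1, gsg); (0, gga); (1, gga); (0, gmW)] ~> [:: (0, geU); (0,
  guW)] by (op_lift_convr). Defined.
Let cvl : rule sig.
Proof. rule [:: 1] : [:: (0, gdU); (0, gsg); (0, gga); (1, gga); (0, gmW)] ~> [:: (0, geU); (0,
  guW)] by (op_lift_convl). Defined.
Let nr_mW_R : rule sig.
Proof. rule [:: 3; 3; 2] : [:: (0, gmW); (0, gWR)] ~> [:: (1, gWR); (0, gWR); (1, gmW)] by
  (braid_op21l yR (ydalg_mul_ydm aHU)). Defined.
Let nr_ga_R : rule sig.
Proof. rule [:: 1; 2] : [:: (0, gga); (0, gWR)] ~> [:: (0, gUR); (1, gga)] by (braid_op11l (X :=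
  R) gm). Defined.

(** theta is moved past the action of U by [thb], then past that of H by [thl]; the factor in R
    multiplies from the left on both sides. *)
Lemma op_theta_word : weq sig [:: 2; 0; 1; 2; 0] [:: (3, gpsi); (4, grh); (2, gUR); (3, ghp); (1,
  gdH); (2, gHR); (1, gal); (0, gmR); (1, gmH)]
  [:: (2, gUR); (1, gHR); (3, ghp); (2, gmH); (1, gpsi); (2, grh); (0, gmR)].
Proof.
diagram ars [:: ([:: 3; 2; 1; 0], 1, 3, thb); ([:: 0; 1; 2; 3; 7], 2, 1, thl)] [:: 1].
Qed.

(** The lift g(r_1) acts as rho(r_1), which is the twist that [thr] absorbs when r is multiplied
    into theta. *)
Lemma op_intertwine_word : weq sig [:: 2; 3; 2; 0] [:: (0, gpsi); (1, gga); (1, gmW); (1, gWR);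
  (2, gla); (1, gpsi); (2, grh); (0, gmR)]
  [:: (1, gWR); (2, gla); (0, gmR); (0, gpsi); (1, grh)].
Proof.
diagram ars [:: ([::], 2, 1, nr_mW_R); ([:: 5; 4; 7; 6; 5], 6, 2, laM); ([:: 1; 5; 4; 3; 2], 3, 1,
  nr_ga_R);
    ([:: 4; 5], 6, 2, gaE); ([:: 0; 1; 5; 4; 6], 2, 0, thr)] [::].
Qed.

Lemma op_braided_repM_word : weq sig [:: 2; 3; 2; 3; 0] [:: (1, gWR); (0, gmR); (1, gmW); (1, gla)]
  [:: (3, gla); (1, gWR); (2, gla); (0, gmR)].
Proof.
diagram ars [:: ([::], 2, 1, laM)] [:: 1; 0; 2].
Qed.

(** Coassociativity of psi puts g sigma and g on the two factors of one coproduct, where they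
    cancel. *)
Lemma op_isoK_word : weq sig [:: 2; 3] [:: (0, gpsi); (1, gga); (1, gmW); (0, gpsi); (1, gsg); (1,
  gga); (1, gmW)]
  [::].
Proof.
diagram ars [:: ([:: 2; 3; 4], 5, 1, rflip mWA); ([:: 1], 0, 0, pA); ([:: 2; 3], 1, 1, cvl);
    ([::], 2, 1, mWl); ([::], 0, 0, pe)] [::].
Qed.

Lemma op_isoVK_word : weq sig [:: 2; 3] [:: (0, gpsi); (1, gsg); (1, gga); (1, gmW); (0, gpsi);
  (1, gga); (1, gmW)]
  [::].
Proof.
diagram ars [:: ([:: 3; 4], 5, 1, rflip mWA); ([:: 2; 1], 0, 0, pA); ([:: 3], 1, 1, cvr); ([::],
  2, 1, mWl);
    ([::], 0, 0, pe)] [::].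
Qed.
End Words.

Lemma op_theta Q (t : tens R (tens H (tens U (tens R (tens H Q))))) :
  tmap idfun (op21 mH) (op21 mR (tmap idfun (op21 al) (tmap idfun (tmap idfun (op22 (C H R)))
    (tmap idfun (op12 dH) (tmap idfun (tmap idfun (tmap idfun (op21 hp))) (tmap idfun (tmap idfun
    (op22 (C U R))) (tmap idfun (tmap idfun (tmap idfun (tmap idfun (op21 rh)))) (tmap idfun (tmap
    idfun (tmap idfun (op12 psi))) t)))))))) =
  op21 mR (tmap idfun (tmap idfun (op21 rh)) (tmap idfun (op12 psi) (tmap idfun (tmap idfun (op21
    mH)) (tmap idfun (tmap idfun (tmap idfun (op21 hp))) (tmap idfun (op22 (C H R)) (tmap idfun
    (tmap idfun (op22 (C U R))) t)))))).
Proof. word_eq (op_theta_word t). Qed.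

Lemma op_intertwine Q (t : tens R (tens HU (tens R (tens H Q)))) :
  op21 mR (tmap idfun (tmap idfun (op21 rh)) (tmap idfun (op12 psi) (tmap idfun (tmap idfun (op21
    la)) (tmap idfun (op22 (C HU R)) (tmap idfun (op21 mW) (tmap idfun (op11 g) (op12 psi t))))))) =
  tmap idfun (op21 rh) (op12 psi (op21 mR (tmap idfun (tmap idfun (op21 la)) (tmap idfun (op22 (C
    HU R)) t)))).
Proof. word_eq (op_intertwine_word t). Qed.

Lemma op_braided_repM Q (t : tens R (tens HU (tens R (tens HU (tens H Q))))) :
  tmap idfun (op21 la) (tmap idfun (op21 mW) (op21 mR (tmap idfun (op22 (C HU R)) t))) =
  op21 mR (tmap idfun (tmap idfun (op21 la)) (tmap idfun (op22 (C HU R)) (tmap idfun (tmap idfun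
    (tmap idfun (op21 la))) t))).
Proof. word_eq (op_braided_repM_word t). Qed.

Lemma op_isoK Q (t : tens R (tens HU Q)) :
  tmap idfun (op21 mW) (tmap idfun (op11 g) (tmap idfun (op11 sg) (op12 psi (tmap idfun (op21 mW)
    (tmap idfun (op11 g) (op12 psi t)))))) =
  t.
Proof. word_eq (op_isoK_word t). Qed.

Lemma op_isoVK Q (t : tens R (tens HU Q)) :
  tmap idfun (op21 mW) (tmap idfun (op11 g) (op12 psi (tmap idfun (op21 mW) (tmap idfun (op11 g)
    (tmap idfun (op11 sg) (op12 psi t)))))) =
  t.
Proof. word_eq (op_isoVK_word t). Qed.

Definition theta : tens R H -> tens R H := tmap idfun rh \o op12 psi (X:=H).
HB.instance Definition _ := GRing.Linear.on theta.

Lemma theta_op (Q : lmodType k) (m : tens R H) (q : Q) :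
  tmap idfun (op21 rh) (op12 psi (tassoc (m \ox q))) = tassoc (theta m \ox q).
Proof.
move: m; tpure r x; rewrite /theta; te.
by move: (psi r); tpure r0 u; te.
Qed.

Lemma theta_one x : theta (alg_one R \ox x) = alg_one R \ox x.
Proof.
rewrite /theta; te; rewrite (coact1 hpsi); te.
rewrite -gE (lift_one hH hU hev HC SK iSK gE).
by rewrite (smash_rep_one aH mhp).
Qed.

Notation L := (@smash_rep k B RH U be).

(** In (R # H) # U, the element r # w acts on theta m as w acts on m in the braided sense, followed
    by theta and multiplication by r. The twist by r_1 is not present yet; it enters with
    [iso_fun]. *)
Lemma smash_rep_theta (Q : lmodType k) (y : tens R HU) (m : tens R H) (q : Q) :
  tassoc (L (tassocV y \ox theta m) \ox q) =
  op21 mR (tmap idfun (tmap idfun (op21 rh)) (tmap idfun (op12 psi)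
    (tmap idfun (tmap idfun (op21 la)) (tmap idfun (op22 (C HU R))
      (tassoc (y \ox tassoc (m \ox q))))))).
Proof.
move: y; tpure r w; move: w; tpure h f; move: m; tpure s x.
have eL : tmap idfun (op21 mH (X:=Q)) (op21 mR (r \ox op21 al (tmap idfun (op22 (C H R))
     (op12 dH (h \ox tmap idfun (op21 hp (X:=Q)) (op22 (C U R) (f \ox
       tmap idfun (op21 rh (X:=Q)) (op12 psi (s \ox (x \ox q)))))))))) =
   tassoc (L (tassocV (r \ox (h \ox f)) \ox theta (s \ox x)) \ox q).
  rewrite tassocVE smash_repE -smash_mul_op -beta_op -theta_op !tassocE.
  by rewrite ![tmap idfun _ (r \ox _)]tmapE /=.
have eR : tmap idfun (op21 la (X:=Q)) (op22 (C HU R) ((h \ox f) \ox (s \ox (x \ox q)))) =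
   tmap idfun (op21 mH (X:=Q)) (tmap idfun (tmap idfun (op21 hp (X:=Q)))
     (op22 (C H R) (h \ox op22 (C U R) (f \ox (s \ox (x \ox q)))))).
  rewrite !op22E /= (braid_hexl _ _ _ yR).
  move: (C U R _); tpure s' f'; te.
  move: (C H R _); tpure s0 h'; te.
  by rewrite smash_repE.
rewrite -eL !tassocE ![tmap idfun _ (r \ox _)]tmapE /=; rewrite /= in eR; rewrite eR.
have := op_theta (r \ox (h \ox (f \ox (s \ox (x \ox q))))).
by rewrite ![tmap idfun _ (r \ox _)]tmapE /= ![tmap idfun _ (h \ox _)]tmapE /= ![tmap idfun _ (f
  \ox _)]tmapE.
Qed.

Definition iso_fun : tens R HU -> tens R HU :=
  tmap idfun (mW \o tmap g idfun) \o op12 psi (X:=HU).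
HB.instance Definition _ := GRing.Linear.on iso_fun.
Definition iso_inv : tens R HU -> tens R HU :=
  tmap idfun (mW \o tmap g idfun \o tmap sg idfun) \o op12 psi (X:=HU).
HB.instance Definition _ := GRing.Linear.on iso_inv.

Lemma iso_fun_op (Q : lmodType k) (y : tens R HU) (q : Q) :
  tmap idfun (op21 mW) (tmap idfun (op11 g) (op12 psi (tassoc (y \ox q)))) =
  tassoc (iso_fun y \ox q).
Proof.
move: y; tpure r w; rewrite tassocE op12E /iso_fun /= op12E.
by move: (psi r); tpure r0 u; te.
Qed.

Lemma iso_inv_op (Q : lmodType k) (y : tens R HU) (q : Q) :
  tmap idfun (op21 mW) (tmap idfun (op11 g) (tmap idfun (op11 sg)
    (op12 psi (tassoc (y \ox q))))) =
  tassoc (iso_inv y \ox q).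
Proof.
move: y; tpure r w; rewrite tassocE op12E /iso_inv /= op12E.
by move: (psi r); tpure r0 u; te.
Qed.

Lemma iso_funK : cancel iso_fun iso_inv.
Proof. by move=> y; apply: tail1_inj; rewrite /= -iso_inv_op -iso_fun_op; apply: op_isoK. Qed.

Lemma iso_invK : cancel iso_inv iso_fun.
Proof. by move=> y; apply: tail1_inj; rewrite /= -iso_fun_op -iso_inv_op; apply: op_isoVK. Qed.

(** The action of R (x) (H # U) on R (x) H, restricted to the vectors 1 (x) x, which already
    separate its elements. *)
Definition braided_rep (y : tens R HU) (x : H) : tens R H := tmap idfun la (tassoc (y \ox x)).

Lemma braided_rep_inj (y z : tens R HU) :
  (forall x, braided_rep y x = braided_rep z x) -> y = z.
Proof.
move=> h; apply/eqP; rewrite -subr_eq0; apply/eqP.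
apply: (lambda_sep hH hU hev HC SK iSK) => x.
rewrite tsumB; last by blin.
have e (s : tens R HU) : \tsum_(r, t <- s) (r \ox la (t \ox x)) = braided_rep s x.
  by rewrite /braided_rep; move: s; tpure r t; rewrite tsumE; [te|blin].
by rewrite !e h subrr.
Qed.

(** theta fixes 1 (x) x, so on these vectors an element of (R # H) # U acts as its reassociation
    does, and the faithfulness carries over. *)
Lemma smash_rep_one_l (y : tens R HU) x :
  L (tassocV y \ox (alg_one R \ox x)) = braided_rep y x.
Proof.
apply: tail1_inj; rewrite /= -{1}theta_one smash_rep_theta /braided_rep.
move: y; tpure r w; te.
rewrite (braid_invr _ yHU (ydalg_one_inv hR)); te; rewrite (coact1 hpsi); te.
rewrite -gE (lift_one hH hU hev HC SK iSK gE) (smash_rep_one aH mhp).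
by rewrite (ydalg_mul1r hR).
Qed.

(** The hypothesis says that y takes m to n in the natural action of R (x) (H # U); it is kept in
    tail form to match [op_intertwine]. *)
Lemma smash_rep_iso (y : tens R HU) (m n : tens R H) :
  op21 mR (tmap idfun (tmap idfun (op21 la)) (tmap idfun (op22 (C HU R))
      (tassoc (y \ox tassoc (m \ox (1 : k^o)))))) = tassoc (n \ox (1 : k^o)) ->
  L (tassocV (iso_fun y) \ox theta m) = theta n.
Proof.
move=> e; apply: tail1_inj; rewrite /= smash_rep_theta -iso_fun_op -theta_op -e.
exact: op_intertwine.
Qed.

Lemma smash_rep_iso1 y x : L (tassocV (iso_fun y) \ox theta (alg_one R \ox x)) = theta
  (braided_rep y x).
Proof.
apply: smash_rep_iso; rewrite /braided_rep; move: y; tpure r w; te.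
by rewrite (braid_invr _ yHU (ydalg_one_inv hR)); te; rewrite (ydalg_mul1r hR).
Qed.

(** Both sides are compared on 1 (x) x = theta (1 (x) x), where each equals theta of the result of
    acting by z and then by y. *)
Lemma iso_funM (y z : tens R HU) :
  tassocV (iso_fun (alg_mul Y (y \ox z))) =
  alg_mul X (tassocV (iso_fun y) \ox tassocV (iso_fun z)).
Proof.
apply: (can_inj (@tassocK k R H U)); rewrite tassocVK; apply: braided_rep_inj => x.
rewrite -!smash_rep_one_l tassocK (smash_repM aRH mbe) -theta_one !smash_rep_iso1.
apply: esym; apply: smash_rep_iso.
have brE (u : tens R HU) : tmap idfun (op21 la (X:=k^o)) (tassoc (u \ox (x \ox 1))) =
    tassoc (braided_rep u x \ox 1).
  by rewrite /braided_rep; move: u; tpure r w; te.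
have mulE q : tmap idfun (op21 mW) (op21 mR (tmap idfun (op22 (C HU R))
    (tassoc (y \ox tassoc (z \ox q))))) = tassoc (alg_mul Y (y \ox z) \ox q) :> tens R (tens HU
      (tens H k^o)).
  exact: (esym (twist_opE mR mW (C HU R) y z q)).
have := op_braided_repM (tassoc (y \ox tassoc (z \ox (x \ox (1 : k^o))))).
rewrite mulE brE => ->; congr (op21 _ (tmap _ _ (tmap _ _ _))).
by rewrite -brE; apply: esym; apply: (@tassoc_tail k R HU _ _ (tmap idfun (op21 la (X:=k^o)))).
Qed.

(** The isomorphism out of the smash product is the inverse of the map shown to be multiplicative,
    hence is built from [iso_inv]. *)
Definition Phi : X -> Y := iso_inv \o @tassoc k R H U.
HB.instance Definition _ := GRing.Linear.on Phi.
Definition Psi : Y -> X := @tassocV k R H U \o iso_fun.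
HB.instance Definition _ := GRing.Linear.on Psi.

Lemma PhiK : cancel Phi Psi.
Proof. by move=> t; rewrite /Phi /Psi /= iso_invK tassocK. Qed.
Lemma PsiK : cancel Psi Phi.
Proof. by move=> t; rewrite /Phi /Psi /= tassocVK iso_funK. Qed.

Lemma PsiM t : Psi (alg_mul Y t) = alg_mul X (tmap Psi Psi t).
Proof. by move: t; tpure y z; rewrite tmapE; apply: iso_funM. Qed.

Lemma Psi1 : Psi (alg_one Y) = alg_one X.
Proof.
have -> : alg_one Y = alg_one R \ox alg_one HU by rewrite /alg_one /=; te.
have e : iso_fun (alg_one R \ox alg_one HU) = alg_one R \ox mW (g (alg_one U) \ox alg_one HU).
  by rewrite /iso_fun /= op12E (coact1 hpsi) tassocE tmapE /= tmapE.
rewrite -[LHS]/(tassocV (iso_fun _)) e (lift_one hH hU hev HC SK iSK gE) (ydalg_mul1l aHU)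
  !smash_one.
by rewrite tassocVE.
Qed.

Lemma Psi_ydm : @yd_morph k B Y X Psi.
Proof.
exact: (ydm_comp (ydm_assocV R H U) (ydm_comp (ydm_tmapr R (ydm_comp (ydalg_mul_ydm aHU)
    (ydm_tmap gm (ydm_id HU)))) (ydm_comp (ydm_assoc R U HU)
    (ydm_tmap (psi_ydm hpsi) (ydm_id HU))))).
Qed.

Lemma Phi_iso : ydalg_iso (X := X) (Y := Y) Phi.
Proof.
split=> //.
- split=> [t|]; last by apply: (can_inj PsiK); rewrite PhiK Psi1.
  apply: (can_inj PsiK); rewrite PhiK PsiM; congr (alg_mul X _).
  by move: t; tpure a b; rewrite !tmapE /= !PhiK.
- exact: (@ydm_can k B Y X Psi Phi PsiK PhiK Psi_ydm).
by exists Psi; [apply: PhiK|apply: PsiK].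
Qed.

End Isomorphism.

(** * The evaluation of the finite dual, and of its braided Hopf subalgebras, as a Hopf pairing *)

Section Pairings.
Variables (k : fieldType) (B : hopfAlgebra k) (H D U : hopfData B).
Hypothesis hH : is_braided_hopf H.
Notation C V W := (@braid k B V W).

(** The antipode in the action on the dual makes the evaluation linear over B, and S^-1 in the
    coaction makes it colinear. *)
Lemma finite_dual_pairing (evd : {linear tens D H -> k^o}) :
  is_finite_dual evd -> hopf_pairing evd.
Proof.
case=> hD [sep _] [eact ecoact] [emulr ecounit emull eone] eanti.
have yH := ydalg_yd (hopf_ydalg hH); have yD := ydalg_yd (hopf_ydalg hD).
have [a1 aM _ _ _] := yH; have [_ _ _ c1 _] := yH.
split=> //; first split.
- move=> b; tpure f x; rewrite act_tens linear_tsum /=; te.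
  under eq_tsum => b1 b2 do rewrite eact -aM.
  rewrite (antipodeB_l (F := fun z => evd (f \ox yd_act H (z \ox x)))); last by lin.
  by rewrite a1.
- tpure f x; rewrite coact_tens /=.
  transitivity (\tsum_(c, x0 <- yd_coact H x) \tsum_(d, y <- yd_coact H x0)
     ((antipodeB_inv d * c) \ox evd (f \ox y))).
    rewrite -[LHS]/((1 : B) \ox (evd (f \ox x) : k^o)).
    rewrite -(coact_assoc (G := fun c d y => (antipodeB_inv d * c) \ox evd (f \ox y))) //;
      try by move=> *; lin.
    under eq_tsum => c y do
      [rewrite (antipodeB_invl (F := fun z => z \ox evd (f \ox y))); last by lin].
    rewrite -{1}(c1 x); move: (yd_coact H x); tpure b x0.
    by rewrite tsumE; [te; rewrite tpureZr [evd _]linearZ tpureZr|blin].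
  transitivity (\tsum_(b, g <- yd_coact D f) \tsum_(c, x0 <- yd_coact H x)
    ((b * c) \ox (evd (g \ox x0) : k^o))); last first.
    rewrite linear_tsum; apply: eq_tsum => b g; rewrite linear_tsum.
    by apply: eq_tsum => c x0; te.
  rewrite exch_tsum; apply: eq_tsum => c x0.
  (* The clause on the coaction is an identity in B; G carries it to B (x) k after multiplication by
     c. *)
  pose G := mklin (lin_tpurel (1 : k^o) (lin_mull c (@lin_id k B))).
  have eG (a : k^o) z : z * c \ox a = G ((a : k) *: z).
    by rewrite linearZ /= -tpureZr; congr (_ \ox _); rewrite -[LHS]mulr1.
  under eq_tsum do rewrite eG; under [RHS]eq_tsum do rewrite eG.
  by rewrite -!linear_tsum ecoact.
by move=> f x y; rewrite -emulr.
Qed.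

(** j is a morphism, so naturality exchanges C_(U,H) and C_(D,H) in the formulas for products and
    coproducts; separation is inherited because j is injective. *)
Lemma hopf_incl_pairing (evd : {linear tens D H -> k^o}) (j : {linear U -> D})
    (ev : {linear tens U H -> k^o}) :
  hopf_pairing evd -> is_yd U -> is_yd H -> hopf_incl j ->
  (forall f x, ev (f \ox x) = evd (j f \ox x)) -> hopf_pairing ev.
Proof.
case=> md emulr emull e1r e1l eanti sep yU yH [inj_j mj [jM j1] jd [jc jS]] e.
have e2 s t : tlunit (tmap ev ev (tmid (C U H) (s \ox t))) =
   tlunit (tmap evd evd (tmid (C D H) (tmap j j s \ox t))) :> k^o.
  move: s; tpure f g; move: t; tpure x y; te; rewrite !tmidE /=.
  rewrite -[x in RHS]/(idfun x) (braid_nat g x mj (ydm_id H)).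
  by move: (C U H _); tpure x' g'; te; rewrite !e.
split=> [|f x y|f g x|f|x|f x|f h].
- have m : @yd_morph k B (yd_tens U H) (yd_unit B) (fun t => evd (tmap j idfun t)).
    exact: (ydm_comp md (ydm_tmap mj (ydm_id H))).
  by apply: (eq_ydm _ m) => t; move: t; tpure f x; te; rewrite e.
- by rewrite e emulr jd e2.
- by rewrite e jM tmapE emull e2 tmapE.
- by rewrite e e1r jc.
- by rewrite e j1 e1l.
- by rewrite e -jS eanti e.
apply: inj_j; rewrite linear0; apply: sep => x; rewrite -e; exact: h.
Qed.
End Pairings.

Theorem corollary2p5 (k : fieldType) (B : hopfAlgebra k)
    (H : hopfData B) (hH : is_braided_hopf H)
    (HCsym : forall t : tens H H, @braid k B H H (@braid k B H H t) = t)
    (HS : bijective (antipode H))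
    (* the finite dual Hd of H, with its evaluation *)
    (Hd : hopfData B) (evd : {linear tens Hd H -> k^o})
    (hHd : is_finite_dual evd)
    (* the braided Hopf subalgebra U of Hd *)
    (U : hopfData B) (hU : is_braided_hopf U)
    (j : {linear U -> Hd}) (hj : hopf_incl j)
    (ev : {linear tens U H -> k^o})
    (hev : forall (f : U) (x : H), ev (tpure f x) = evd (tpure (j f) x))
    (hRL : RL_condition ev)
    (R : algData B) (hR : is_ydalg R)
    (psi : {linear R -> tens R U}) (hpsi : comodule_algebra psi) :
  let alpha : {linear tens H R -> R} := coact_action ev psi in
  let RH : algData B := smash alpha in
  let beta : {linear tens U RH -> RH} := @extended_action k B H U ev R in
  let HU : algData B := @smash k B H U (harpoon ev) in
  [/\ module_algebra alpha,
      @module_algebra k B U H (harpoon ev),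
      module_algebra beta
    & exists Phi : {linear smash beta -> braided_tens R HU},
        kalg_iso Phi /\
        (commutativeB B -> cocommutativeB B -> ydalg_iso Phi) ].
Proof.
have [iS0 SK iSK] := HS.
have lS : linear iS0.
  by move=> a x y; apply: (can_inj SK); rewrite linearP !iSK.
pose iS := mklin lS.
have pev : hopf_pairing ev.
  exact: (hopf_incl_pairing (finite_dual_pairing hH hHd) (ydalg_yd (hopf_ydalg hU))
    (ydalg_yd (hopf_ydalg hH)) hj hev).
have [g [gm gE]] := RL_lift hH hU pev HCsym (iS := iS) SK iSK hRL.
have [iX iY mP dP bP] := Phi_iso hH hU hR pev hpsi HCsym (iS := iS) SK iSK gm gE.
split.
- exact: alpha_module_algebra.
- exact: harpoon_module_algebra.
- exact: beta_module_algebra.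
exists (Phi g); split=> [|_ _]; last by split.
by split=> //; [case: iX|case: iY].
Qed.
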